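(* Let $p\in(0,1)$ be fixed and let $G_{n;\nu_1\ldots\nu_m}(p)$ be the random $m$-partite graph on $[n]$ with parts $V_1,\dots,V_m$, $m=m(n)\ge 2$, of sizes $|V_i|=n\nu_i(n)$. Suppose that $\lim_{n\to\infty}\max\{\nu_1(n),\dots,\nu_m(n)\}>0$ and that there exist $i,j$ with $\lim_{n\to\infty}\nu_i(n)/\nu_j(n)<1$. Suppose the parts are labelled so that, for some fixed $r\ge1$, $|V_1|,\dots,|V_r|$ are of order $n$ (i.e. $\nu_1,\dots,\nu_r$ are bounded below by a positive constant for large $n$), while $|V_{r+1}|,\dots,|V_m|$ are of order $o(n)$ (i.e. $\max_{s>r}\nu_s(n)\to0$). Then almost every random graph $G_{n;\nu_1\ldots\nu_m}(p)$ satisfies $$\left(1-\sum_{i=1}^r\nu_i^{3/2}\right)n^{3/2}\le\mathscr{E}(G_{n;\nu_1\ldots\nu_m}(p))\left(\frac{8}{3\pi}\sqrt{p(1-p)}+o(1)\right)^{-1}\le\left(1+\sum_{i=1}^r\nu_i^{3/2}\right)n^{3/2}.$$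
   Context: For a simple graph $G$ with adjacency matrix eigenvalues $\lambda_1,\dots,\lambda_n$ (with multiplicity), the energy is $\mathscr{E}(G)=\sum_{i=1}^n|\lambda_i|$. For each $n$, $[n]=\{1,\dots,n\}$ is partitioned into nonempty parts $V_1,\dots,V_m$; the random $m$-partite graph $G_{n;\nu_1\ldots\nu_m}(p)$ is obtained by including each edge of the complete $m$-partite graph with parts $V_1,\dots,V_m$ independently with probability $p$ (no edges inside parts). ''Almost every'' graph has a property if its probability tends to $1$ as $n\to\infty$; the statement with $o(1)$ means: for every $\varepsilon>0$, with probability tending to $1$ there is a number $\eta$ with $|\eta|\le\varepsilon$ such that the displayed inequalities hold with $o(1)$ replaced by $\eta$. *)

(* Defs.v *)
From mathcomp Require Import all_boot all_order all_algebra.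
From mathcomp Require Import all_classical all_reals all_analysis.

Set Implicit Arguments.
Unset Strict Implicit.
Unset Printing Implicit Defensive.

Import Order.TTheory GRing.Theory Num.Theory.
Import numFieldNormedType.Exports.

Local Open Scope ring_scope.

(* A simple graph on the vertex set 'I_n is given by its set of edges, each edge
   being the unordered pair [set u; v] of its ends; [set u; u] is a singleton,
   so (u != v) rules out loops. *)
Definition adjmx (R : realType) (n : nat) (G : {set {set 'I_n}}) : 'M[R]_n :=
  \matrix_(u < n, v < n) ((u != v) && ([set u; v]%SET \in G))%:R.

(* sum of |x| over the eigenvalues x of the adjacency matrix, each counted with
   its multiplicity as a root of the characteristic polynomial; see energyE *)
Definition energy (R : realType) (n : nat) (G : {set {set 'I_n}}) : R :=
  \sum_(x \in [set x | eigenvalue (adjmx R G) x]%classic)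
     `|x| *+ mup x (char_poly (adjmx R G)).

Lemma energyE (R : realType) (n : nat) (G : {set {set 'I_n}}) (s : seq R) :
  char_poly (adjmx R G) = \prod_(x <- s) ('X - x%:P) ->
  energy R G = \sum_(x <- s) `|x|.
Proof.
move=> sE; rewrite /energy sE -[RHS]big_undup_iterop_count /=.
have -> : [set x | eigenvalue (adjmx R G) x]%classic
        = [set` undup s]%classic.
  apply/seteqP; split=> x /=;
  by rewrite eigenvalue_root_char sE root_prod_XsubC mem_undup.
rewrite -fsbig_seq ?undup_uniq //.
by apply: eq_bigr => x _; rewrite mu_prod_XsubC.
Qed.

(* V 0, ..., V m.-1 are the m parts of a partition of 'I_n into nonempty sets;
   the values of V beyond m.-1 are irrelevant. *)
Definition is_parts (n m : nat) (V : nat -> {set 'I_n}) : Prop :=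
  {in gtn m &, injective V} /\
  finset.partition [set V i | i : 'I_m]%SET [set: 'I_n]%SET.

Definition multipartite_edges (n m : nat) (V : nat -> {set 'I_n}) :
    {set {set 'I_n}} :=
  [set e : {set 'I_n} |
    [exists i : 'I_m, exists j : 'I_m, exists u in V i, exists v in V j,
       (i != j) && (e == [set u; v])]]%SET.

(* Each edge of K is present with probability p, independently of the others. *)
Definition edge_mass (R : realType) (n : nat) (p : R)
    (K G : {set {set 'I_n}}) : R :=
  \prod_(e in K) (if e \in G then p else 1 - p).

Definition edge_prob (R : realType) (n : nat) (p : R) (K : {set {set 'I_n}})
    (Q : {set {set 'I_n}} -> Prop) : R :=
  \sum_(G : {set {set 'I_n}} | (G \subset K) && `[< Q G >]) edge_mass p K G.

Lemma edge_prob_True (R : realType) (n : nat) (p : R) (K : {set {set 'I_n}}) :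
  edge_prob p K (fun=> True) = 1.
Proof.
have : \prod_e ((if e \in K then p else 0) + (if e \in K then 1 - p else 1))
     = 1 :> R.
  by apply: big1 => e _; case: ifP => _; rewrite ?add0r // addrC subrK.
rewrite bigA_distr => <-.
transitivity (\sum_(G : {set {set 'I_n}}) \prod_e
    (if e \in G then if e \in K then p else 0
     else if e \in K then 1 - p else 1)); last by apply: eq_bigl.
rewrite [RHS](bigID (fun G : {set {set 'I_n}} => G \subset K)) /=.
rewrite [X in _ = _ + X]big1 ?addr0 => [|G /subsetPn[e eG eNK]]; last first.
  by rewrite (bigD1 e) //= eG (negPf eNK) mul0r.
apply: eq_big => [G|G /andP[GK _]]; first by rewrite asboolT ?andbT.
rewrite /edge_mass big_mkcond; apply: eq_bigr => e _.
by case: (boolP (e \in K)) => // eNK; rewrite ifN //;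
  apply: contra eNK; apply: (fintype.subsetP GK).
Qed.

Definition almost_every (R : realType) (p : R) (m : nat -> nat)
    (V : forall n, nat -> {set 'I_n})
    (Q : forall n, {set {set 'I_n}} -> Prop) : Prop :=
  (edge_prob p (multipartite_edges (m n) (V n)) (Q n) @[n --> \oo]
     --> (1 : R))%classic.

Definition part_frac (R : realType) (n : nat) (V : nat -> {set 'I_n})
    (i : nat) : R :=
  #|V i|%:R / n%:R.

(* Main.v *)
(* Centering the entries writes the adjacency matrix of the m-partite graph as
   W - sum_k W_(V_k) plus a mean of trace norm O(n), where W is the centered
   adjacency matrix of the binomial graph on [n] and W_(V_k) its diagonal blocks.
   The trace norm is subadditive, so the theorem follows from
   |W_U|_1 = (8 / (3 pi) sqrt (p (1 - p)) + o(1)) |U|^(3/2) in probability,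
   with an o(n^(3/2)) error that is uniform in U; the small parts are bounded by
   Cauchy-Schwarz.

   The expectation of |W_U|_1 is computed with Coulson's formula
   pi / 2 |x| = int_0^oo x^2 / (x^2 + s^2) ds from the resolvent of W_U on the
   imaginary axis.  A two-point Stein formula and the Efron-Stein inequality give
   the equation y^2 + tau y = |U| / n of the semicircle law for the rescaled trace
   of the resolvent, and int_0^oo y^2 dtau = 4 / 3 (|U| / n)^(3/2).  Efron-Stein
   also concentrates |W_U|_1, since one edge changes it by at most 2.

   If the largest part U has n - o(n) vertices, then 1 - sum nu_i^(3/2) tends to 0
   and additive errors o(n^(3/2)) do not give the lower bound.  There the second
   and fourth moments of the block between U and its complement show that the
   energy is at least about 2 sqrt (p (1 - p)) (n - |U|) sqrt n. *)

Require Import Defs.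
From mathcomp Require Import all_boot all_order all_algebra spectral.
From mathcomp Require Import all_classical all_reals all_analysis.
From mathcomp Require Import ring lra complex.

Set Implicit Arguments.
Unset Strict Implicit.
Unset Printing Implicit Defensive.

Import Order.TTheory GRing.Theory Num.Theory.
Import numFieldNormedType.Exports.

Local Open Scope ring_scope.

(** * Orthogonal diagonalization over a real closed field *)

Section Spectral.
Variable R : rcfType.

(** No integral is formed. The error in the equation for the resolvent blows up as tau tends to 0,
    so both integrals are compared with Riemann sums over a grid h, 2 h, ..., N h that avoids 0 and
    does not depend on n: h is chosen first, then N, and only then does n grow. The error bounds
    never depend on which set U is taken; this uniformity is needed because the parts change with n.

    Efron-Stein is strong enough because toggling one edge is a perturbation of rank two: the row
    bounds of the resolvent keep the change of a partial trace over U below a constant times t^-2,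
    whatever the size of U.

    The case of a dominating part has numerical room. Since 1 - nu^(3/2) <= 3/2 (1 - nu), the
    constant to reach is 8 / (3 pi) * 3/2 = 4 / pi, about 1.27, while the block provides nearly 2.
    The intermediate value 27/20 leaves space for crude Markov thresholds, at the price of an
    explicit lower bound on pi. *)

Lemma row_sqnE n (u : 'rV[R]_n) :
  u *m u^T = (\sum_i u 0 i ^+ 2)%:M.
Proof.
apply/rowP => i; rewrite !mxE ord1 eqxx mulr1n.
by apply: eq_bigr => j _; rewrite !mxE expr2.
Qed.

Lemma row_sqn_ge0 n (u : 'rV[R]_n) : 0 <= \sum_i u 0 i ^+ 2.
Proof. by apply: sumr_ge0 => i _; exact: sqr_ge0. Qed.

Lemma row_sqn_gt0 n (u : 'rV[R]_n) : u != 0 -> 0 < \sum_i u 0 i ^+ 2.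
Proof.
move=> u0; rewrite lt_neqAle row_sqn_ge0 andbT eq_sym.
apply: contra u0 => /eqP /psumr_eq0P u0; apply/eqP/rowP => i.
by rewrite mxE; apply/eqP; rewrite -sqrf_eq0 u0 // => j _; exact: sqr_ge0.
Qed.

(** Over the complexification [A] is Hermitian, so its spectral diagonal is real; the resulting root
    of the characteristic polynomial descends to [R] along the injection [real_complex]. *)
Lemma sym_eigenvalue n (A : 'M[R]_n.+1) : A^T = A -> exists a, eigenvalue A a.
Proof.
move=> sA; pose AC := map_mx (real_complex R) A.
have hA : AC \is hermsymmx.
  apply: realsym_hermsym; last first.
    by apply/mxOverP => i j; rewrite mxE; apply/complex_realP; exists (A i j).
  by apply/is_hermitianmxP; rewrite expr0 scale1r map_mx_id // /AC map_trmx sA.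
have /mxOverP/(_ 0 0)/complex_realP[a spa] := hermitian_spectral_diag_real hA.
have /orthomx_spectralP AE := hermitian_normalmx hA.
exists a; rewrite eigenvalue_root_char -(fmorph_root (real_complex R)).
rewrite map_char_poly -/AC -eigenvalue_root_char.
apply/eigenvalueP; exists (row 0 (spectralmx AC)).
  rewrite -row_mul {2}AE !mulmxA mulmxV ?spectral_unit // mul1mx row_mul.
  by rewrite row_diag_mx -scalemxAl -rowE spa.
apply/eqP => /(congr1 (mulmx^~ (invmx (spectralmx AC)))).
rewrite -row_mul mulmxV ?spectral_unit // mul0mx => /rowP/(_ 0).
by rewrite !mxE eqxx => /eqP; rewrite oner_eq0.
Qed.

(* The Householder reflection in the hyperplane bisecting v and the first
   basis vector exchanges them. *)
Lemma orthogonal_completion n (v : 'rV[R]_n.+1) : v *m v^T = 1%:M ->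
  exists2 P : 'M[R]_n.+1, P *m P^T = 1%:M & row 0 P = v.
Proof.
move=> vv; have [->|wn0] := eqVneq v (delta_mx 0 0).
  by exists 1%:M; rewrite ?trmx1 ?mul1mx // row1.
pose e : 'rV[R]_n.+1 := delta_mx 0 0; have [w wE] : {w | w = v - e} by exists (v - e).
have ev : e *m v^T = (v 0 0)%:M.
  by rewrite -rowE; apply/rowP => i; rewrite !mxE !ord1 eqxx mulr1n.
have ve : v *m e^T = (v 0 0)%:M.
  by rewrite -[LHS]trmxK trmx_mul trmxK ev tr_scalar_mx.
have ee : e *m e^T = 1%:M.
  by rewrite -rowE; apply/rowP => i; rewrite !mxE !ord1 eqxx.
pose c := (1 - v 0 0) *+ 2.
have wwE : w *m w^T = c%:M.
  rewrite wE linearB /= mulmxBl !mulmxBr vv ev ve ee.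
  by apply/rowP => i; rewrite !mxE !ord1 !eqxx /c !mulr1n; ring.
have c0 : c != 0.
  apply/eqP => c0; move: wwE; rewrite c0 row_sqnE => /matrixP/(_ 0 0).
  rewrite !mxE eqxx !mulr1n => w0.
  by move: (row_sqn_gt0 (u := w)); rewrite w0 ltxx wE subr_eq0 => /(_ wn0).
pose H := 1%:M - (2 / c) *: (w^T *m w).
have HT : H^T = H by rewrite /H linearB /= linearZ /= trmx1 trmx_mul trmxK.
exists H; rewrite ?HT.
  rewrite /H mulmxBl mul1mx mulmxBr mulmx1 -!scalemxAl -!scalemxAr.
  rewrite mulmxA -(mulmxA w^T) wwE mul_mx_scalar -scalemxAl !scalerA.
  set M := w^T *m w; rewrite -[RHS](subr0 1%:M).
  rewrite -addrA; congr (_ + _); rewrite -opprD; congr (- _).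
  rewrite -scalerBl -scalerDl.
  rewrite [X in X *: _](_ : _ = 0) ?scale0r //.
  by move: (c : R) c0 => x x0; field.
rewrite rowE -/e mulmxBr mulmx1 -scalemxAr mulmxA {1}wE linearB /= mulmxBr ev ee.
rewrite -raddfB /= mul_scalar_mx scalerA.
rewrite [X in X *: _](_ : _ = -1) ?scaleN1r ?opprK ?wE; last first.
  by rewrite /c; field; move: c0; rewrite /c -mulr_natl mulf_eq0 negb_or => /andP[].
by rewrite addrCA subrr addr0.
Qed.

(** Deflation: an orthogonal matrix whose first row is a unit eigenvector conjugates [A] into a 1 x
    1 block and a smaller symmetric block. The complex eigenbasis behind [sym_eigenvalue] need not
    be real, so a real one is built by induction. *)
Theorem sym_diagonalization n (A : 'M[R]_n) : A^T = A ->
  exists (P : 'M[R]_n) (d : 'rV[R]_n),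
    P *m P^T = 1%:M /\ A = P^T *m diag_mx d *m P.
Proof.
elim: n A => [|n IH] A sA.
  by exists 1%:M, 0; split; apply/matrixP => -[].
have [a /eigenvalueP[u uA u0]] := sym_eigenvalue sA.
pose q := \sum_i u 0 i ^+ 2; have q0 : 0 < q by exact: row_sqn_gt0.
pose v := (Num.sqrt q)^-1 *: u.
have vv : v *m v^T = 1%:M.
  rewrite /v linearZ /= -scalemxAl -scalemxAr row_sqnE scalerA -/q.
  rewrite scale_scalar_mx; congr (_%:M).
  rewrite -invfM -expr2 sqr_sqrtr ?ltW // mulVf //; exact: lt0r_neq0.
have vA : v *m A = a *: v by rewrite /v -scalemxAl uA !scalerA mulrC.
have [P PP Pv] := orthogonal_completion vv.
have PP' : P^T *m P = 1%:M by exact: mulmx1C.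
have [B Bdef] : {B : 'M[R]_(1 + n) | B = P *m A *m P^T} by exists (P *m A *m P^T).
have sB : B^T = B by rewrite Bdef !trmx_mul trmxK sA mulmxA.
have rB : row 0 B = a *: delta_mx 0 0.
  by rewrite Bdef !row_mul Pv vA -scalemxAl -Pv -row_mul PP row1.
have B0 j : B (lshift n (0 : 'I_1)) j = a * (j == lshift n (0 : 'I_1))%:R.
  have -> : lshift n (0 : 'I_1) = 0 :> 'I_n.+1 by apply/val_inj.
  by have /rowP/(_ j) := rB; rewrite !mxE.
have BE : B = block_mx a%:M 0 0 (drsubmx B).
  rewrite -{1}(submxK B); congr block_mx.
  - apply/matrixP => i j; rewrite !mxE !ord1.
    by rewrite B0 eqxx mulr1.
  - apply/matrixP => i j; rewrite !mxE !ord1.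
    by rewrite B0 eq_rlshift mulr0.
  - apply/matrixP => i j; rewrite !mxE !ord1.
    by rewrite -sB mxE B0 eq_rlshift mulr0.
have sC : (drsubmx B)^T = drsubmx B by rewrite trmx_drsub sB.
have [Q [d [QQ CE]]] := IH _ sC.
pose Q1 : 'M[R]_(1 + n) := block_mx 1%:M 0 0 Q.
have QQ1 : Q1 *m Q1^T = 1%:M.
  rewrite /Q1 tr_block_mx trmx1 !trmx0 mulmx_block.
  by rewrite !mulmx0 !mul0mx !addr0 add0r mulmx1 QQ -scalar_mx_block.
exists (Q1 *m P), (row_mx a%:M d : 'rV[R]_(1 + n)); split.
  by rewrite trmx_mul mulmxA -(mulmxA Q1) PP mulmx1 QQ1.
have AE : A = P^T *m B *m P.
  by rewrite Bdef !mulmxA PP' mul1mx -mulmxA PP' mulmx1.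
have BQ : B = Q1^T *m diag_mx (row_mx a%:M d) *m Q1 :> 'M[R]_(1 + n).
  rewrite {1}BE diag_mx_row /Q1 tr_block_mx trmx1 !trmx0 !mulmx_block.
  rewrite !(mulmx0, mul0mx, addr0, add0r, mul1mx, mulmx1) {1}CE.
  by congr block_mx; apply/matrixP => i j; rewrite !mxE !ord1 eqxx.
by rewrite AE BQ trmx_mul !mulmxA.
Qed.

End Spectral.

(** * The trace norm of symmetric matrices *)

Section TraceNorm.
Variable R : realType.

(* A pair (P, d) with A = P^T diag(d) P and P orthogonal; the junk value (1, 0)
   when A is not symmetric. *)
Definition eigs n (A : 'M[R]_n) : 'M[R]_n * 'rV[R]_n :=
  xget (1%:M, 0) [set Pd | Pd.1 *m Pd.1^T = 1%:M /\
                           A = Pd.1^T *m diag_mx Pd.2 *m Pd.1]%classic.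

Lemma eigsP n (A : 'M[R]_n) : A^T = A ->
  [/\ (eigs A).1 *m (eigs A).1^T = 1%:M, (eigs A).1^T *m (eigs A).1 = 1%:M &
      A = (eigs A).1^T *m diag_mx (eigs A).2 *m (eigs A).1].
Proof.
move=> /sym_diagonalization[P [d PdP]].
have : exists Pd : 'M[R]_n * 'rV[R]_n, Pd.1 *m Pd.1^T = 1%:M /\
    A = Pd.1^T *m diag_mx Pd.2 *m Pd.1 by exists (P, d).
move=> /(xgetPex (1%:M, 0)); rewrite -/(eigs A) /= => -[PP AE].
by split => //; exact: mulmx1C.
Qed.

Definition trnorm n (A : 'M[R]_n) : R := \sum_i `|(eigs A).2 0 i|.

Lemma energy_trnorm n (G : {set {set 'I_n}}) :
  energy R G = trnorm (adjmx R G).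
Proof.
have sA : (adjmx R G)^T = adjmx R G.
  by apply/matrixP => i j; rewrite !mxE eq_sym finset.setUC.
have [PP PP' AE] := eigsP sA; rewrite /trnorm.
set P := (eigs _).1 in PP PP' AE; set d := (eigs _).2 in AE *.
rewrite (@energyE _ _ _ [seq d 0 i | i : 'I_n]) ?big_image //=.
rewrite /char_poly /char_poly_mx.
have -> : 'X%:M - map_mx polyC (adjmx R G) =
   map_mx polyC P^T *m ('X%:M - map_mx polyC (diag_mx d)) *m map_mx polyC P.
  rewrite mulmxBr mulmxBl AE !map_mxM mul_mx_scalar -scalemxAl -(map_mxM _ P^T P).
  by rewrite PP' map_mx1 scalemx1.
rewrite !det_mulmx mulrAC -det_mulmx -(map_mxM _ P^T P) PP' map_mx1 det1 mul1r.
rewrite map_diag_mx.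
rewrite [X in \det X](_ : _ = diag_mx (\row_i ('X - (d 0 i)%:P))); last first.
  apply/matrixP => i j; rewrite !mxE; case: eqP => // _.
  by rewrite !mulr0n subr0.
by rewrite det_diag; apply: eq_bigr => i _; rewrite mxE.
Qed.

Definition sqn n (u : 'rV[R]_n) : R := \sum_i u 0 i ^+ 2.

Lemma sqn_ge0 n (u : 'rV[R]_n) : 0 <= sqn u.
Proof. exact: row_sqn_ge0. Qed.

Lemma sqnE n (u : 'rV[R]_n) : sqn u = (u *m u^T) 0 0.
Proof. by rewrite row_sqnE mxE eqxx. Qed.

Lemma sqnZ n c (u : 'rV[R]_n) : sqn (c *: u) = c ^+ 2 * sqn u.
Proof. by rewrite /sqn mulr_sumr; apply: eq_bigr => i _; rewrite mxE exprMn. Qed.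

Lemma sqn_delta n (i : 'I_n) : sqn (delta_mx 0 i) = 1.
Proof.
rewrite /sqn (bigD1 i) //= mxE !eqxx expr1n big1 ?addr0 // => j ji.
by rewrite mxE (negPf ji) andbF expr0n.
Qed.

(* For symmetric Q this is the operator norm bound |Q| <= 1; the trace norm is the
   dual norm. *)
Definition contraction n (Q : 'M[R]_n) : Prop :=
  forall x : 'rV[R]_n, `|(x *m Q *m x^T) 0 0| <= sqn x.

Lemma contractionN n (Q : 'M[R]_n) : contraction Q -> contraction (- Q).
Proof. by move=> cQ x; rewrite mulmxN mulNmx mxE normrN. Qed.

Lemma contraction_conj n (B Q : 'M[R]_n) :
  (forall x : 'rV[R]_n, sqn (x *m B) <= sqn x) ->
  contraction Q -> contraction (B *m Q *m B^T).
Proof.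
move=> cB cQ x; apply: le_trans (cB x).
by rewrite !mulmxA -(mulmxA _ B^T) -trmx_mul; exact: cQ.
Qed.

(** By cyclicity the trace is the sum of the eigenvalues weighted by the quadratic form of [Q] at
    the unit eigenvectors [row i P], and these weights have absolute value at most 1. *)
Lemma trnorm_ge n (A Q : 'M[R]_n) : A^T = A -> contraction Q ->
  \tr (A *m Q) <= trnorm A.
Proof.
move=> /eigsP[PP PP' AE] cQ; rewrite /trnorm.
set P := (eigs _).1 in PP PP' AE; set d := (eigs _).2 in AE *.
rewrite {1}AE -!mulmxA mxtrace_mulC -!mulmxA /mxtrace.
apply: ler_sum => i _; rewrite mul_diag_mx mxE.
apply: le_trans (ler_norm _) _; rewrite normrM ler_piMr //.
have -> : (P *m (Q *m P^T)) i i = (row i P *m Q *m (row i P)^T) 0 0.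
  rewrite -!row_mul -mulmxA tr_row colE (mulmxA Q).
  by move: (Q *m P^T) => M; rewrite (mulmxA P) -colE !mxE.
apply: le_trans (cQ _) _; rewrite /sqn.
have -> : 1 = (P *m P^T) i i by rewrite PP mxE eqxx.
by rewrite mxE; apply: ler_sum => j _; rewrite !mxE expr2.
Qed.

(** The maximizer is the sign of [A], formed in its eigenbasis. With [trnorm_ge] this makes [trnorm]
    a maximum of linear functionals, so subadditivity and its relatives follow without comparing
    eigenbases. *)
Lemma trnorm_attained n (A : 'M[R]_n) : A^T = A ->
  exists2 Q, contraction Q & trnorm A = \tr (A *m Q).
Proof.
move=> /eigsP[PP PP' AE]; rewrite /trnorm.
set P := (eigs _).1 in PP PP' AE; set d := (eigs _).2 in AE *.
exists (P^T *m diag_mx (\row_i Num.sg (d 0 i)) *m P).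
  move=> x; set y := x *m P^T.
  have -> : sqn x = sqn y.
    by rewrite !sqnE /y trmx_mul trmxK !mulmxA -(mulmxA x) PP' mulmx1.
  have yT : P *m x^T = y^T by rewrite trmx_mul trmxK.
  rewrite !mulmxA -/y -mulmxA yT.
  rewrite mul_mx_diag mxE; apply: le_trans (ler_norm_sum _ _ _) _.
  apply: ler_sum => i _; rewrite !mxE -mulrA mulrC -mulrA -expr2 normrM.
  rewrite (ger0_norm (sqr_ge0 _)) ler_piMl ?sqr_ge0 // normr_sg.
  by case: (d 0 i != 0).
rewrite {1}AE !mulmxA -(mulmxA _ P) PP mulmx1.
rewrite -(mulmxA P^T) mxtrace_mulC !mulmxA PP mul1mx mulmx_diag.
rewrite mxtrace_diag; apply: eq_bigr => i _.
by rewrite !mxE mulrC -normrEsg.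
Qed.

Lemma trnorm_ge0 n (A : 'M[R]_n) : 0 <= trnorm A.
Proof. exact: sumr_ge0. Qed.

Lemma trnormD n (A B : 'M[R]_n) : A^T = A -> B^T = B ->
  trnorm (A + B) <= trnorm A + trnorm B.
Proof.
move=> sA sB; have [Q cQ ->] := trnorm_attained (A := A + B) ltac:(by rewrite linearD /= sA sB).
by rewrite mulmxDl mxtraceD lerD // trnorm_ge.
Qed.

Lemma trnormZ n c (A : 'M[R]_n) : A^T = A ->
  trnorm (c *: A) <= `|c| * trnorm A.
Proof.
move=> sA; have [Q cQ ->] := trnorm_attained (A := c *: A) ltac:(by rewrite linearZ /= sA).
rewrite -scalemxAl mxtraceZ; case: (ger0P c) => c0.
  by apply: ler_wpM2l => //; exact: trnorm_ge.
have -> : c * \tr (A *m Q) = - c * \tr (A *m - Q) by rewrite mulmxN raddfN mulrNN.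
apply: ler_wpM2l; first by rewrite oppr_ge0 ltW.
by apply: trnorm_ge => //; exact: contractionN.
Qed.

Lemma trnormN n (A : 'M[R]_n) : A^T = A -> trnorm (- A) = trnorm A.
Proof.
have H (B : 'M[R]_n) : B^T = B -> trnorm (- B) <= trnorm B.
  by move=> sB; rewrite -scaleN1r (le_trans (trnormZ _ sB)) // normrN1 mul1r.
move=> sA; apply/eqP; rewrite eq_le H //= -{1}[A]opprK H //.
by rewrite linearN /= sA.
Qed.

Lemma trnormB n (A B : 'M[R]_n) : A^T = A -> B^T = B ->
  trnorm (A - B) <= trnorm A + trnorm B.
Proof.
move=> sA sB; rewrite -(trnormN sB) trnormD //.
by rewrite linearN /= sB.
Qed.

Lemma ler_trnormB n (A B : 'M[R]_n) : A^T = A -> B^T = B ->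
  trnorm A - trnorm B <= trnorm (A - B).
Proof.
move=> sA sB; rewrite lerBlDr -{1}(subrK B A) trnormD //.
by rewrite linearB /= sA sB.
Qed.

Lemma trnorm0 n : trnorm (0 : 'M[R]_n) = 0.
Proof.
have [//|Q _ ->] := @trnorm_attained n 0; first by rewrite linear0.
by rewrite mul0mx raddf0.
Qed.

Lemma trnorm_sum n (I : Type) (r : seq I) (P : pred I) (F : I -> 'M[R]_n) :
  (forall i, P i -> (F i)^T = F i) ->
  trnorm (\sum_(i <- r | P i) F i) <= \sum_(i <- r | P i) trnorm (F i).
Proof.
move=> sF; suff [] : trnorm (\sum_(i <- r | P i) F i)
   <= \sum_(i <- r | P i) trnorm (F i) /\
   (\sum_(i <- r | P i) F i)^T = \sum_(i <- r | P i) F i by [].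
pose K (x : 'M[R]_n) (y : R) := trnorm x <= y /\ x^T = x.
apply: (big_ind2 K) => [|x1 x2 y1 y2 [le1 s1] [le2 s2]|i Pi]; rewrite /K.
- by rewrite trnorm0 linear0.
- by rewrite linearD /= s1 s2 (le_trans (trnormD _ _)) // lerD.
- by rewrite sF.
Qed.

Lemma trnorm_conj n (A B : 'M[R]_n) : A^T = A ->
  (forall x : 'rV[R]_n, sqn (x *m B) <= sqn x) ->
  trnorm (B^T *m A *m B) <= trnorm A.
Proof.
move=> sA cB.
have [|Q cQ ->] := @trnorm_attained _ (B^T *m A *m B).
  by rewrite !trmx_mul trmxK sA mulmxA.
rewrite -!mulmxA mxtrace_mulC -!mulmxA; apply: trnorm_ge => //.
by rewrite mulmxA; exact: contraction_conj.
Qed.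

Lemma trnorm_rank1 n (v : 'rV[R]_n) : trnorm (v^T *m v) <= sqn v.
Proof.
have [|Q cQ ->] := @trnorm_attained _ (v^T *m v).
  by rewrite trmx_mul trmxK.
rewrite -mulmxA mxtrace_mulC trace_mx11.
exact: le_trans (ler_norm _) (cQ v).
Qed.

Lemma sqnD2 n (u v : 'rV[R]_n) :
  sqn (u + v) + sqn (u - v) = 2 * (sqn u + sqn v).
Proof.
rewrite /sqn -!big_split mulr_sumr /=; apply: eq_bigr => i _.
by rewrite !mxE; ring.
Qed.

(** Polarization gives a difference of two rank-one squares, and the parallelogram law [sqnD2] adds
    up their norms. *)
Lemma trnorm_rank2 n (v w : 'rV[R]_n) :
  trnorm (v^T *m w + w^T *m v) <= sqn v + sqn w.
Proof.
have -> : v^T *m w + w^T *m v =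
    2^-1 *: ((v + w)^T *m (v + w) - (v - w)^T *m (v - w)).
  apply/matrixP => i j; rewrite !mxE !big_ord1 !mxE; by field.
have s1 (u : 'rV[R]_n) : (u^T *m u)^T = u^T *m u by rewrite trmx_mul trmxK.
apply: le_trans (trnormZ _ _) _; first by rewrite linearB /= !s1.
apply: (@le_trans _ _ (`|2^-1| * (sqn (v + w) + sqn (v - w)))).
  rewrite ler_wpM2l // (le_trans (trnormB _ _)) // lerD // trnorm_rank1 //.
by rewrite sqnD2 ger0_norm ?invr_ge0 // mulrA mulVf ?mul1r.
Qed.

Lemma mxtrace_eigs n (A : 'M[R]_n) : A^T = A ->
  \tr (A *m A) = \sum_i (eigs A).2 0 i ^+ 2.
Proof.
move=> /eigsP[PP PP' AE]; rewrite {1 2}AE.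
set P := (eigs _).1 in PP PP' AE *; set d := (eigs _).2 in AE *.
rewrite !mulmxA -(mulmxA _ P) PP mulmx1.
rewrite -!mulmxA mxtrace_mulC -!mulmxA PP mulmx1 mulmx_diag mxtrace_diag.
by apply: eq_bigr => i _; rewrite mxE expr2.
Qed.

Lemma mxtrace_eigs4 n (A : 'M[R]_n) : A^T = A ->
  \tr (A *m A *m (A *m A)) = \sum_i (eigs A).2 0 i ^+ 4.
Proof.
move=> /eigsP[PP PP' AE].
set P := (eigs _).1 in PP PP' AE *; set d := (eigs _).2 in AE *.
have -> : A *m A = P^T *m diag_mx (\row_i (d 0 i * d 0 i)) *m P.
  rewrite {1 2}AE !mulmxA -(mulmxA _ P) PP mulmx1.
  by rewrite -(mulmxA P^T) mulmx_diag.
rewrite !mulmxA -(mulmxA _ P) PP mulmx1.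
rewrite -!mulmxA mxtrace_mulC -!mulmxA PP mulmx1 mulmx_diag mxtrace_diag.
by apply: eq_bigr => i _; rewrite !mxE; ring.
Qed.

(** Cauchy-Schwarz in the form 2 |d| <= th + d^2 / th for each eigenvalue; the free parameter [th]
    is chosen where a bound on the Frobenius norm is known. *)
Lemma trnorm_le_frobenius n (A : 'M[R]_n) (th : R) : A^T = A -> 0 < th ->
  trnorm A <= (n%:R * th + \tr (A *m A) / th) / 2.
Proof.
move=> sA th0; rewrite mxtrace_eigs // /trnorm.
apply: (@le_trans _ _ (\sum_(i < n) (th + (eigs A).2 0 i ^+ 2 / th) / 2)).
  apply: ler_sum => i _; set d := _ 0 i.
  rewrite -(ler_pM2r th0) -[d ^+ 2]real_normK ?num_real //; move: `|d| => x.
  have -> : (th + x ^+ 2 / th) / 2 * th = (th ^+ 2 + x ^+ 2) / 2.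
    by field; exact: lt0r_neq0.
  have := sqr_ge0 (x - th); lra.
rewrite -mulr_suml ler_pM2r ?invr_gt0 // big_split /= -mulr_suml.
by rewrite sumr_const card_ord mulr_natl.
Qed.

(* The cubic [3 x / 2 - x ^ 3 / 2] is tangent to the constant 1 at [x = 1]. *)
Lemma trnorm_ge_moments n (A : 'M[R]_n) (th : R) : A^T = A -> 0 < th ->
  3 / (2 * th) * \tr (A *m A) - \tr (A *m A *m (A *m A)) / (2 * th ^+ 3)
  <= trnorm A.
Proof.
move=> sA th0; rewrite mxtrace_eigs // mxtrace_eigs4 // /trnorm.
rewrite mulr_sumr mulr_suml -sumrB; apply: ler_sum => i _.
set d := _ 0 i; set x := `|d|; have x0 : 0 <= x by exact: normr_ge0.
have -> : d ^+ 4 = x ^+ 4 by rewrite /x -normrX ger0_norm // exprn_even_ge0.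
have -> : d ^+ 2 = x ^+ 2 by rewrite /x real_normK // num_real.
have th1 : th != 0 by exact: lt0r_neq0.
have th3 : 0 < 2 * th ^+ 3 by rewrite mulr_gt0 // exprn_gt0.
rewrite -(ler_pM2r th3) mulrBl.
have -> : 3 / (2 * th) * x ^+ 2 * (2 * th ^+ 3) = 3 * x ^+ 2 * th ^+ 2 by field.
rewrite divfK ?lt0r_neq0 //.
have : 0 <= x * ((x - th) ^+ 2 * (x + 2 * th)).
  apply: mulr_ge0 => //; apply: mulr_ge0; first exact: sqr_ge0.
  by rewrite addr_ge0 // mulr_ge0 // ltW.
nra.
Qed.

End TraceNorm.

(** * Bernoulli subsets of a finite type *)

Section Bernoulli.
Variables (R : realType) (T : finType) (p : R).
Implicit Types (G : {set T}) (f g : {set T} -> R) (e : T).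

Definition bmass G : R := \prod_e (if e \in G then p else 1 - p).

Definition bexp f : R := \sum_G bmass G * f G.

(** Conditional expectation given the status of all elements other than [e]; [bdiff] is the matching
    discrete derivative. *)
Definition bavg e f G : R := p * f (e |: G)%SET + (1 - p) * f (G :\ e)%SET.

Definition bdiff e f G : R := f (e |: G)%SET - f (G :\ e)%SET.

Definition bvar f : R := bexp (fun G => (f G - bexp f) ^+ 2).

Lemma eq_bexp f g : f =1 g -> bexp f = bexp g.
Proof. by move=> fg; apply: eq_bigr => G _; rewrite fg. Qed.

Lemma bexpD f g : bexp (fun G => f G + g G) = bexp f + bexp g.
Proof.
by rewrite -big_split /=; apply: eq_bigr => G _; rewrite mulrDr.
Qed.

Lemma bexpZ c f : bexp (fun G => c * f G) = c * bexp f.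
Proof. by rewrite mulr_sumr; apply: eq_bigr => G _; rewrite mulrCA. Qed.

Lemma bexpB f g : bexp (fun G => f G - g G) = bexp f - bexp g.
Proof.
rewrite -mulN1r -bexpZ -bexpD; apply: eq_bexp => G; by rewrite mulN1r.
Qed.

Lemma bexp_sum (I : Type) (r : seq I) (P : pred I) (F : I -> {set T} -> R) :
  bexp (fun G => \sum_(i <- r | P i) F i G) = \sum_(i <- r | P i) bexp (F i).
Proof.
by rewrite exchange_big; apply: eq_bigr => G _; rewrite mulr_sumr.
Qed.

Let rest e G : R := \prod_(x | x != e) (if x \in G then p else 1 - p).

Let bmassE e G : bmass G = (if e \in G then p else 1 - p) * rest e G.
Proof. by rewrite /bmass (bigD1 e). Qed.

Let restU e G : rest e (e |: G)%SET = rest e G.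
Proof.
by apply: eq_bigr => x xe; rewrite in_setU1 (negPf xe).
Qed.

Let bexp_split e f : bexp f =
  \sum_(G : {set T} | e \notin G)
     rest e G * (p * f (e |: G)%SET + (1 - p) * f G).
Proof.
rewrite /bexp (bigID (fun G : {set T} => e \notin G)) /= addrC.
rewrite (reindex_onto (fun G => e |: G)%SET (fun G => G :\ e)%SET) /=; last first.
  by move=> G; rewrite negbK; exact: finset.setD1K.
rewrite (eq_bigl (fun G : {set T} => e \notin G)); last first.
  move=> G; rewrite setU11 /=; apply/eqP/idP => [<-|eG].
    by rewrite !inE eqxx.
  exact: setU1K.
rewrite -big_split; apply: eq_bigr => G eG /=.
rewrite !(bmassE e) restU setU11 (negPf eG); ring.
Qed.

Lemma bexp_bavg e f : bexp (bavg e f) = bexp f.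
Proof.
rewrite !(bexp_split e); apply: eq_bigr => G eG; congr (_ * _).
rewrite /bavg setU1K // finset.setUA finset.setUid.
have -> : (G :\ e)%SET = G by apply/finset.setDidPl; rewrite disjoint_sym disjoints1.
by rewrite -mulrDl [p + _]addrC subrK mul1r.
Qed.

(* Integration by parts for a two-point distribution; it is exact. *)
Lemma bexp_stein e f :
  bexp (fun G => ((e \in G)%:R - p) * f G) = p * (1 - p) * bexp (bdiff e f).
Proof.
rewrite -(bexp_bavg e) -bexpZ; apply: eq_bexp => G.
by rewrite /bavg /bdiff setU11 setD11 /=; ring.
Qed.

Lemma bexp1 : bexp (fun=> 1) = 1.
Proof.
have -> : bexp (fun=> 1) = \sum_G bmass G.
  by apply: eq_bigr => G _; rewrite mulr1.
have : \prod_(e : T) (p + (1 - p)) = 1 by apply: big1 => e _; rewrite addrC subrK.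
by rewrite bigA_distr.
Qed.

Lemma bexp_cst c : bexp (fun=> c) = c.
Proof. by rewrite -[RHS]mulr1 -bexp1 -bexpZ; apply: eq_bexp => G; rewrite mulr1. Qed.

Hypothesis p01 : 0 <= p <= 1.

Let p0 : 0 <= p. Proof. by case/andP: p01. Qed.
Let q0 : 0 <= 1 - p. Proof. by rewrite subr_ge0; case/andP: p01. Qed.

Lemma bmass_ge0 G : 0 <= bmass G.
Proof. by apply: prodr_ge0 => e _; case: ifP. Qed.

Lemma ler_bexp f g : (forall G, f G <= g G) -> bexp f <= bexp g.
Proof. by move=> fg; apply: ler_sum => G _; rewrite ler_wpM2l // bmass_ge0. Qed.

Lemma bexp_ge0 f : (forall G, 0 <= f G) -> 0 <= bexp f.
Proof. by move=> f0; apply: sumr_ge0 => G _; rewrite mulr_ge0 // bmass_ge0. Qed.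

Lemma ler_norm_bexp f : `|bexp f| <= bexp (fun G => `|f G|).
Proof.
apply: le_trans (ler_norm_sum _ _ _) _; apply: ler_sum => G _.
by rewrite normrM ger0_norm ?bmass_ge0.
Qed.

Lemma bvarE f : bvar f = bexp (fun G => f G ^+ 2) - bexp f ^+ 2.
Proof.
rewrite /bvar; set m := bexp f.
have -> : bexp (fun G => (f G - m) ^+ 2) =
    bexp (fun G => f G ^+ 2 + ((- 2 * m) * f G + m ^+ 2)).
  by apply: eq_bexp => G; ring.
rewrite bexpD bexpD bexpZ bexp_cst -/m; ring.
Qed.

Lemma bvar_ge0 f : 0 <= bvar f.
Proof. by apply: bexp_ge0 => G; exact: sqr_ge0. Qed.

Lemma bdiff_bavg e e' f G : e != e' ->
  bdiff e (bavg e' f) G = bavg e' (bdiff e f) G.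
Proof.
move=> ee'; rewrite /bdiff /bavg.
have -> : (e' |: (G :\ e))%SET = ((e' |: G) :\ e)%SET.
  by apply/setP => x; rewrite !inE; case: eqP => // ->; rewrite eq_sym ee'.
have -> : (e |: (G :\ e'))%SET = ((e |: G) :\ e')%SET.
  by apply/setP => x; rewrite !inE; have [->|//] := eqVneq x e; rewrite ee'.
by rewrite (finset.setUCA [set e]%SET) !finset.setDDl [(_ |: [set e'])%SET]finset.setUC; ring.
Qed.

Lemma bexp_sqr_bavg e f : bexp (fun G => bavg e f G ^+ 2) <= bexp (fun G => f G ^+ 2).
Proof.
rewrite -[leRHS](bexp_bavg e); apply: ler_bexp => G; rewrite /bavg.
rewrite -subr_ge0.
have -> : forall x y : R, p * x ^+ 2 + (1 - p) * y ^+ 2 - (p * x + (1 - p) * y) ^+ 2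
   = p * (1 - p) * (x - y) ^+ 2 by move=> x y; ring.
by apply: mulr_ge0; rewrite ?sqr_ge0 // mulr_ge0.
Qed.

(** The conditional variance of a two-point variable with values x and y is p (1 - p) (x - y)^2. *)
Let bexp_sqr_step e f : bexp (fun G => f G ^+ 2) =
  bexp (fun G => bavg e f G ^+ 2) + p * (1 - p) * bexp (fun G => bdiff e f G ^+ 2).
Proof.
rewrite -[LHS](bexp_bavg e) -bexpZ -bexpD; apply: eq_bexp => G.
by rewrite /bavg /bdiff; ring.
Qed.

(** The elements are averaged out one after another, and each step lowers the second moment by one
    conditional variance. Averaging commutes with [bdiff] at other elements and does not increase
    second moments, so every loss is bounded by that of the original [f]. *)
Theorem efron_stein f :
  bvar f <= p * (1 - p) * \sum_e bexp (fun G => bdiff e f G ^+ 2).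
Proof.
pose F (s : seq T) := foldr bavg f s.
have FD e s : e \notin s -> bexp (fun G => bdiff e (F s) G ^+ 2) <=
    bexp (fun G => bdiff e f G ^+ 2).
  elim: s => //= e' s IH; rewrite inE negb_or => /andP[ee' /IH]; apply: le_trans.
  rewrite (eq_bexp (g := fun G => bavg e' (bdiff e (F s)) G ^+ 2)).
    exact: bexp_sqr_bavg.
  by move=> G; rewrite bdiff_bavg.
have FS s : uniq s -> bexp (fun G => f G ^+ 2) <=
    bexp (fun G => F s G ^+ 2) +
    p * (1 - p) * \sum_(e <- s) bexp (fun G => bdiff e f G ^+ 2).
  elim: s => [_|e s IH /= /andP[es us]]; first by rewrite big_nil mulr0 addr0.
  rewrite big_cons mulrDr; apply: le_trans (IH us) _.
  rewrite (bexp_sqr_step e) -addrA lerD2l lerD2r.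
  by apply: ler_wpM2l; [rewrite mulr_ge0|exact: FD].
have F_cst e s G : e \in s -> F s (e |: G)%SET = F s (G :\ e)%SET.
  elim: s G => //= e' s IH G; rewrite inE.
  have [<- _|ee' /= es] := eqVneq e e'.
    rewrite /bavg !finset.setUA finset.setUid finset.setDDl finset.setUid.
    have -> : (e |: (G :\ e))%SET = (e |: G)%SET.
      by apply/setP => x; rewrite !inE; case: eqP.
    have -> // : ((e |: G) :\ e)%SET = (G :\ e)%SET.
    by apply/setP => x; rewrite !inE; case: eqP.
  rewrite /bavg.
  have -> : (e' |: (G :\ e))%SET = ((e' |: G) :\ e)%SET.
    by apply/setP => x; rewrite !inE; case: eqP => // ->; rewrite eq_sym ee'.
  have -> : ((e |: G) :\ e')%SET = (e |: (G :\ e'))%SET.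
    by apply/setP => x; rewrite !inE; have [->|//] := eqVneq x e; rewrite ee'.
  by rewrite finset.setUCA !IH // !finset.setDDl [(_ |: [set e'])%SET]finset.setUC.
pose s := enum T.
(* After all averagings the function ignores every element, hence equals its value at the empty
   set. *)
have Fs G : F s G = bexp f.
  have F0 G' : F s G' = F s finset.set0.
    have [k] := ubnP #|G'|; elim: k G' => // k IH G' Gk.
    have [->//|[e eG]] := finset.set_0Vmem G'.
    rewrite -(finset.setD1K eG) F_cst ?mem_enum // IH // finset.setDDl finset.setUid.
    by move: Gk; rewrite (cardsD1 e) eG.
  have -> : bexp f = bexp (F s).
    by elim: s {F0} => //= e s' ->; rewrite bexp_bavg.
  by rewrite F0 (eq_bexp (g := fun=> F s finset.set0)) ?bexp_cst.
rewrite bvarE lerBlDl; apply: le_trans (FS s _) _; first exact: enum_uniq.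
rewrite (eq_bexp (g := fun=> bexp f ^+ 2)); last by move=> G; rewrite Fs.
by rewrite bexp_cst big_enum.
Qed.

Definition bprob (Q : {set T} -> Prop) : R := bexp (fun G => (`[< Q G >])%:R).

Lemma ler_bprob (Q Q' : {set T} -> Prop) : (forall G, Q G -> Q' G) ->
  bprob Q <= bprob Q'.
Proof.
move=> QQ; apply: ler_bexp => G; rewrite ler_nat.
by case: (asboolP (Q G)) => // /QQ ?; rewrite asboolT.
Qed.

Lemma bprob_le1 Q : bprob Q <= 1.
Proof. by rewrite -bexp1; apply: ler_bexp => G; rewrite lern1 leq_b1. Qed.

Lemma bprobC Q : bprob (fun G => ~ Q G) = 1 - bprob Q.
Proof.
rewrite -bexp1 -bexpB; apply: eq_bexp => G; rewrite asbool_neg.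
by case: asboolP; rewrite ?subrr ?subr0.
Qed.

Lemma bprobU (Q1 Q2 : {set T} -> Prop) :
  bprob (fun G => Q1 G \/ Q2 G) <= bprob Q1 + bprob Q2.
Proof.
rewrite -bexpD; apply: ler_bexp => G; rewrite asbool_or -natrD ler_nat.
by do 2 case: asboolP.
Qed.

Lemma markov_bexp f a : (forall G, 0 <= f G) -> 0 < a ->
  bprob (fun G => a <= f G) <= bexp f / a.
Proof.
move=> f0 a0; rewrite ler_pdivlMr // mulrC -bexpZ; apply: ler_bexp => G.
by case: asboolP; rewrite ?mulr1 ?mulr0.
Qed.

Lemma chebyshev_bexp f a : 0 < a ->
  bprob (fun G => a <= `|f G - bexp f|) <= bvar f / a ^+ 2.
Proof.
move=> a0; have a20 : 0 < a ^+ 2 by rewrite exprn_gt0.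
apply: le_trans (markov_bexp (fun=> sqr_ge0 _) a20).
apply: ler_bprob => G H; rewrite -[leRHS]real_normK ?num_real //.
by rewrite lerXn2r // nnegrE // ltW.
Qed.

(** Used to split the expected product of the real and imaginary partial traces. The arithmetic mean
    loses nothing there, since both variances have the same bound. *)
Lemma ler_cov f g : `|bexp (fun G => f G * g G) - bexp f * bexp g| <=
  (bvar f + bvar g) / 2.
Proof.
have -> : bexp (fun G => f G * g G) - bexp f * bexp g =
    bexp (fun G => (f G - bexp f) * (g G - bexp g)).
  have -> : bexp (fun G => (f G - bexp f) * (g G - bexp g)) =
    bexp (fun G => f G * g G - (bexp g * f G + (bexp f * g G - bexp f * bexp g))).
    by apply: eq_bexp => G; ring.
  by rewrite bexpB bexpD bexpB !bexpZ bexp_cst; ring.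
apply: le_trans (ler_norm_bexp _) _.
rewrite /bvar -bexpD mulrC -bexpZ; apply: ler_bexp => G.
rewrite normrM -[X in 2^-1 * (X + _)]real_normK ?num_real //.
rewrite -[X in 2^-1 * (_ + X)]real_normK ?num_real //.
move: `|_| `|_| => x y; have := sqr_ge0 (x - y); lra.
Qed.

End Bernoulli.

(** * Resolvents on the imaginary axis *)

Section Resolvent.
Variables (R : realType) (n : nat) (t : R).
Hypothesis t0 : 0 < t.
Implicit Types A B : 'M[R]_n.

(* For symmetric A, [resre A] and [resim A] are the real and imaginary parts of
   the resolvent (A - i t)^-1 = (A + i t) (A ^ 2 + t ^ 2)^-1. *)
Definition resim A : 'M[R]_n := t *: invmx (A *m A + (t ^+ 2)%:M).
Definition resre A : 'M[R]_n := A *m invmx (A *m A + (t ^+ 2)%:M).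

Let tn0 : t != 0. Proof. exact: lt0r_neq0. Qed.

(** A row x in the kernel satisfies |x A|^2 + t^2 |x|^2 = 0. *)
Lemma sqr_shift_unit A : A^T = A -> A *m A + (t ^+ 2)%:M \in unitmx.
Proof.
move=> sA; rewrite -row_free_unit -kermx_eq0; apply/rowV0P => x /sub_kermxP.
have xA : A *m x^T = (x *m A)^T by rewrite trmx_mul sA.
move=> /(congr1 (mulmx^~ x^T)); rewrite mul0mx mulmxDr mul_mx_scalar mulmxDl.
rewrite mulmxA -mulmxA xA => H.
apply/eqP; apply: contraT => x0; have := row_sqn_gt0 x0.
have /matrixP/(_ 0 0) := H; rewrite -scalemxAl !row_sqnE !mxE eqxx !mulr1n.
have := row_sqn_ge0 (x *m A).
set a := \sum_i _; set b := \sum_i _ => a0 ab b0.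
have : 0 < t ^+ 2 * b by apply: mulr_gt0 => //; exact: exprn_gt0.
lra.
Qed.

Lemma tr_resim A : A^T = A -> (resim A)^T = resim A.
Proof.
move=> sA; rewrite /resim linearZ /= trmx_inv linearD /= tr_scalar_mx.
by rewrite trmx_mul sA.
Qed.

Let inv_comm A : A^T = A -> invmx (A *m A + (t ^+ 2)%:M) *m A =
  A *m invmx (A *m A + (t ^+ 2)%:M).
Proof.
move=> sA; have Mu := sqr_shift_unit sA; set M := _ + _ in Mu *.
apply: (can_inj (mulKmx Mu)); rewrite mulKVmx // mulmxA.
have -> : M *m A = A *m M.
  by rewrite /M mulmxDl mulmxDr mulmxA mul_mx_scalar mul_scalar_mx.
by rewrite mulmxK.
Qed.

Lemma tr_resre A : A^T = A -> (resre A)^T = resre A.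
Proof.
move=> sA; rewrite /resre trmx_mul trmx_inv linearD /= tr_scalar_mx.
by rewrite trmx_mul sA inv_comm.
Qed.

Lemma mul_resre A : A^T = A -> A *m resre A = 1%:M - t *: resim A.
Proof.
move=> sA; have Mu := sqr_shift_unit sA; rewrite /resre /resim scalerA -expr2.
rewrite -mul_scalar_mx mulmxA; apply/eqP; rewrite -subr_eq0 opprB addrA.
by rewrite -mulmxDl mulmxV // subrr.
Qed.

Lemma mul_resim A : A *m resim A = t *: resre A.
Proof. by rewrite /resre /resim -scalemxAr. Qed.

Lemma resre_mul A : A^T = A -> resre A *m A = 1%:M - t *: resim A.
Proof.
move=> sA; rewrite -mul_resre // -[LHS]trmxK trmx_mul tr_resre // sA mul_resre //.
by rewrite linearB /= linearZ /= trmx1 tr_resim.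
Qed.

Lemma resim_mul A : A^T = A -> resim A *m A = t *: resre A.
Proof.
move=> sA; rewrite -mul_resim -[LHS]trmxK trmx_mul tr_resim // sA mul_resim //.
by rewrite linearZ /= tr_resre.
Qed.

(** The Ward identity: the resolvent times its adjoint is its imaginary part divided by t. It
    controls a whole row by a single diagonal entry. *)
Lemma resre2D A : A^T = A ->
  resre A *m resre A + resim A *m resim A = t^-1 *: resim A.
Proof.
move=> sA; apply: (scalerI tn0); rewrite scalerDr scalerA divff // scale1r.
rewrite [X in X + _]scalemxAl [X in _ + X]scalemxAl -resim_mul //.
rewrite -mulmxA mul_resre // mulmxBr mulmx1 -scalemxAl -scalemxAr subrK //.
Qed.

(** Real and imaginary parts of the resolvent identity g1 - g0 = - g0 (A1 - A0) g1 for g = B + i Z.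
    Only a left equation for g0 and a right equation for g1 enter. *)
Let pair_diff A0 A1 B0 Z0 B1 Z1 :
    B0 *m A0 = 1%:M - t *: Z0 -> Z0 *m A0 = t *: B0 ->
    A1 *m B1 = 1%:M - t *: Z1 -> A1 *m Z1 = t *: B1 ->
  B1 - B0 = Z0 *m (A1 - A0) *m Z1 - B0 *m (A1 - A0) *m B1 /\
  Z1 - Z0 = - (B0 *m (A1 - A0) *m Z1 + Z0 *m (A1 - A0) *m B1).
Proof.
move=> BA ZA AB AZ.
have BAB : B0 *m (A1 - A0) *m B1 = B0 *m (1%:M - t *: Z1) - (1%:M - t *: Z0) *m B1.
  by rewrite -AB -BA mulmxBr mulmxBl mulmxA.
have BAZ : B0 *m (A1 - A0) *m Z1 = B0 *m (t *: B1) - (1%:M - t *: Z0) *m Z1.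
  by rewrite -AZ -BA mulmxBr mulmxBl mulmxA.
have ZAB : Z0 *m (A1 - A0) *m B1 = Z0 *m (1%:M - t *: Z1) - (t *: B0) *m B1.
  by rewrite -AB -ZA mulmxBr mulmxBl mulmxA.
have ZAZ : Z0 *m (A1 - A0) *m Z1 = Z0 *m (t *: B1) - (t *: B0) *m Z1.
  by rewrite -AZ -ZA mulmxBr mulmxBl mulmxA.
rewrite BAB BAZ ZAB ZAZ !mulmxBr !mulmxBl !mulmx1 !mul1mx -!scalemxAl -!scalemxAr.
move: (B0 *m B1) (B0 *m Z1) (Z0 *m B1) (Z0 *m Z1) => X1 X2 X3 X4.
by split; apply/matrixP => i j; rewrite !mxE; ring.
Qed.

Lemma resreB A0 A1 : A0^T = A0 -> A1^T = A1 ->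
  resre A1 - resre A0 = resim A0 *m (A1 - A0) *m resim A1
                        - resre A0 *m (A1 - A0) *m resre A1.
Proof.
move=> s0 s1; have [//] := pair_diff (resre_mul s0) (resim_mul s0) (mul_resre s1)
  (mul_resim A1).
Qed.

Lemma resimB A0 A1 : A0^T = A0 -> A1^T = A1 ->
  resim A1 - resim A0 = - (resre A0 *m (A1 - A0) *m resim A1
                           + resim A0 *m (A1 - A0) *m resre A1).
Proof.
move=> s0 s1; have [//] := pair_diff (resre_mul s0) (resim_mul s0) (mul_resre s1)
  (mul_resim A1).
Qed.

Lemma res_rowE A i : A^T = A ->
  \sum_j (resre A i j ^+ 2 + resim A i j ^+ 2) = t^-1 * resim A i i.
Proof.
move=> sA; have /matrixP/(_ i i) := resre2D sA; rewrite !mxE => <-.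
rewrite -big_split; apply: eq_bigr => j _ /=.
have -> : resre A j i = resre A i j by rewrite -{1}tr_resre // mxE.
have -> : resim A j i = resim A i j by rewrite -{1}tr_resim // mxE.
by rewrite !expr2.
Qed.

(** For the diagonal entry z, the Ward identity at row i writes z / t as a sum of squares, one of
    which is z^2. *)
Lemma resim_diag A i : A^T = A -> 0 <= resim A i i <= t^-1.
Proof.
move=> sA; have := res_rowE i sA; rewrite (bigD1 i) //=.
have s0 : 0 <= \sum_(j | j != i) (resre A i j ^+ 2 + resim A i j ^+ 2).
  by apply: sumr_ge0 => j _; rewrite addr_ge0 ?sqr_ge0.
have b0 := sqr_ge0 (resre A i i).
move: (resim A i i) (\sum_(_ < _ | _) _) s0 b0 => z s s0.
move: (resre A i i ^+ 2) => b b0 E.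
have ti : 0 < t^-1 by rewrite invr_gt0.
have z0 : 0 <= z by rewrite -(pmulr_rge0 _ ti) -E; nra.
rewrite z0 /=; case: (lerP z t^-1) => // zt.
have : t^-1 * z < z * z by rewrite ltr_pM2r // (lt_trans ti).
by rewrite -expr2; lra.
Qed.

Lemma res_row_le A i : A^T = A ->
  \sum_j (resre A i j ^+ 2 + resim A i j ^+ 2) <= t^-1 ^+ 2.
Proof.
move=> sA; rewrite res_rowE // expr2; apply: ler_wpM2l.
  by rewrite invr_ge0 ltW.
by have /andP[] := resim_diag i sA.
Qed.

Lemma res_entry_le A i j : A^T = A ->
  resre A i j ^+ 2 + resim A i j ^+ 2 <= t^-1 ^+ 2.
Proof.
move=> sA; apply: le_trans (res_row_le i sA); rewrite (bigD1 j) //= lerDl.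
by apply: sumr_ge0 => k _; rewrite addr_ge0 ?sqr_ge0.
Qed.

Lemma resre_norm A i j : A^T = A -> `|resre A i j| <= t^-1.
Proof.
move=> sA; rewrite -ler_sqr ?nnegrE ?invr_ge0 ?(ltW t0) //.
rewrite real_normK ?num_real //; apply: le_trans (res_entry_le i j sA).
by rewrite lerDl sqr_ge0.
Qed.

Lemma resim_norm A i j : A^T = A -> `|resim A i j| <= t^-1.
Proof.
move=> sA; rewrite -ler_sqr ?nnegrE ?invr_ge0 ?(ltW t0) //.
rewrite real_normK ?num_real //; apply: le_trans (res_entry_le i j sA).
by rewrite lerDr sqr_ge0.
Qed.

(** The right side is Coulson's integrand at t, summed over the spectrum. *)
Lemma mxtrace_mul_resre A : A^T = A ->
  \tr (A *m resre A) = \sum_i (eigs A).2 0 i ^+ 2 / ((eigs A).2 0 i ^+ 2 + t ^+ 2).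
Proof.
move=> sA; rewrite /resre; have [PP PP' AE] := eigsP sA.
set P := (eigs _).1 in PP PP' AE *; set d := (eigs _).2 in AE *.
pose D := diag_mx (\row_i (d 0 i ^+ 2 + t ^+ 2)).
have dt i : d 0 i ^+ 2 + t ^+ 2 != 0.
  by rewrite lt0r_neq0 // ltr_wpDl ?sqr_ge0 // exprn_gt0.
have AA : A *m A = P^T *m diag_mx (\row_i (d 0 i ^+ 2)) *m P.
  rewrite {1 2}AE !mulmxA -(mulmxA _ P) PP mulmx1 -(mulmxA P^T) mulmx_diag.
  by congr (_ *m diag_mx _ *m _); apply/rowP => i; rewrite !mxE expr2.
have ME : A *m A + (t ^+ 2)%:M = P^T *m D *m P.
  have -> : (t ^+ 2)%:M = P^T *m (t ^+ 2)%:M *m P.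
    by rewrite mul_mx_scalar -scalemxAl PP' scalemx1.
  rewrite AA -mulmxDl -mulmxDr; congr (_ *m _ *m _).
  by apply/matrixP => i j; rewrite !mxE; case: eqP; rewrite ?mulr1n ?mulr0n ?addr0.
pose X := P^T *m diag_mx (\row_i (d 0 i ^+ 2 + t ^+ 2)^-1) *m P.
have MX : (A *m A + (t ^+ 2)%:M) *m X = 1%:M.
  rewrite ME /X !mulmxA -(mulmxA _ P) PP mulmx1 -(mulmxA P^T) mulmx_diag.
  rewrite [X in diag_mx X](_ : _ = const_mx 1).
    by rewrite diag_const_mx mulmx1 PP'.
  by apply/rowP => i; rewrite !mxE divff.
have -> : invmx (A *m A + (t ^+ 2)%:M) = X.
  by rewrite -[LHS]mulmx1 -MX mulKmx // sqr_shift_unit.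
rewrite mulmxA AA /X !mulmxA -(mulmxA _ P) PP mulmx1 -(mulmxA P^T) mulmx_diag.
rewrite mxtrace_mulC !mulmxA PP mul1mx mxtrace_diag.
by apply: eq_bigr => i _; rewrite !mxE.
Qed.

End Resolvent.

(** * Change of the resolvent when one edge is added *)

Section RankTwoUpdate.
Variables (R : realType) (n : nat) (t : R).
Hypothesis t0 : 0 < t.
Implicit Types A X Y : 'M[R]_n.

Definition edge_mx (i j : 'I_n) : 'M[R]_n := delta_mx i j + delta_mx j i.

Lemma tr_edge_mx i j : (edge_mx i j)^T = edge_mx i j.
Proof. by rewrite /edge_mx linearD /= !trmx_delta addrC. Qed.

Lemma mulmx_edge X Y i j k l :
  (X *m edge_mx i j *m Y) k l = X k i * Y j l + X k j * Y i l.
Proof.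
have H a b : (X *m delta_mx a b *m Y) k l = X k a * Y b l.
  rewrite -(mul_delta_mx (0 : 'I_1)) mulmxA -mulmxA -colE -rowE.
  by rewrite !mxE big_ord1 !mxE.
by rewrite /edge_mx mulmxDr mulmxDl mxE !H.
Qed.

Lemma resre_edge A0 A1 i j k l : A0^T = A0 -> A1 = A0 + edge_mx i j ->
  resre t A1 k l - resre t A0 k l =
    resim t A0 k i * resim t A1 j l + resim t A0 k j * resim t A1 i l
    - (resre t A0 k i * resre t A1 j l + resre t A0 k j * resre t A1 i l).
Proof.
move=> s0 A1E; have s1 : A1^T = A1 by rewrite A1E linearD /= tr_edge_mx s0.
have subE X Y : (X - Y) k l = X k l - Y k l by rewrite !mxE.
by rewrite -subE (resreB t0 s0 s1) subE -!mulmx_edge A1E [_ - A0]addrC addKr.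
Qed.

Lemma resim_edge A0 A1 i j k l : A0^T = A0 -> A1 = A0 + edge_mx i j ->
  resim t A1 k l - resim t A0 k l =
    - (resre t A0 k i * resim t A1 j l + resre t A0 k j * resim t A1 i l
       + (resim t A0 k i * resre t A1 j l + resim t A0 k j * resre t A1 i l)).
Proof.
move=> s0 A1E; have s1 : A1^T = A1 by rewrite A1E linearD /= tr_edge_mx s0.
have subE X Y : (X - Y) k l = X k l - Y k l by rewrite !mxE.
have oppDE X Y : (- (X + Y)) k l = - (X k l + Y k l) by rewrite !mxE.
by rewrite -subE (resimB t0 s0 s1) oppDE -!mulmx_edge A1E [_ - A0]addrC addKr.
Qed.

Let norm4_le (a b c d u : R) : `|a| <= u -> `|b| <= u -> `|c| <= u ->
  `|d| <= u -> `|a + b - (c + d)| <= 4 * u /\ `|- (a + b + (c + d))| <= 4 * u.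
Proof.
rewrite !ler_norml => /andP[a1 a2] /andP[b1 b2] /andP[c1 c2] /andP[d1 d2].
by split; apply/andP; split; lra.
Qed.

Let normM_le (a b u : R) : `|a| <= u -> `|b| <= u -> `|a * b| <= u ^+ 2.
Proof. by move=> au bu; rewrite normrM expr2 ler_pM. Qed.

Lemma res_edge_norm A0 A1 i j k l : A0^T = A0 -> A1 = A0 + edge_mx i j ->
  `|resre t A1 k l - resre t A0 k l| <= 4 * t^-1 ^+ 2 /\
  `|resim t A1 k l - resim t A0 k l| <= 4 * t^-1 ^+ 2.
Proof.
move=> s0 A1E; have s1 : A1^T = A1 by rewrite A1E linearD /= tr_edge_mx s0.
rewrite (resre_edge _ _ s0 A1E) (resim_edge _ _ s0 A1E).
have re0 a b := resre_norm t0 a b s0; have re1 a b := resre_norm t0 a b s1.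
have im0 a b := resim_norm t0 a b s0; have im1 a b := resim_norm t0 a b s1.
by split; [apply: (norm4_le _ _ _ _).1|apply: (norm4_le _ _ _ _).2]; exact: normM_le.
Qed.

Let sum_normM_le (U : {set 'I_n}) (x y : 'I_n -> R) u :
  \sum_k x k ^+ 2 <= u -> \sum_k y k ^+ 2 <= u ->
  \sum_(k in U) `|x k * y k| <= u.
Proof.
move=> xu yu; apply: (@le_trans _ _ (\sum_k `|x k * y k|)).
  by rewrite [leRHS](bigID (mem U)) /= lerDl sumr_ge0.
apply: (@le_trans _ _ (\sum_k (x k ^+ 2 + y k ^+ 2) / 2)).
  apply: ler_sum => k _; rewrite normrM -[x k ^+ 2]real_normK ?num_real //.
  rewrite -[y k ^+ 2]real_normK ?num_real //.
  by move: `|x k| `|y k| => a b; have := sqr_ge0 (a - b); lra.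
by rewrite -mulr_suml big_split /=; lra.
Qed.

(** Entrywise bounds would cost a factor |U|. Instead, each of the four sums over k is an inner
    product of a column and a row of resolvents, whose squared lengths are at most t^-2 by the Ward
    identity. *)
Lemma res_edge_trace (U : {set 'I_n}) A0 A1 i j :
    A0^T = A0 -> A1 = A0 + edge_mx i j ->
  `|\sum_(k in U) resre t A1 k k - \sum_(k in U) resre t A0 k k|
    <= 4 * t^-1 ^+ 2 /\
  `|\sum_(k in U) resim t A1 k k - \sum_(k in U) resim t A0 k k|
    <= 4 * t^-1 ^+ 2.
Proof.
move=> s0 A1E; have s1 : A1^T = A1 by rewrite A1E linearD /= tr_edge_mx s0.
have col_re A a : A^T = A -> \sum_k resre t A k a ^+ 2 <= t^-1 ^+ 2.
  move=> sA; apply: le_trans (res_row_le t0 a sA); apply: ler_sum => k _.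
  by rewrite -{1}(tr_resre t0 sA) mxE lerDl sqr_ge0.
have col_im A a : A^T = A -> \sum_k resim t A k a ^+ 2 <= t^-1 ^+ 2.
  move=> sA; apply: le_trans (res_row_le t0 a sA); apply: ler_sum => k _.
  by rewrite -{1}(tr_resim t sA) mxE lerDr sqr_ge0.
have row_re A a : A^T = A -> \sum_k resre t A a k ^+ 2 <= t^-1 ^+ 2.
  move=> sA; apply: le_trans (res_row_le t0 a sA); apply: ler_sum => k _.
  by rewrite lerDl sqr_ge0.
have row_im A a : A^T = A -> \sum_k resim t A a k ^+ 2 <= t^-1 ^+ 2.
  move=> sA; apply: le_trans (res_row_le t0 a sA); apply: ler_sum => k _.
  by rewrite lerDr sqr_ge0.
have S x y : \sum_k x k ^+ 2 <= t^-1 ^+ 2 -> \sum_k y k ^+ 2 <= t^-1 ^+ 2 ->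
    `|\sum_(k in U) x k * y k| <= t^-1 ^+ 2.
  move=> xu yu; apply: le_trans (ler_norm_sum _ _ _) _; exact: sum_normM_le.
rewrite -!sumrB; split.
- under eq_bigr do rewrite (resre_edge _ _ s0 A1E).
  by rewrite sumrB !big_split /=; apply: (norm4_le _ _ _ _).1; apply: S; auto.
- under eq_bigr do rewrite (resim_edge _ _ s0 A1E).
  by rewrite sumrN !big_split /=; apply: (norm4_le _ _ _ _).2; apply: S; auto.
Qed.

End RankTwoUpdate.

(** [h] enumerates, possibly with repetitions, the coordinates on which [f] depends. For graphs [T]
    consists of all vertex sets, exponentially many, of which only pairs matter. *)
Lemma efron_stein_card (R : realType) (T I : finType) (p : R) (h : I -> T)
    (f : {set T} -> R) (a : R) : 0 <= p <= 1 ->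
    (forall e, (forall i, e != h i) -> forall G, bdiff e f G = 0) ->
    (forall i G, `|bdiff (h i) f G| <= a) ->
  bvar p f <= p * (1 - p) * (#|I|%:R * a ^+ 2).
Proof.
move=> p01 f0 fa; apply: le_trans (efron_stein p01 f) _.
have pq0 : 0 <= p * (1 - p).
  by case/andP: p01 => ? ?; rewrite mulr_ge0 // subr_ge0.
apply: ler_wpM2l => //.
have H e : bexp p (fun G => bdiff e f G ^+ 2) <= \sum_i a ^+ 2 * (e == h i)%:R.
  have [/existsP[i /eqP ei]|] := boolP [exists i, e == h i].
    rewrite (bigD1 i) //= -ei eqxx mulr1.
    apply: (@le_trans _ _ (a ^+ 2)).
      rewrite -[leRHS](@bexp_cst R T p); apply: ler_bexp => // G.
      rewrite -[leLHS]real_normK ?num_real // ei.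
      have H := fa i G; rewrite lerXn2r // nnegrE //.
      by apply: le_trans H.
    by rewrite lerDl sumr_ge0 // => j _; rewrite mulr_ge0 // sqr_ge0.
  rewrite negb_exists => /forallP ne.
  rewrite (@eq_bexp _ _ _ _ (fun=> 0)) ?bexp_cst.
    by apply: sumr_ge0 => i _; rewrite mulr_ge0 // sqr_ge0.
  by move=> G; rewrite f0 // expr0n.
apply: le_trans (ler_sum _ (fun e _ => H e)) _; rewrite exchange_big /=.
under eq_bigr do rewrite -mulr_sumr.
have -> : \sum_(i : I) a ^+ 2 * \sum_(e : T) (e == h i)%:R = \sum_(i : I) a ^+ 2.
  apply: eq_bigr => i _; rewrite (bigD1 (h i)) //= eqxx big1 ?addr0 ?mulr1 //.
  by move=> e /negPf ->.
by rewrite sumr_const mulr_natl.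
Qed.

Lemma eq_pair_set (T : finType) (i j k l : T) : i != j ->
  ([set k; l] == [set i; j])%SET = (k == i) && (l == j) || (k == j) && (l == i).
Proof.
move=> ij; apply/eqP/orP => [H|].
  have /setP M := H; have := M k; have := M l; have := M i; have := M j.
  rewrite !inE !eqxx /= !orbT /=.
  have [->|ki] /= := eqVneq k i.
    by rewrite (eq_sym j) (negPf ij) /= => /eqP ->; left; rewrite eqxx.
  by move=> _ /eqP <- _ /esym/eqP ->; right; rewrite !eqxx.
by case=> /andP[/eqP-> /eqP->] //; rewrite finset.setUC.
Qed.

(** * Centered adjacency matrices and their dependence on one edge *)

Section CenteredAdjacency.
Variables (R : realType) (n : nat) (p : R).
Hypothesis p01 : 0 <= p <= 1.
Implicit Types (K : rel 'I_n) (G : {set {set 'I_n}}).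

(** [K] selects the entries that are kept: a diagonal block, several of them, or the block between a
    set and its complement. All are read off the same [G]. *)
Definition wig K G : 'M[R]_n :=
  \matrix_(i, j) (if (i != j) && K i j then ([set i; j]%SET \in G)%:R - p else 0).

Lemma tr_wig K G : symmetric K -> (wig K G)^T = wig K G.
Proof.
by move=> sK; apply/matrixP => i j; rewrite !mxE eq_sym sK finset.setUC.
Qed.

Lemma wig_edge K G i j : symmetric K -> i != j -> K i j ->
  wig K ([set i; j] |: G)%SET = wig K (G :\ [set i; j])%SET + edge_mx R i j.
Proof.
move=> sK ij Kij; apply/matrixP => k l; rewrite !mxE !inE eq_pair_set //.
have [->|ki] := eqVneq k i; rewrite ?eqxx /=.
  have [->|lj] := eqVneq l j; rewrite ?ij ?Kij /=.
    by rewrite (negPf ij) /=; ring.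
  by rewrite (negPf ij) /= !addr0.
have [->|kj] /= := eqVneq k j; last by rewrite !addr0.
have [->|li] /= := eqVneq l i; last by rewrite !addr0.
by rewrite eq_sym ij sK Kij /=; ring.
Qed.

Lemma wig_nedge K G e : (forall i j, i != j -> K i j -> e != [set i; j]%SET) ->
  wig K (e |: G)%SET = wig K (G :\ e)%SET.
Proof.
move=> He; apply/matrixP => k l; rewrite !mxE; case: ifP => // /andP[kl Kkl].
by rewrite !inE (eq_sym _ e) (negPf (He _ _ kl Kkl)).
Qed.

Lemma bvar_wig K (f : 'M[R]_n -> R) a : symmetric K -> 0 <= a ->
    (forall (A : 'M[R]_n) i j, A^T = A -> `|f (A + edge_mx R i j) - f A| <= a) ->
  bvar p (fun G => f (wig K G)) <= p * (1 - p) * ((n ^ 2)%:R * a ^+ 2).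
Proof.
move=> sK a0 fa; pose h (ij : 'I_n * 'I_n) := [set ij.1; ij.2]%SET.
have -> : (n ^ 2)%:R = #|{: 'I_n * 'I_n}|%:R :> R by rewrite card_prod card_ord.
apply: (@efron_stein_card _ _ _ p h) => // [e He G|[i j] G].
  rewrite /bdiff wig_nedge ?subrr // => i j _ _; exact: (He (i, j)).
(* The index set of ordered pairs also produces singletons, which no entry of the matrix reads. *)
rewrite /bdiff /h /=; have [ij|/negbNE/eqP ->] := boolP (i != j); last first.
  rewrite wig_nedge ?subrr ?normr0 // => k l kl _; apply: contra kl => /eqP H.
  have /setP M := H; have := M k; have := M l; rewrite !inE !eqxx orbT /=.
  by rewrite !orbb => /eqP -> /eqP ->.
have [Kij|nK] := boolP (K i j); first by rewrite wig_edge // fa // tr_wig.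
rewrite wig_nedge ?subrr ?normr0 // => k l kl Kkl; apply: contra nK.
by rewrite eq_pair_set // => /orP[] /andP[/eqP -> /eqP ->] //; rewrite sK.
Qed.

Lemma bvar_trnorm_wig K : symmetric K ->
  bvar p (fun G => trnorm (wig K G)) <= p * (1 - p) * (4 * n%:R ^+ 2).
Proof.
move=> sK; have -> : 4 * n%:R ^+ 2 = (n ^ 2)%:R * 2 ^+ 2 :> R.
  by rewrite natrX; ring.
apply: bvar_wig => // A i j sA.
have E2 : trnorm (edge_mx R i j) <= 2.
  have -> : edge_mx R i j = (delta_mx 0 i : 'rV_n)^T *m (delta_mx 0 j : 'rV_n) +
     (delta_mx 0 j : 'rV_n)^T *m (delta_mx 0 i : 'rV_n).
    by rewrite !trmx_delta !mul_delta_mx.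
  by apply: le_trans (trnorm_rank2 _ _) _; rewrite !sqn_delta.
have sE := tr_edge_mx R i j.
have sAE : (A + edge_mx R i j)^T = A + edge_mx R i j by rewrite linearD /= sA sE.
rewrite ler_norml; apply/andP; split.
  rewrite lerNl opprB (le_trans (ler_trnormB _ _)) // opprD addNKr trnormN //.
by rewrite (le_trans (ler_trnormB _ _)) // addrC addKr.
Qed.

End CenteredAdjacency.

(** * The semicircle law *)

Section LocalLaw.
Variables (R : realType) (n : nat) (p t : R) (U : {set 'I_n}).
Hypotheses (p01 : 0 <= p <= 1) (t0 : 0 < t).
Implicit Types (G : {set {set 'I_n}}).

Definition inside : rel 'I_n := fun i j => (i \in U) && (j \in U).

Lemma inside_sym : symmetric inside.
Proof. by move=> i j; rewrite /inside andbC. Qed.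

Let W G : 'M[R]_n := wig p inside G.
Let sW G : (W G)^T = W G := tr_wig p G inside_sym.
Let re G := resre t (W G).
Let im G := resim t (W G).
Let u := t^-1.

Let u0 : 0 <= u. Proof. by rewrite invr_ge0 ltW. Qed.

Let pq0 : 0 <= p * (1 - p).
Proof. by case/andP: p01 => ? ?; rewrite mulr_ge0 // subr_ge0. Qed.

Definition retr G : R := \sum_(i in U) re G i i.
Definition imtr G : R := \sum_(i in U) im G i i.

Lemma bvar_retr : bvar p retr <= p * (1 - p) * ((n ^ 2)%:R * (4 * u ^+ 2) ^+ 2).
Proof.
apply: (@bvar_wig _ _ _ p01 _ (fun A => \sum_(i in U) resre t A i i)).
- exact: inside_sym.
- by rewrite mulr_ge0 // sqr_ge0.
- by move=> A i j sA; have [] := res_edge_trace t0 U sA (erefl (A + edge_mx R i j)).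
Qed.

Lemma bvar_imtr : bvar p imtr <= p * (1 - p) * ((n ^ 2)%:R * (4 * u ^+ 2) ^+ 2).
Proof.
apply: (@bvar_wig _ _ _ p01 _ (fun A => \sum_(i in U) resim t A i i)).
- exact: inside_sym.
- by rewrite mulr_ge0 // sqr_ge0.
- by move=> A i j sA; have [] := res_edge_trace t0 U sA (erefl (A + edge_mx R i j)).
Qed.

Lemma imtr_ge0 G : 0 <= imtr G.
Proof. by apply: sumr_ge0 => i _; have /andP[] := resim_diag t0 i (sW G). Qed.

(** According to whether [e] belongs to [G], one of the two factors is already evaluated at [G];
    only the other has to be moved. *)
Let prod_close (x y : {set {set 'I_n}} -> R) e a v G :
    (forall G, `|x G| <= a) -> (forall G, `|y G| <= a) ->
    `|bdiff e x G| <= v -> `|bdiff e y G| <= v ->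
  `|x (G :\ e)%SET * y (e |: G)%SET - x G * y G| <= a * v.
Proof.
move=> xa ya; rewrite /bdiff; have [eG|neG] := boolP (e \in G).
  have -> : (e |: G)%SET = G by apply/finset.setUidPr; rewrite finset.sub1set.
  move=> xv _; rewrite -mulrBl normrM mulrC ler_pM // distrC //.
have -> : (G :\ e)%SET = G by apply/finset.setDidPl; rewrite disjoint_sym disjoints1.
by move=> _ yv; rewrite -mulrBr normrM ler_pM.
Qed.

Let bdiff_re i j k l G : i != j -> inside i j ->
  `|bdiff [set i; j]%SET (fun G => re G k l) G| <= 4 * u ^+ 2.
Proof.
move=> ij Uij; rewrite /bdiff /re.
by have [] := res_edge_norm t0 k l (sW _) (wig_edge p G inside_sym ij Uij).
Qed.

Let bdiff_im i j k l G : i != j -> inside i j ->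
  `|bdiff [set i; j]%SET (fun G => im G k l) G| <= 4 * u ^+ 2.
Proof.
move=> ij Uij; rewrite /bdiff /im.
by have [] := res_edge_norm t0 k l (sW _) (wig_edge p G inside_sym ij Uij).
Qed.

Let re_le k l G : `|re G k l| <= u. Proof. exact: resre_norm. Qed.
Let im_le k l G : `|im G k l| <= u. Proof. exact: resim_norm. Qed.

Let h G i j := re G i j ^+ 2 + im G i j ^+ 2.

Let h_ge0 G i j : 0 <= h G i j.
Proof. by rewrite addr_ge0 ?sqr_ge0. Qed.

Let h_sum G : \sum_i \sum_j h G i j <= n%:R * u ^+ 2.
Proof.
apply: (@le_trans _ _ (\sum_(i < n) u ^+ 2)); last first.
  by rewrite sumr_const card_ord mulr_natl.
by apply: ler_sum => i _; exact: res_row_le.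
Qed.

(** The exact identity mixes the graphs without and with the edge. Moving each of its four products
    to [G] costs u * 4 u^2. The two products of off-diagonal entries are left in the error as [h],
    to be summed by the Ward identity. *)
Let re_approx i j G : i != j -> inside i j ->
  `|bdiff [set i; j]%SET (fun G => re G j i) G -
    (im G j j * im G i i - re G j j * re G i i)| <= 16 * u ^+ 3 + h G j i.
Proof.
move=> ij Uij; set e := [set i; j]%SET.
rewrite /bdiff /re (resre_edge t0 _ _ (sW _) (wig_edge p G inside_sym ij Uij)).
rewrite -/(W _) -/e -!/(re _) -!/(im _).
have re1 k l := bdiff_re k l G ij Uij; have im1 k l := bdiff_im k l G ij Uij.
have H1 := prod_close (im_le j i) (im_le j i) (im1 j i) (im1 j i).
have H2 := prod_close (im_le j j) (im_le i i) (im1 j j) (im1 i i).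
have H3 := prod_close (re_le j i) (re_le j i) (re1 j i) (re1 j i).
have H4 := prod_close (re_le j j) (re_le i i) (re1 j j) (re1 i i).
move: H1 H2 H3 H4; rewrite -/e /h.
have -> : u * (4 * u ^+ 2) = 4 * u ^+ 3 by ring.
have := sqr_ge0 (re G j i); have := sqr_ge0 (im G j i).
rewrite !expr2 !ler_norml => s1 s2.
move=> /andP[? ?] /andP[? ?] /andP[? ?] /andP[? ?].
by apply/andP; split; lra.
Qed.

Let im_approx i j G : i != j -> inside i j ->
  `|bdiff [set i; j]%SET (fun G => im G j i) G -
    - (re G j j * im G i i + im G j j * re G i i)| <= 16 * u ^+ 3 + h G j i.
Proof.
move=> ij Uij; set e := [set i; j]%SET.
rewrite /bdiff /im (resim_edge t0 _ _ (sW _) (wig_edge p G inside_sym ij Uij)).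
rewrite -/(W _) -/e -!/(re _) -!/(im _).
have re1 k l := bdiff_re k l G ij Uij; have im1 k l := bdiff_im k l G ij Uij.
have H1 := prod_close (re_le j i) (im_le j i) (re1 j i) (im1 j i).
have H2 := prod_close (re_le j j) (im_le i i) (re1 j j) (im1 i i).
have H3 := prod_close (im_le j i) (re_le j i) (im1 j i) (re1 j i).
have H4 := prod_close (im_le j j) (re_le i i) (im1 j j) (re1 i i).
move: H1 H2 H3 H4; rewrite -/e /h.
have -> : u * (4 * u ^+ 2) = 4 * u ^+ 3 by ring.
have := sqr_ge0 (re G j i - im G j i); have := sqr_ge0 (re G j i + im G j i).
rewrite !sqrrD !expr2 !mulrN mulNr opprK !ler_norml => s1 s2.
move=> /andP[? ?] /andP[? ?] /andP[? ?] /andP[? ?].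
by apply/andP; split; lra.
Qed.

Let err := p * (1 - p) * (16 * u ^+ 3 * (n ^ 2)%:R + n%:R * u ^+ 2).

(** Stein's formula is applied to each entry of [W] inside [U], and the derivative is replaced by
    [C]. The double sum of [C] includes the diagonal, where [W] vanishes; the second hypothesis
    charges those terms to [h G i i]. *)
Let ibp_sum (X : {set {set 'I_n}} -> 'M[R]_n) (C : {set {set 'I_n}} -> 'I_n -> 'I_n -> R) :
    (forall G i j, i != j -> inside i j ->
      `|bdiff [set i; j]%SET (fun G => X G j i) G - C G i j|
        <= 16 * u ^+ 3 + h G j i) ->
    (forall G i, `|C G i i| <= h G i i) ->
  `|bexp p (fun G => \sum_(i in U) (W G *m X G) i i)
    - p * (1 - p) * bexp p (fun G => \sum_(i in U) \sum_(j in U) C G i j)| <= err.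
Proof.
move=> XC CD.
have -> : bexp p (fun G => \sum_(i in U) (W G *m X G) i i) =
    p * (1 - p) * bexp p (fun G => \sum_(i in U) \sum_(j in U)
      (if i != j then bdiff [set i; j]%SET (fun G => X G j i) G else 0)).
  rewrite !bexp_sum mulr_sumr; apply: eq_bigr => i iU.
  rewrite (eq_bexp p (g := fun G => \sum_(j in U) W G i j * X G j i)).
    rewrite !bexp_sum mulr_sumr; apply: eq_bigr => j jU.
    rewrite (eq_bexp p (g := fun G : {set {set 'I_n}} => if i != j then
        (([set i; j]%SET \in G)%:R - p) * X G j i else 0)).
      by case: (i != j); rewrite ?bexp_stein // !bexp_cst mulr0.
    by move=> G; rewrite mxE /inside iU jU andbT; case: (i != j); rewrite ?mul0r.
  move=> G; rewrite mxE (bigID (mem U)) /= addrC big1 ?add0r // => j jU.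
  by rewrite mxE /inside (negPf jU) !andbF mul0r.
rewrite -mulrBr normrM (ger0_norm pq0) /err; apply: ler_wpM2l => //.
rewrite -bexpB; apply: le_trans (ler_norm_bexp p01 _) _.
rewrite -[leRHS](@bexp_cst R {set 'I_n} p); apply: ler_bexp => // G.
rewrite -sumrB; apply: le_trans (ler_norm_sum _ _ _) _.
apply: (@le_trans _ _ (\sum_(i in U) \sum_(j in U) (16 * u ^+ 3 + h G j i))).
  apply: ler_sum => i iU; rewrite -sumrB; apply: le_trans (ler_norm_sum _ _ _) _.
  apply: ler_sum => j jU; have [->|ij] /= := eqVneq i j.
    rewrite sub0r normrN; apply: le_trans (CD G j) _; rewrite lerDr.
    by rewrite mulr_ge0 // exprn_ge0.
  by apply: XC => //; rewrite /inside iU jU.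
apply: (@le_trans _ _ (\sum_i \sum_j (16 * u ^+ 3 + h G j i))).
  have H0 i j : 0 <= 16 * u ^+ 3 + h G j i by rewrite addr_ge0 // mulr_ge0 // exprn_ge0.
  rewrite [leRHS](bigID (mem U)) /=; apply: ler_wpDr.
    by apply: sumr_ge0 => i _; apply: sumr_ge0 => j _.
  apply: ler_sum => i _; rewrite [leRHS](bigID (mem U)) /= lerDl.
  by apply: sumr_ge0 => j _.
under eq_bigr do rewrite big_split /=.
rewrite big_split /= [X in _ + X <= _]exchange_big /= lerD //.
by rewrite !sumr_const card_ord -mulrnA mulnn -[leLHS]mulr_natr.
Qed.

Let retrE G : \sum_(i in U) (W G *m im G) i i = t * retr G.
Proof. by rewrite mul_resim mulr_sumr; apply: eq_bigr => i _; rewrite mxE. Qed.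

Let imtrE G : \sum_(i in U) (W G *m re G) i i = #|U|%:R - t * imtr G.
Proof.
rewrite mul_resre // /imtr mulr_sumr -sumr_const -sumrB.
by apply: eq_bigr => i _; rewrite !mxE eqxx.
Qed.

(* The real and imaginary parts of p (1 - p) g ^ 2 + z g + |U| = 0, z = i t, for the
   partial trace g = retr + i imtr of the resolvent. *)
Lemma imtr_equation :
  `|#|U|%:R - t * bexp p imtr -
    p * (1 - p) * bexp p (fun G => imtr G ^+ 2 - retr G ^+ 2)| <= err.
Proof.
have := @ibp_sum re (fun G i j => im G j j * im G i i - re G j j * re G i i).
have -> : bexp p (fun G => \sum_(i in U) (W G *m re G) i i) =
    #|U|%:R - t * bexp p imtr.
  rewrite (eq_bexp p imtrE) bexpB bexpZ bexp_cst //.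
rewrite [X in _ - _ * X](eq_bexp p (g := fun G => imtr G ^+ 2 - retr G ^+ 2)).
  apply; first by move=> G i j; exact: re_approx.
  move=> G i; rewrite /h -!expr2 ler_norml.
  by have := sqr_ge0 (re G i i); have := sqr_ge0 (im G i i); lra.
move=> G; rewrite !expr2 /imtr /retr !mulr_suml -sumrB; apply: eq_bigr => i _.
by rewrite !mulr_sumr -sumrB; apply: eq_bigr => j _; ring.
Qed.

Lemma retr_equation :
  `|t * bexp p retr + p * (1 - p) * (2 * bexp p (fun G => retr G * imtr G))|
    <= err.
Proof.
have := @ibp_sum im (fun G i j => - (re G j j * im G i i + im G j j * re G i i)).
rewrite (eq_bexp p retrE) bexpZ.
rewrite [X in _ - _ * X](eq_bexp p (g := fun G => -2 * (retr G * imtr G))).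
  rewrite bexpZ mulNr mulrN opprK; apply; first by move=> G i j; exact: im_approx.
  move=> G i; rewrite /h normrN ler_norml; apply/andP.
  have := sqr_ge0 (re G i i - im G i i); have := sqr_ge0 (re G i i + im G i i).
  by rewrite !sqrrD !expr2 !mulrN mulNr opprK; split; lra.
move=> G; rewrite /imtr /retr.
have -> : -2 * ((\sum_(i in U) re G i i) * (\sum_(i in U) im G i i)) =
   - ((\sum_(i in U) im G i i) * (\sum_(i in U) re G i i) +
   (\sum_(i in U) re G i i) * (\sum_(i in U) im G i i)) by ring.
rewrite !mulr_suml -big_split -sumrN; apply: eq_bigr => i _ /=.
rewrite !mulr_sumr -big_split -sumrN; apply: eq_bigr => j _ /=; ring.
Qed.

Lemma mxtrace_wig_resre G : \tr (W G *m re G) = #|U|%:R - t * imtr G.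
Proof.
rewrite -imtrE /mxtrace [LHS](bigID (mem U)) /= addrC big1 ?add0r // => i iU.
by rewrite mxE big1 // => j _; rewrite mxE /inside (negPf iU) andbF mul0r.
Qed.

End LocalLaw.

(** * Riemann sums for Coulson's integral and for the semicircle law *)

Section RiemannSums.
Variable R : realType.

Lemma atan_le (x : R) : 0 <= x -> atan x <= x.
Proof.
rewrite le_eqVlt => /orP[/eqP <-|x0]; first by rewrite atan0.
have [c _ H] := @MVT R (@atan R) (fun x => (1 + x ^+ 2)^-1) 0 x x0
  (fun y _ => is_derive1_atan y)
  (continuous_subspaceT (@continuous_atan R)).
move: H; rewrite atan0 !subr0 => ->; rewrite ler_piMl ?(ltW x0) // invf_le1.
  by rewrite lerDl sqr_ge0.
by rewrite ltr_wpDr ?sqr_ge0.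
Qed.

Lemma pihalf_sub_atan_le (x : R) : 0 < x -> pi / 2 - atan x <= x^-1.
Proof.
move=> x0; set th := pi / 2 - atan x.
have a0 : 0 < atan x by rewrite -atan0 lt_atan.
have thB : th \in `](- (pi / 2)), (pi / 2)[.
  have := atan_ltpi2 x; rewrite in_itv /= /th => ?; apply/andP; split.
    have := pi_gt0 R; lra.
  lra.
have -> : th = atan (tan th) by rewrite tanK.
have -> : tan th = x^-1.
  rewrite /tan /th sinB cosB sin_pihalf cos_pihalf !mul0r !mul1r subr0 add0r.
  by rewrite -invf_div -/(tan _) atanK.
by rewrite atan_le // invr_ge0 ltW.
Qed.

(** x atan (s / x) is a primitive in s of the decreasing function x^2 / (x^2 + s^2). *)
Lemma coulson_step (x a b : R) : 0 < x -> 0 <= a -> a < b ->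
  (b - a) * (x ^+ 2 / (x ^+ 2 + b ^+ 2)) <= x * atan (b / x) - x * atan (a / x)
    <= (b - a) * (x ^+ 2 / (x ^+ 2 + a ^+ 2)).
Proof.
move=> x0 a0 ab; have ab' : a / x < b / x by rewrite ltr_pM2r // invr_gt0.
have [c cab H] := @MVT R (@atan R) (fun x => (1 + x ^+ 2)^-1) (a / x) (b / x) ab'
  (fun y _ => is_derive1_atan y)
  (continuous_subspaceT (@continuous_atan R)).
rewrite -mulrBr H.
have P (y : R) : 0 < 1 + y ^+ 2 by have := sqr_ge0 y; lra.
have -> : x * ((1 + c ^+ 2)^-1 * (b / x - a / x)) = (b - a) * (1 + c ^+ 2)^-1.
  by field; rewrite (lt0r_neq0 x0) andbT lt0r_neq0.
have E y : x ^+ 2 / (x ^+ 2 + y ^+ 2) = (1 + (y / x) ^+ 2)^-1.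
  have x2 : 0 < x ^+ 2 by exact: exprn_gt0.
  have xy : x ^+ 2 + y ^+ 2 != 0 by rewrite lt0r_neq0 //; have := sqr_ge0 y; lra.
  by field; rewrite (lt0r_neq0 x0) /= xy.
move: cab; rewrite in_itv /= => /andP[ac cb].
have ax0 : 0 <= a / x by rewrite divr_ge0 // ltW.
have c0 : 0 <= c by apply: le_trans ax0 (ltW ac).
rewrite !E; apply/andP; split; apply: ler_wpM2l; rewrite ?subr_ge0 ?(ltW ab) //.
  rewrite lef_pV2 ?posrE // lerD2l ler_sqr ?nnegrE ?(ltW cb) //.
  exact: le_trans c0 (ltW cb).
by rewrite lef_pV2 ?posrE // lerD2l ler_sqr ?nnegrE // ltW.
Qed.

(* Riemann sums of the Coulson integral
   pi / 2 * |x| = \int_0^oo x ^ 2 / (x ^ 2 + s ^ 2) ds. *)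
Lemma coulson_sum (x h : R) (N : nat) : 0 < h -> (0 < N)%N ->
  `|pi / 2 * `|x| - h * \sum_(1 <= j < N.+1) x ^+ 2 / (x ^+ 2 + (j%:R * h) ^+ 2)|
    <= h + x ^+ 2 / (h * N%:R).
Proof.
move=> h0 N0; have hN : 0 < h * N%:R by rewrite mulr_gt0 // ltr0n.
rewrite -[x ^+ 2]real_normK ?num_real //.
have [->|xn0] := eqVneq `|x| 0.
  rewrite expr0n /= mul0r mulr0 add0r big1 ?mulr0 ?oppr0 ?normr0 ?addr0 ?(ltW h0) //.
  by move=> j _; rewrite mul0r.
have {xn0} : 0 < `|x| by rewrite lt0r xn0 normr_ge0.
move: `|x| => {}x x0; pose f j := x * atan (j%:R * h / x).
pose g j := x ^+ 2 / (x ^+ 2 + (j%:R * h) ^+ 2).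
have step j : h * g j.+1 <= f j.+1 - f j <= h * g j.
  have := @coulson_step x (j%:R * h) (j.+1%:R * h) x0.
  rewrite -mulrBl -natrB // subSnn mul1r; apply; last by rewrite ltr_pM2r ?ltr_nat.
  by rewrite mulr_ge0 // ltW.
have f0 : f 0%N = 0 by rewrite /f !mul0r atan0 mulr0.
have g0 : g 0%N = 1.
  by rewrite /g mul0r expr0n addr0 divff // expf_neq0 // lt0r_neq0.
have gge0 j : 0 <= g j by rewrite divr_ge0 ?sqr_ge0 // addr_ge0 ?sqr_ge0.
have fE : f N = \sum_(0 <= k < N) (f k.+1 - f k).
  by rewrite telescope_sumr // f0 subr0.
have lo : h * \sum_(1 <= j < N.+1) g j <= f N.
  rewrite fE big_add1 mulr_sumr.
  by apply: ler_sum => j _; have /andP[] := step j.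
(* Left endpoints bring in the node 0, where the integrand is 1; this is the extra h. *)
have up : f N <= h * \sum_(1 <= j < N.+1) g j + h.
  apply: (@le_trans _ _ (h * \sum_(0 <= j < N) g j)).
    rewrite fE mulr_sumr.
    by apply: ler_sum => j _; have /andP[] := step j.
  rewrite -[X in _ <= _ + X]mulr1 -mulrDr; apply: ler_wpM2l; first exact: ltW.
  apply: (@le_trans _ _ (\sum_(0 <= j < N.+1) g j)).
    by rewrite big_nat_recr //= lerDl.
  by rewrite big_nat_recl // addrC big_add1 g0.
have tail : 0 <= pi / 2 * x - f N <= x ^+ 2 / (h * N%:R).
  rewrite /f [pi / 2 * x]mulrC -mulrBr; apply/andP; split.
    by rewrite mulr_ge0 ?(ltW x0) // subr_ge0 ltW // atan_ltpi2.
  have -> : x ^+ 2 / (h * N%:R) = x * (x / (h * N%:R)) by rewrite expr2 mulrA.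
  apply: ler_wpM2l; first exact: ltW.
  have y0 : 0 < N%:R * h / x by rewrite divr_gt0 // [N%:R * h]mulrC.
  apply: le_trans (pihalf_sub_atan_le y0) _.
  by rewrite invf_div [h * _]mulrC.
move: lo up tail; rewrite -/(g _) => lo up /andP[t1 t2].
have -> : \sum_(1 <= j < N.+1) x ^+ 2 / (x ^+ 2 + (j%:R * h) ^+ 2) =
  \sum_(1 <= j < N.+1) g j by [].
by rewrite ler_norml; apply/andP; split; lra.
Qed.

(* The positive root y of y ^ 2 + tau y = kappa; at kappa = 1 it is the value at
   i tau of -i times the Stieltjes transform of the semicircle law. *)
Definition semiroot (kappa tau : R) : R :=
  (Num.sqrt (tau ^+ 2 + 4 * kappa) - tau) / 2.

Lemma semirootP (kappa tau : R) : 0 <= kappa -> 0 <= tau ->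
  0 <= semiroot kappa tau /\
  semiroot kappa tau ^+ 2 + tau * semiroot kappa tau = kappa.
Proof.
move=> k0 t0; have d0 : 0 <= tau ^+ 2 + 4 * kappa.
  by rewrite addr_ge0 ?sqr_ge0 // mulr_ge0.
have E := sqr_sqrtr d0; have s0 := sqrtr_ge0 (tau ^+ 2 + 4 * kappa).
rewrite /semiroot; split.
  rewrite divr_ge0 // subr_ge0 -[leLHS]ger0_norm // -sqrtr_sqr.
  by rewrite ler_wsqrtr // lerDl mulr_ge0.
move: (Num.sqrt _) E s0 => s E s0; nra.
Qed.

(** On the curve tau = kappa / y - y one has y^2 dtau = - (kappa + y^2) dy, so - (kappa y + y^3 / 3)
    is a primitive of y^2 with respect to tau, and y decreases in tau. *)
Lemma semicircle_step (kappa a b ta tb : R) : 0 < kappa -> 0 <= ta -> ta <= tb ->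
    0 <= a -> 0 <= b -> a ^+ 2 + ta * a = kappa -> b ^+ 2 + tb * b = kappa ->
  (tb - ta) * b ^+ 2 <= (kappa * a + a ^+ 3 / 3) - (kappa * b + b ^+ 3 / 3)
    <= (tb - ta) * a ^+ 2.
Proof.
move=> k0 ta0 tab a0 b0 Ea Eb.
have ap : 0 < a by rewrite lt0r a0 andbT; apply/eqP => a1; move: Ea; rewrite a1; lra.
have bp : 0 < b by rewrite lt0r b0 andbT; apply/eqP => b1; move: Eb; rewrite b1; lra.
have an : a != 0 by exact: lt0r_neq0.
have bn : b != 0 by exact: lt0r_neq0.
have taE : ta = kappa / a - a by rewrite -Ea; field.
have tbE : tb = kappa / b - b by rewrite -Eb; field.
have tE : tb - ta = (a - b) * (kappa / (a * b) + 1) by rewrite taE tbE; field; rewrite an bn.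
have ab0 : 0 < kappa / (a * b) by rewrite divr_gt0 // mulr_gt0.
have ab : b <= a.
  rewrite -subr_ge0 -(pmulr_lge0 _ (x := kappa / (a * b) + 1)) -?tE ?subr_ge0 //.
  by rewrite addr_gt0.
have -> : (kappa * a + a ^+ 3 / 3) - (kappa * b + b ^+ 3 / 3) =
   (a - b) * (kappa + (a ^+ 2 + a * b + b ^+ 2) / 3) by field.
have -> : (tb - ta) * b ^+ 2 = (a - b) * (kappa * (b / a) + b ^+ 2).
  by rewrite tE; field; rewrite an bn.
have -> : (tb - ta) * a ^+ 2 = (a - b) * (kappa * (a / b) + a ^+ 2).
  by rewrite tE; field; rewrite an bn.
have s0 : 0 <= a - b by rewrite subr_ge0.
have ba1 : kappa * (b / a) <= kappa.
  by rewrite ler_piMr ?(ltW k0) // ler_pdivrMr // mul1r.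
have ab1 : kappa <= kappa * (a / b).
  by rewrite ler_peMr ?(ltW k0) // ler_pdivlMr // mul1r.
apply/andP; split; apply: ler_wpM2l => //; apply: lerD => //; nra.
Qed.

(** At tau = 0 the root is sqrt kappa, where kappa y + y^3 / 3 equals 4/3 kappa^(3/2). The tail is
    its value at tau = h N, at most 4/3 y, and there y <= 1 / (h N) because tau y <= kappa <= 1. *)
Lemma semicircle_sum (kappa h : R) (N : nat) : 0 <= kappa <= 1 -> 0 < h ->
    (0 < N)%N ->
  `|4 / 3 * (kappa * Num.sqrt kappa)
    - h * \sum_(1 <= j < N.+1) semiroot kappa (j%:R * h) ^+ 2|
    <= h + 4 / (3 * (h * N%:R)).
Proof.
move=> /andP[k0 k1] h0 N0; have hN : 0 < h * N%:R by rewrite mulr_gt0 // ltr0n.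
pose y j := semiroot kappa (j%:R * h).
have jh j : 0 <= j%:R * h by rewrite mulr_ge0 // ltW.
have y0 j : 0 <= y j by have [] := semirootP k0 (jh j).
have yE j : y j ^+ 2 + j%:R * h * y j = kappa by have [] := semirootP k0 (jh j).
have y1 j : y j <= 1.
  rewrite -[leRHS](expr1n R 1) -(@ler_pXn2r _ 2) ?nnegrE // expr1n.
  by rewrite expr1n; apply: le_trans k1; rewrite -(yE j) lerDl mulr_ge0.
pose f j := - (kappa * y j + y j ^+ 3 / 3).
have step j : h * y j.+1 ^+ 2 <= f j.+1 - f j <= h * y j ^+ 2.
  rewrite /f opprK addrC.
  have [k00|kn0] := eqVneq kappa 0.
    have yz i : y i = 0.
      apply/eqP; rewrite -sqrf_eq0 eq_le sqr_ge0 andbT -k00 -(yE i) lerDl.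
      exact: mulr_ge0.
    by rewrite !yz; apply/andP; split; lra.
  have kp : 0 < kappa by rewrite lt0r kn0.
  have := @semicircle_step kappa (y j) (y j.+1) _ _ kp (jh j) _ (y0 _) (y0 _) (yE _) (yE _).
  rewrite -mulrBl -natrB // subSnn mul1r; apply.
  by rewrite ler_pM2r ?ler_nat.
have f0 : f 0%N = - (4 / 3 * (kappa * Num.sqrt kappa)).
  rewrite /f; have -> : y 0%N = Num.sqrt kappa.
    have E0 := yE 0%N; rewrite !mul0r addr0 in E0.
    by rewrite -E0 sqrtr_sqr ger0_norm.
  by move: (Num.sqrt kappa) (sqr_sqrtr k0) => s sE; rewrite -sE; field.
have fN : - (4 / (3 * (h * N%:R))) <= f N <= 0.
  rewrite /f; have yN : y N <= (h * N%:R)^-1.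
    rewrite -[leRHS]mul1r ler_pdivlMr // mulrC [h * _]mulrC.
    by apply: le_trans k1; rewrite -(yE N) lerDr sqr_ge0.
  have y3 : y N ^+ 3 <= y N by rewrite exprS ler_piMr // exprn_ile1.
  have y30 : 0 <= y N ^+ 3 by rewrite exprn_ge0.
  have ky : kappa * y N <= y N by rewrite ler_piMl.
  have ky0 : 0 <= kappa * y N by rewrite mulr_ge0.
  have -> : 4 / (3 * (h * N%:R)) = 4 / 3 * (h * N%:R)^-1 by rewrite invfM mulrA.
  by apply/andP; split; lra.
have lo : h * \sum_(1 <= j < N.+1) y j ^+ 2 <= f N - f 0%N.
  rewrite -telescope_sumr // big_add1 mulr_sumr.
  by apply: ler_sum => j _; have /andP[] := step j.
have up : f N - f 0%N <= h * \sum_(1 <= j < N.+1) y j ^+ 2 + h.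
  apply: (@le_trans _ _ (h * \sum_(0 <= j < N) y j ^+ 2)).
    rewrite -telescope_sumr // mulr_sumr.
    by apply: ler_sum => j _; have /andP[] := step j.
  rewrite -[X in _ <= _ + X]mulr1 -mulrDr; apply: ler_wpM2l; first exact: ltW.
  apply: (@le_trans _ _ (\sum_(0 <= j < N.+1) y j ^+ 2)).
    by rewrite big_nat_recr //= lerDl sqr_ge0.
  by rewrite big_nat_recl // addrC big_add1 lerD2l exprn_ile1.
move: fN lo up; rewrite f0 => /andP[? ?] ? ?.
have -> : \sum_(1 <= j < N.+1) semiroot kappa (j%:R * h) ^+ 2 =
  \sum_(1 <= j < N.+1) y j ^+ 2 by [].
by rewrite ler_norml; apply/andP; split; lra.
Qed.

End RiemannSums.

(** * The expected trace norm of a diagonal block *)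

Section ExpectedTraceNorm.
Variables (R : realType) (p : R).
Hypothesis p01 : 0 < p < 1.

Let p01' : 0 <= p <= 1. Proof. by case/andP: p01 => *; rewrite !ltW. Qed.
Let s : R := Num.sqrt (p * (1 - p)).
Let pq_gt0 : 0 < p * (1 - p).
Proof. by case/andP: p01 => *; rewrite mulr_gt0 // subr_gt0. Qed.
Let s_gt0 : 0 < s. Proof. by rewrite sqrtr_gt0. Qed.
Let sE : s ^+ 2 = p * (1 - p). Proof. by rewrite sqr_sqrtr // ltW. Qed.

(** [x] and [y] are the rescaled real and imaginary parts. The second equation bounds x (tau + 2 y),
    hence |x| <= D / tau. The first then makes y an approximate root, and (Y + y + tau) (Y - y)
    compares it with the exact root Y. *)
Lemma semiroot_stable (kappa tau x y D : R) : 0 <= kappa -> 0 < tau -> 0 <= y ->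
    `|kappa - tau * y - y ^+ 2 + x ^+ 2| <= D -> `|tau * x + 2 * (x * y)| <= D ->
  `|kappa - tau * y - semiroot kappa tau ^+ 2| <= D + D ^+ 2 / tau ^+ 2.
Proof.
move=> k0 t0 y0 H1 H2; have [Y0 YE] := semirootP k0 (ltW t0).
have D0 : 0 <= D by apply: le_trans H2.
have x2 : x ^+ 2 <= D ^+ 2 / tau ^+ 2.
  have t2 : 0 < tau ^+ 2 by rewrite exprn_gt0.
  rewrite ler_pdivlMr // -exprMn -[leLHS]real_normK ?num_real //.
  rewrite ler_sqr ?nnegrE //; apply: le_trans H2.
  have -> : tau * x + 2 * (x * y) = x * (tau + 2 * y) by ring.
  have ty : 0 <= tau + 2 * y by lra.
  rewrite !normrM (gtr0_norm t0) (ger0_norm ty); apply: ler_wpM2l => //; lra.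
move: (semiroot _ _) Y0 YE => Y Y0 YE.
have -> : kappa - tau * y - Y ^+ 2 = tau * (Y - y) by rewrite -YE; ring.
have E : (Y + y + tau) * (Y - y) = kappa - tau * y - y ^+ 2 by rewrite -YE; ring.
apply: (@le_trans _ _ `|(Y + y + tau) * (Y - y)|).
  rewrite !normrM (gtr0_norm t0); apply: ler_wpM2r => //.
  by rewrite ger0_norm; lra.
rewrite E; apply: (@le_trans _ _ (D + x ^+ 2)); last by lra.
move: H1; rewrite !ler_norml => /andP[? ?]; have := sqr_ge0 x.
by move=> ?; apply/andP; split; lra.
Qed.

(** The summands come from moving products of resolvent entries to one graph, from the off-diagonal
    squares, and from the variances of the two partial traces. *)
Definition law_cst (tau : R) : R :=
  16 / (tau ^+ 3 * s) + 1 / tau ^+ 2 + 32 / tau ^+ 4.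

Lemma law_cst_gt0 tau : 0 < tau -> 0 < law_cst tau.
Proof.
move=> t0; have tX k : 0 < tau ^+ k by exact: exprn_gt0.
have ts : 0 < tau ^+ 3 * s by rewrite mulr_gt0.
by rewrite /law_cst !addr_gt0 // divr_gt0.
Qed.

Lemma local_law (n : nat) (U : {set 'I_n}) (tau : R)
    (D := law_cst tau / Num.sqrt n%:R) : (0 < n)%N -> 0 < tau ->
  `|bexp p (fun G => \tr (wig p (inside U) G *m
      resre (tau * s * Num.sqrt n%:R) (wig p (inside U) G))) / n%:R
    - semiroot (#|U|%:R / n%:R) tau ^+ 2| <= D + D ^+ 2 / tau ^+ 2.
Proof.
move=> n0 t0; set q := Num.sqrt n%:R in D *.
have q0 : 0 < q by rewrite sqrtr_gt0 ltr0n.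
have qE : q ^+ 2 = n%:R by rewrite sqr_sqrtr.
have q1 : 1 <= q.
  by rewrite -[leLHS]sqrtr1 ler_wsqrtr // ler1n.
(* At this scale, with unknowns s b / q and s g / q, the coefficients p (1 - p) and n drop out of
   the equations. *)
pose t := tau * s * q; have tp : 0 < t by rewrite !mulr_gt0.
have E1 := imtr_equation U p01' tp; have E2 := retr_equation U p01' tp.
have Vb := bvar_retr U p01' tp; have Vg := bvar_imtr U p01' tp.
have g0 : 0 <= bexp p (imtr p t U).
  by apply: bexp_ge0 => // G; exact: imtr_ge0.
have E3 := ler_cov p01' (retr p t U) (imtr p t U).
have Vb0 := bvar_ge0 p01' (retr p t U); have Vg0 := bvar_ge0 p01' (imtr p t U).
rewrite (eq_bexp p (mxtrace_wig_resre p U tp)) bexpB bexpZ bexp_cst.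
rewrite bexpB in E1.
have Eb2 : bexp p (fun G => retr p t U G ^+ 2) =
    bvar p (retr p t U) + bexp p (retr p t U) ^+ 2 by rewrite bvarE subrK.
have Eg2 : bexp p (fun G => imtr p t U G ^+ 2) =
    bvar p (imtr p t U) + bexp p (imtr p t U) ^+ 2 by rewrite bvarE subrK.
rewrite Eb2 Eg2 in E1; clear Eb2 Eg2.
move: (bexp p (fun G => retr p t U G * imtr p t U G)) E2 E3 => c E2 E3.
move: (bexp p (imtr p t U)) (bexp p (retr p t U)) (bvar p (imtr p t U)) (bvar p (retr p t U))
  Vg0 Vb0 g0 Vg Vb E1 E2 E3 => g b vg vb vg0 vb0 g0.
rewrite natrX -qE -sE => Vg Vb E1 E2 E3.
have sn : s != 0 by exact: lt0r_neq0.
have qn : q != 0 by exact: lt0r_neq0.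
have tn : tau != 0 by exact: lt0r_neq0.
have q20 : 0 < q ^+ 2 by rewrite exprn_gt0.
have s20 : 0 < s ^+ 2 by rewrite exprn_gt0.
pose v := 16 / tau ^+ 4.
have vE : s ^+ 2 * (s ^+ 2 * (q ^+ 2 ^+ 2 * (4 * t^-1 ^+ 2) ^+ 2)) = v.
  by rewrite /v /t; field; rewrite tn sn qn.
have {}Vg : s ^+ 2 * vg <= v by rewrite -vE; apply: ler_wpM2l => //; exact: ltW.
have {}Vb : s ^+ 2 * vb <= v by rewrite -vE; apply: ler_wpM2l => //; exact: ltW.
have sg0 : 0 <= s ^+ 2 * vg by rewrite mulr_ge0 // ltW.
have sb0 : 0 <= s ^+ 2 * vb by rewrite mulr_ge0 // ltW.
pose err := s ^+ 2 * (16 * t^-1 ^+ 3 * q ^+ 2 ^+ 2 + q ^+ 2 * t^-1 ^+ 2).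
have DE : (err + 2 * v) / q ^+ 2 <= D.
  have -> : (err + 2 * v) / q ^+ 2 =
     (16 / (tau ^+ 3 * s)) / q + (1 / tau ^+ 2) / q ^+ 2 + (32 / tau ^+ 4) / q ^+ 2.
    by rewrite /err /v /t; field; rewrite tn sn qn.
  have qq : (q ^+ 2)^-1 <= q^-1.
    by rewrite lef_pV2 ?posrE // expr2 ler_peMr // ltW.
  rewrite /D /law_cst [leRHS]mulrDl [X in _ <= X + _]mulrDl; apply: lerD; last first.
    by apply: ler_wpM2l => //; rewrite divr_ge0 // exprn_ge0 // ltW.
  apply: lerD => //; apply: ler_wpM2l => //.
  by rewrite divr_ge0 // exprn_ge0 // ltW.
have -> : (#|U|%:R - t * g) / q ^+ 2 = #|U|%:R / q ^+ 2 - tau * (s * g / q).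
  by rewrite /t; field.
have v0 : 0 <= v by rewrite divr_ge0 // exprn_ge0 // ltW.
apply: (@semiroot_stable _ _ (s * b / q)) => //.
- by rewrite divr_ge0 // ltW.
- by apply: divr_ge0; [apply: mulr_ge0 => //|]; exact: ltW.
- apply: le_trans DE.
  have -> : #|U|%:R / q ^+ 2 - tau * (s * g / q) - (s * g / q) ^+ 2 + (s * b / q) ^+ 2
     = (#|U|%:R - t * g - s ^+ 2 * g ^+ 2 + s ^+ 2 * b ^+ 2) / q ^+ 2.
    by rewrite /t; field.
  rewrite normrM [X in _ * X]gtr0_norm ?invr_gt0 // ler_pM2r ?invr_gt0 //.
  move: E1; rewrite -/err mulrBr !mulrDr !ler_norml => /andP[? ?].
  by apply/andP; split; lra.
apply: le_trans DE.
have -> : tau * (s * b / q) + 2 * (s * b / q * (s * g / q)) =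
   (t * b + 2 * s ^+ 2 * (b * g)) / q ^+ 2.
  by rewrite /t; field.
rewrite normrM [X in _ * X]gtr0_norm ?invr_gt0 // ler_pM2r ?invr_gt0 //.
have {}E3 : `|s ^+ 2 * (c - b * g)| <= v.
  rewrite normrM gtr0_norm //.
  apply: (@le_trans _ _ (s ^+ 2 * ((vb + vg) / 2))).
    by apply: ler_wpM2l => //; exact: ltW.
  lra.
move: E2 E3; rewrite -/err !ler_norml => /andP[? ?] /andP[? ?].
by apply/andP; split; lra.
Qed.

Lemma mxtrace_sqr_wig n K (G : {set {set 'I_n}}) : symmetric K ->
  \tr (wig p K G *m wig p K G) <= (\sum_i \sum_j (K i j)%:R).
Proof.
move=> sK; apply: ler_sum => i _; rewrite mxE; apply: ler_sum => j _.
rewrite !mxE (eq_sym j) (sK j) finset.setUC; case: (K i j); last first.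
  by rewrite andbF mul0r.
rewrite andbT; case: (i != j); last by rewrite mul0r.
by case/andP: p01 => ? ?; case: (_ \in G) => /=; nra.
Qed.

(** Each of the two Riemann sums contributes h and a tail beyond h N; Coulson's tail is controlled
    by the squared Frobenius norm, at most n^2. The last term is the error of [local_law] at N nodes
    of weight h, each bounded by its value at the first node. *)
Lemma expected_trnorm_bound (n N : nat) (U : {set 'I_n}) (h : R)
    (D := law_cst h / Num.sqrt n%:R) (kappa := #|U|%:R / n%:R) :
    (0 < n)%N -> (0 < N)%N -> 0 < h ->
  `|pi / 2 * bexp p (fun G => trnorm (wig p (inside U) G)) / (s * n%:R * Num.sqrt n%:R)
    - 4 / 3 * (kappa * Num.sqrt kappa)|
  <= 2 * h + ((s ^+ 2)^-1 + 4 / 3) / (h * N%:R) + h * N%:R * (D + D ^+ 2 / h ^+ 2).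
Proof.
move=> n0 N0 h0; set q := Num.sqrt n%:R in D *.
have q0 : 0 < q by rewrite sqrtr_gt0 ltr0n.
have qE : q ^+ 2 = n%:R by rewrite sqr_sqrtr.
have nR0 : 0 < n%:R :> R by rewrite ltr0n.
have hN : 0 < h * N%:R by rewrite mulr_gt0 // ltr0n.
have k01 : 0 <= kappa <= 1.
  rewrite /kappa divr_ge0 //= ler_pdivrMr // mul1r ler_nat.
  by rewrite -[leqRHS]card_ord max_card.
pose W (G : {set {set 'I_n}}) := wig p (inside U) G.
pose t (j : nat) := j%:R * h * s * q.
pose a j := bexp p (fun G => \tr (W G *m resre (t j) (W G))) / n%:R.
have sW G : (W G)^T = W G := tr_wig p G (inside_sym U).
pose h' := h * s * q; have h'0 : 0 < h' by rewrite !mulr_gt0.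
have pt G : `|pi / 2 * trnorm (W G) -
    h' * \sum_(1 <= j < N.+1) \tr (W G *m resre (t j) (W G))| <=
    n%:R * h' + n%:R ^+ 2 / (h' * N%:R).
  have -> : \sum_(1 <= j < N.+1) \tr (W G *m resre (t j) (W G)) =
     \sum_i \sum_(1 <= j < N.+1) (eigs (W G)).2 0 i ^+ 2 /
        ((eigs (W G)).2 0 i ^+ 2 + (j%:R * h') ^+ 2).
    rewrite [RHS]exchange_big /=; apply: eq_big_nat => j /andP[j0 _].
    rewrite mxtrace_mul_resre //; last by rewrite /t !mulr_gt0 // ltr0n.
    by apply: eq_bigr => i _; rewrite /t /h' !mulrA.
  rewrite /trnorm !mulr_sumr -sumrB.
  apply: le_trans (ler_norm_sum _ _ _) _.
  apply: le_trans (ler_sum _ (fun i _ => coulson_sum _ h'0 N0)) _.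
  rewrite big_split /= sumr_const card_ord mulr_natl lerD2l -mulr_suml.
  rewrite -mxtrace_eigs // ler_pM2r ?invr_gt0 ?mulr_gt0 ?ltr0n //.
  apply: le_trans (mxtrace_sqr_wig _ (inside_sym U)) _.
  apply: (@le_trans _ _ (\sum_(i < n) \sum_(j < n) 1)).
    by apply: ler_sum => i _; apply: ler_sum => j _; rewrite lern1 leq_b1.
  by rewrite !sumr_const !card_ord -mulrnA mulnn natrX.
have ex : `|pi / 2 * bexp p (fun G => trnorm (W G)) -
    h' * \sum_(1 <= j < N.+1) (n%:R * a j)| <=
    n%:R * h' + n%:R ^+ 2 / (h' * N%:R).
  have -> : \sum_(1 <= j < N.+1) (n%:R * a j) =
    bexp p (fun G => \sum_(1 <= j < N.+1) \tr (W G *m resre (t j) (W G))).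
    rewrite bexp_sum; apply: eq_bigr => j _.
    by rewrite /a mulrC divfK // lt0r_neq0.
  rewrite -!bexpZ -bexpB; apply: le_trans (ler_norm_bexp p01' _) _.
  by rewrite -[leRHS](@bexp_cst R {set 'I_n} p); apply: ler_bexp.
have snq : 0 < s * n%:R * q by rewrite !mulr_gt0.
have aE : `|h * \sum_(1 <= j < N.+1) a j -
   h * \sum_(1 <= j < N.+1) semiroot kappa (j%:R * h) ^+ 2|
   <= h * N%:R * (D + D ^+ 2 / h ^+ 2).
  rewrite -mulrBr -sumrB normrM gtr0_norm // -mulrA; apply: ler_wpM2l; first exact: ltW.
  apply: le_trans (ler_norm_sum _ _ _) _.
  have -> : N%:R * (D + D ^+ 2 / h ^+ 2) = \sum_(1 <= j < N.+1) (D + D ^+ 2 / h ^+ 2).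
    by rewrite sumr_const_nat subn1 mulr_natl.
  apply: ler_sum_nat => j /andP[j0 _].
  have jh : h <= j%:R * h by apply: ler_peMl; [exact: ltW | rewrite ler1n].
  have jh0 : 0 < j%:R * h by apply: lt_le_trans jh.
  apply: le_trans (local_law U n0 jh0) _; rewrite -/q.
  have C0 : 0 <= law_cst (j%:R * h) / q by rewrite ltW // divr_gt0 // law_cst_gt0.
  have CD : law_cst (j%:R * h) / q <= D.
    have hX k : h ^+ k <= (j%:R * h) ^+ k by rewrite lerXn2r ?nnegrE // ltW.
    rewrite /D ler_pM2r ?invr_gt0 //; apply: lerD; [apply: lerD|]; apply: ler_wpM2l => //.
    - have P3 x : 0 < x -> 0 < x ^+ 3 * s by move=> x0; rewrite mulr_gt0 // exprn_gt0.
      by rewrite lef_pV2 ?posrE ?P3 //; apply: ler_wpM2r => //; exact: ltW.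
    - by rewrite lef_pV2 ?posrE ?exprn_gt0.
    - by rewrite lef_pV2 ?posrE ?exprn_gt0.
  apply: lerD => //; apply: ler_pM.
  - exact: sqr_ge0.
  - by rewrite invr_ge0 exprn_ge0 // ltW.
  - by rewrite lerXn2r ?nnegrE // (le_trans C0).
  - by rewrite lef_pV2 ?posrE ?exprn_gt0 // lerXn2r ?nnegrE // ltW.
have sum := semicircle_sum k01 h0 N0.
have {}ex : `|pi / 2 * bexp p (fun G => trnorm (W G)) / (s * n%:R * q)
    - h * \sum_(1 <= j < N.+1) a j| <= h + (s ^+ 2)^-1 / (h * N%:R).
  rewrite -mulr_sumr in ex.
  have -> : pi / 2 * bexp p (fun G => trnorm (W G)) / (s * n%:R * q)
    - h * \sum_(1 <= j < N.+1) a j =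
    (pi / 2 * bexp p (fun G => trnorm (W G)) - h' * (n%:R * \sum_(1 <= j < N.+1) a j))
     / (s * n%:R * q).
    by rewrite /h'; field; rewrite !lt0r_neq0.
  rewrite normrM [X in _ * X]gtr0_norm ?invr_gt0 // ler_pdivrMr //.
  apply: le_trans ex _; rewrite le_eqVlt; apply/orP; left; apply/eqP.
  by rewrite /h' -qE; field; rewrite !lt0r_neq0 // ltr0n.
have E1 : ((s ^+ 2)^-1 + 4 / 3) / (h * N%:R) =
    (s ^+ 2)^-1 / (h * N%:R) + 4 / (3 * (h * N%:R)).
  by rewrite mulrDl [(3 * _)^-1]invfM (mulrA 4).
rewrite E1; move: ex aE sum; rewrite -/(W _) !ler_norml.
move=> /andP[? ?] /andP[? ?] /andP[? ?]; apply/andP; split; lra.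
Qed.

Lemma expected_trnorm (eps : R) : 0 < eps ->
  (\forall n \near \oo, forall U : {set 'I_n},
    `|bexp p (fun G => trnorm (wig p (inside U) G))
      - 8 / (3 * pi) * s * (#|U|%:R * Num.sqrt #|U|%:R)|
    <= eps * (n%:R * Num.sqrt n%:R))%classic.
Proof.
move=> e0; have pi0 := pi_gt0 R.
(* [eps] in the normalization of [expected_trnorm_bound], which divides by 2 / pi * s * n^(3/2). The
   choices of [h], [N] and the threshold for n make its three error terms at most e / 4 each. *)
pose e := eps * pi / (2 * s); have ep : 0 < e by rewrite divr_gt0 ?mulr_gt0.
pose h := e / 8; have h0 : 0 < h by rewrite divr_gt0.
pose c := ((s ^+ 2)^-1 + 4 / 3) / h * (4 / e).
have c0 : 0 < c.
  have s2 : 0 < (s ^+ 2)^-1 by rewrite invr_gt0 exprn_gt0.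
  by apply: mulr_gt0; apply: divr_gt0 => //; lra.
pose N := (Num.bound c).+1; have N0 : (0 < N)%N by [].
have cN : c <= N%:R.
  apply/ltW/(lt_trans (archi_boundP (ltW c0))).
  by rewrite ltr_nat.
pose C := law_cst h.
have C0 : 0 < C.
  exact: law_cst_gt0.
pose b := h * N%:R * (C + C ^+ 2 / h ^+ 2) * (4 / e) + 1.
exists (Num.bound (b ^+ 2)).+1 => // n /= nb U.
have bnd := archi_boundP (sqr_ge0 b).
have n0 : (0 < n)%N by apply: leq_trans nb.
have hN : 0 < h * N%:R by rewrite mulr_gt0 // ltr0n.
have b1 : 1 <= b.
  have e4 : 0 <= 4 / e by rewrite divr_ge0 // ltW.
  rewrite lerDr; apply: mulr_ge0 => //; apply: mulr_ge0; first exact: ltW.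
  by apply: addr_ge0; [exact: ltW|apply: divr_ge0; exact: sqr_ge0].
have bq : b <= Num.sqrt n%:R.
  rewrite -[leLHS]ger0_norm ?(le_trans _ b1) // -sqrtr_sqr ler_wsqrtr //.
  by apply/ltW/(lt_le_trans bnd); rewrite ler_nat ltnW.
have := expected_trnorm_bound U n0 N0 h0; rewrite -/C.
set q := Num.sqrt n%:R in bq *.
have q0 : 0 < q by rewrite sqrtr_gt0 ltr0n.
have qE : q ^+ 2 = n%:R by rewrite sqr_sqrtr.
set T := bexp p _; set kap := (_ / n%:R) => H.
have T2 : ((s ^+ 2)^-1 + 4 / 3) / (h * N%:R) <= e / 4.
  rewrite ler_pdivrMr //.
  have -> : e / 4 * (h * N%:R) = h * (e / 4) * N%:R by ring.
  have -> : (s ^+ 2)^-1 + 4 / 3 = h * (e / 4) * c.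
    by rewrite /c; field; rewrite !lt0r_neq0.
  by apply: ler_wpM2l => //; apply: mulr_ge0; rewrite ltW // divr_gt0.
have T3 : h * N%:R * (C / q + (C / q) ^+ 2 / h ^+ 2) <= e / 4.
  have q1 : 1 <= q by exact: le_trans bq.
  apply: (@le_trans _ _ (h * N%:R * (C + C ^+ 2 / h ^+ 2) / q)).
    rewrite -[leRHS]mulrA; apply: ler_wpM2l; first exact: ltW.
    have -> : (C / q) ^+ 2 / h ^+ 2 = C ^+ 2 / h ^+ 2 * (q ^+ 2)^-1.
      by field; rewrite !lt0r_neq0.
    rewrite [leRHS]mulrDl lerD2l; apply: ler_wpM2l.
      by apply: divr_ge0; exact: sqr_ge0.
    by rewrite lef_pV2 ?posrE ?exprn_gt0 // expr2 ler_peMr // ltW.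
  rewrite ler_pdivrMr //; apply: (@le_trans _ _ (e / 4 * b)); last first.
    by apply: ler_wpM2l => //; rewrite divr_ge0 // ltW.
  rewrite /b; set X := h * N%:R * _; rewrite mulrDr mulr1; have -> : e / 4 * (X * (4 / e)) = X.
    by field; rewrite lt0r_neq0.
  by rewrite lerDl divr_ge0 // ltW.
have {}H : `|pi / 2 * T / (s * n%:R * q) - 4 / 3 * (kap * Num.sqrt kap)| <= e.
  apply: le_trans H _; have : 2 * h = e / 4 by rewrite /h; field.
  by lra.
have kE : #|U|%:R * Num.sqrt #|U|%:R = kap * Num.sqrt kap * (n%:R * q) :> R.
  have -> : Num.sqrt kap = Num.sqrt #|U|%:R / q.
    by rewrite /kap sqrtrM // sqrtrV.
  by rewrite /kap -qE; field; rewrite lt0r_neq0.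
have -> : T - 8 / (3 * pi) * s * (#|U|%:R * Num.sqrt #|U|%:R) =
   (pi / 2 * T / (s * n%:R * q) - 4 / 3 * (kap * Num.sqrt kap)) *
   (2 / pi * s * (n%:R * q)).
  rewrite kE -qE; move: (pi : R) pi0 (kap * _) => w w0 K.
  by field; rewrite !lt0r_neq0.
have P : 0 < 2 / pi * s * (n%:R * q) by rewrite !mulr_gt0 ?invr_gt0 // ltr0n.
rewrite normrM (gtr0_norm P).
apply: (@le_trans _ _ (e * (2 / pi * s * (n%:R * q)))).
  by rewrite ler_pM2r.
rewrite le_eqVlt; apply/orP; left; apply/eqP.
rewrite /e; move: (pi : R) pi0 => w w0.
by field; rewrite !lt0r_neq0.
Qed.

End ExpectedTraceNorm.

(** * The multipartite graph as a subgraph of the binomial graph *)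

Section Coupling.
Variables (R : realType) (n : nat) (p : R).

(** Puts the multipartite graph on a product space that does not depend on the partition, so that
    all blocks can be compared there. *)
Lemma edge_probE (K : {set {set 'I_n}}) (Q : {set {set 'I_n}} -> Prop) :
  edge_prob p K Q = bprob p (fun G => Q (G :&: K)%SET).
Proof.
rewrite /bprob /bexp (partition_big (fun G : {set {set 'I_n}} => G :&: K)%SET
  (fun H : {set {set 'I_n}} => H \subset K)) /=; last by move=> G _; exact: subsetIr.
rewrite /edge_prob big_mkcondr /=; apply: eq_bigr => H HK.
transitivity ((`[< Q H >])%:R *
    \sum_(G : {set {set 'I_n}} | (G :&: K)%SET == H) bmass p G); last first.
  by rewrite mulr_sumr; apply: eq_bigr => G /eqP ->; rewrite mulrC.
have -> : (if `[< Q H >] then edge_mass p K H else 0) =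
    (`[< Q H >])%:R * edge_mass p K H by case: asboolP; rewrite ?mul1r ?mul0r.
congr (_ * _).
(* An element outside [K] contributes p + (1 - p) = 1, one inside [K] only the weight prescribed by
   [H]. Expanding the product sums over exactly the [G] that meet [K] in [H]. *)
have -> : edge_mass p K H = \prod_e ((if (e \in K) ==> (e \in H) then p else 0) +
    (if (e \in K) ==> (e \notin H) then 1 - p else 0)).
  rewrite /edge_mass big_mkcond; apply: eq_bigr => e _.
  case: (e \in K) => /=; last by rewrite addrC subrK.
  by case: (e \in H); rewrite ?addr0 ?add0r.
rewrite bigA_distr [RHS]big_mkcond /=; apply: eq_bigr => G _.
have [GK|] := eqVneq (G :&: K)%SET H.
  apply: eq_bigr => e _; move/setP/(_ e): GK; rewrite inE.
  by case: (e \in G); case: (e \in K); case: (e \in H).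
move=> GK; have [e eH] : exists e, (e \in (G :&: K)%SET) != (e \in H).
  apply/existsP; apply: contraR GK => /existsPn H'; apply/eqP/setP => e.
  by apply/eqP; rewrite -[_ == _]negbK.
rewrite (bigD1 e) //=; move: eH; rewrite inE.
have := fintype.subsetP HK e.
case: (e \in G); case: (e \in K); case: (e \in H) => //= H'; rewrite ?mul0r //.
- by have := H' isT.
- by have := H' isT.
Qed.

End Coupling.

Section Decomposition.
Variables (R : realType) (n m : nat) (V : nat -> {set 'I_n}).
Hypothesis partsV : is_parts m V.

Lemma parts_cover i : exists2 k, (k < m)%N & i \in V k.
Proof.
case: partsV => _ /and3P[/eqP cov _ _].
have : i \in finset.cover [set V k | k : 'I_m]%SET by rewrite cov inE.
by case/bigcupP => B /imsetP[k _ ->] iB; exists k.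
Qed.

Lemma parts_inj i k l : (k < m)%N -> (l < m)%N -> i \in V k -> i \in V l -> k = l.
Proof.
case: partsV => injV /and3P[_ /finset.trivIsetP tI _] km lm ik il.
apply: injV => //; apply/eqP; apply: contraT => kl.
have Vin a : (a < m)%N -> V a \in [set V i | i : 'I_m]%SET.
  by move=> am; apply/imsetP; exists (Ordinal am).
have := tI (V k) (V l) (Vin k km) (Vin l lm) kl.
by move/pred0P/(_ i); rewrite /= ik il.
Qed.

(** The cutoff serves twice: a = 0 describes the pairs that are not edges of the multipartite graph,
    a = r the blocks of the small parts. *)
Definition same_part (a : nat) : rel 'I_n := fun i j =>
  [exists k : 'I_m, [&& (a <= k)%N, i \in V k & j \in V k]].

Lemma same_part_sym a : symmetric (same_part a).
Proof. by move=> i j; apply: eq_existsb => k; rewrite [X in _ && X]andbC. Qed.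

Lemma same_partE a i j : (same_part a i j)%:R =
  \sum_(a <= k < m) ((i \in V k) && (j \in V k))%:R :> R.
Proof.
rewrite big_nat_cond; have [/existsP[k /and3P[ak ik jk]]|/existsPn H] := boolP (same_part a i j).
  rewrite -big_nat_cond (bigD1_seq (k : nat)) ?iota_uniq //=; last first.
    by rewrite mem_index_iota ak ltn_ord.
  rewrite ik jk /= big_seq_cond big1 ?addr0 // => l.
  rewrite mem_index_iota => /andP[/andP[_ lm] lk].
  case: (boolP (i \in V l)) => //= il; move/eqP: lk; case.
  exact: (parts_inj lm (ltn_ord k) il ik).
rewrite big1 // => k; rewrite andbT => /andP[ak km].
by have := H (Ordinal km); rewrite /= ak /= => /negPf ->.
Qed.

Lemma card_parts : \sum_(0 <= k < m) #|V k|%:R = n%:R :> R.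
Proof.
have cardE (B : {set 'I_n}) : #|B|%:R = \sum_i (i \in B)%:R :> R.
  rewrite -sum1_card natr_sum big_mkcond /=.
  by apply: eq_bigr => i _; case: (i \in B).
under eq_bigr do rewrite cardE.
rewrite exchange_big /=.
have -> : n%:R = \sum_(i < n) 1 :> R by rewrite sumr_const card_ord.
apply: eq_bigr => i _.
have <- : (same_part 0 i i)%:R = \sum_(0 <= k < m) (i \in V k)%:R :> R.
  by rewrite same_partE; apply: eq_bigr => k _; rewrite andbb.
rewrite (_ : same_part 0 i i) //.
have [k km ik] := parts_cover i.
by apply/existsP; exists (Ordinal km); rewrite /= ik.
Qed.

Lemma mem_multipartite_edges i j : i != j ->
  ([set i; j]%SET \in multipartite_edges m V) = ~~ same_part 0 i j.
Proof.
move=> ij; rewrite inE; apply/idP/idP.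
  case/existsP => a /existsP[b /existsP[u /andP[ua /existsP[v /andP[vb]]]]].
  move=> /andP[ab]; have uv : u != v.
    apply: contra ab => /eqP uv; rewrite -val_eqE; apply/eqP.
    by apply: (parts_inj (ltn_ord a) (ltn_ord b) ua); rewrite uv.
  rewrite eq_pair_set // => H; apply/existsPn => k /=; apply/negP => /andP[ik jk].
  move/eqP: ab; apply; apply: val_inj.
  case/orP: H => /andP[/eqP Hi /eqP Hj]; subst i j.
    exact: etrans (esym (parts_inj (ltn_ord k) (ltn_ord a) ik ua))
      (parts_inj (ltn_ord k) (ltn_ord b) jk vb).
  exact: etrans (esym (parts_inj (ltn_ord k) (ltn_ord a) jk ua))
    (parts_inj (ltn_ord k) (ltn_ord b) ik vb).
move=> /existsPn H; have [a am ia] := parts_cover i; have [b bm jb] := parts_cover j.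
apply/existsP; exists (Ordinal am); apply/existsP; exists (Ordinal bm).
apply/existsP; exists i; rewrite /= ia; apply/existsP; exists j; rewrite jb eqxx andbT.
apply/eqP => -[E]; have := H (Ordinal am); by rewrite /= ia E jb.
Qed.

Let ones (B : {set 'I_n}) : 'rV[R]_n := \row_i (i \in B)%:R.

Let sqn_ones B : sqn (ones B) = #|B|%:R.
Proof.
rewrite /sqn -sum1_card natr_sum [RHS]big_mkcond /=.
by apply: eq_bigr => i _; rewrite mxE; case: (i \in B); rewrite ?expr1n ?expr0n.
Qed.

Let onesE B i j : ((ones B)^T *m ones B) i j = ((i \in B) && (j \in B))%:R.
Proof. by rewrite mxE big_ord1 !mxE -natrM mulnb. Qed.

Let sym1 (v : 'rV[R]_n) : (v^T *m v)^T = v^T *m v.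
Proof. by rewrite trmx_mul trmxK. Qed.

Variables (p beta : R) (r : nat).
Hypotheses (p01 : 0 < p < 1) (rm : (r <= m)%N) (beta0 : 0 < beta).
Hypothesis small : forall k, (r <= k < m)%N -> #|V k|%:R <= beta ^+ 2 * n%:R.

(** The number of small parts may grow with n, so they form a single matrix. Its squared Frobenius
    norm is at most the sum of |V_k|^2, hence at most beta^2 n^2, and [th] is taken as beta sqrt
    n. *)
Lemma trnorm_small_parts G : (0 < n)%N ->
  trnorm (wig p (same_part r) G) <= beta * (n%:R * Num.sqrt n%:R).
Proof.
move=> n0; set q := Num.sqrt n%:R; have q0 : 0 < q by rewrite sqrtr_gt0 ltr0n.
have qE : q ^+ 2 = n%:R by rewrite sqr_sqrtr.
have sW := tr_wig p G (same_part_sym r).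
have b0 : 0 < beta * q by rewrite mulr_gt0.
apply: le_trans (trnorm_le_frobenius sW b0) _.
have T : \tr (wig p (same_part r) G *m wig p (same_part r) G) <=
    beta ^+ 2 * n%:R * n%:R.
  apply: le_trans (mxtrace_sqr_wig p01 _ (same_part_sym r)) _.
  have -> : \sum_i \sum_j (same_part r i j)%:R = \sum_(r <= k < m) #|V k|%:R ^+ 2 :> R.
    under eq_bigr do under eq_bigr do rewrite same_partE.
    under eq_bigr do rewrite exchange_big /=.
    rewrite exchange_big /=; apply: eq_bigr => k _.
    rewrite expr2 -sqn_ones /sqn mulr_suml; apply: eq_bigr => i _.
    rewrite mulr_sumr; apply: eq_bigr => j _.
    by rewrite !mxE; do 2 case: (_ \in _); rewrite ?expr1n ?expr0n /= ?mulr1 ?mulr0.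
  apply: (@le_trans _ _ (\sum_(r <= k < m) beta ^+ 2 * n%:R * #|V k|%:R)).
    by apply: ler_sum_nat => k km; rewrite expr2 ler_wpM2r // small.
  rewrite -mulr_sumr; apply: ler_wpM2l; first by rewrite mulr_ge0 ?sqr_ge0.
  by rewrite -card_parts (big_cat_nat (leq0n r) rm) /= lerDr sumr_ge0.
have -> : beta * (n%:R * q) = (n%:R * (beta * q) +
    (beta ^+ 2 * n%:R * n%:R) / (beta * q)) / 2.
  by rewrite -qE; field; rewrite !lt0r_neq0.
by rewrite ler_pM2r ?invr_gt0 // lerD2l ler_pM2r ?invr_gt0.
Qed.

Lemma energy_approx G : (0 < n)%N ->
  `|energy R (G :&: multipartite_edges m V)%SET - trnorm (wig p (inside [set: 'I_n]%SET) G)|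
   <= \sum_(0 <= k < r) trnorm (wig p (inside (V k)) G)
      + beta * (n%:R * Num.sqrt n%:R) + 2 * n%:R.
Proof.
move=> n0; rewrite energy_trnorm; set A := adjmx _ _.
have sA : A^T = A.
  by apply/matrixP => i j; rewrite !mxE eq_sym finset.setUC.
set W := wig p (inside [set: 'I_n]%SET) G; have sW : W^T = W := tr_wig p G (inside_sym _).
pose B := \sum_(0 <= k < r) wig p (inside (V k)) G.
pose C := wig p (same_part r) G.
pose J := \sum_(0 <= k < m) (ones (V k))^T *m ones (V k).
pose J1 := (ones [set: 'I_n]%SET)^T *m ones [set: 'I_n]%SET.
have sB k : (wig p (inside (V k)) G)^T = wig p (inside (V k)) G.
  exact: tr_wig (inside_sym _).
have sBB : B^T = B by rewrite /B linear_sum /=; apply: eq_bigr => k _.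
have sC : C^T = C := tr_wig p G (same_part_sym r).
have sJ1 : J1^T = J1 := sym1 _.
have sJ : J^T = J by rewrite /J linear_sum /=; apply: eq_bigr => k _; exact: sym1.
(* [B] collects the blocks of the first r parts, [C] those of the others, and the last term restores
   the mean p between different parts. *)
have AE : A = W - (B + C) + p *: (J1 - J).
  apply/matrixP => i j.
  have JE : J i j = (same_part 0 i j)%:R.
    rewrite same_partE /J summxE; apply: eq_bigr => k _; exact: onesE.
  have J1E : J1 i j = 1 by rewrite onesE !inE.
  have mE (X Y Z T U' : 'M[R]_n) : (X - (Y + Z) + p *: (T - U')) i j =
     X i j - (Y i j + Z i j) + p * (T i j - U' i j) by rewrite !mxE.
  rewrite mE JE J1E.
  have BE : B i j = \sum_(0 <= k < r) (if (i != j) && inside (V k) i j then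
      ([set i; j]%SET \in G)%:R - p else 0).
    by rewrite /B summxE; apply: eq_bigr => k _; rewrite mxE.
  have CE : C i j = (if i != j then ([set i; j]%SET \in G)%:R - p else 0) *
      (same_part r i j)%:R.
    by rewrite mxE; case: (i != j); case: (same_part r i j); rewrite ?mulr1 ?mulr0.
  have -> : B i j + C i j = (if i != j then ([set i; j]%SET \in G)%:R - p else 0) *
      (same_part 0 i j)%:R.
    rewrite CE BE [in RHS]same_partE (big_cat_nat (leq0n r) rm) /= -same_partE mulrDr.
    congr (_ + _); rewrite mulr_sumr; apply: eq_bigr => k _; rewrite /inside.
    by case: (i != j); case: (i \in V k); case: (j \in V k); rewrite /= ?mulr1 ?mulr0.
  rewrite !mxE /inside !finset.in_setT !finset.in_setI /=; have [->|ij] /= := eqVneq i j.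
    rewrite (_ : same_part 0 j j); first by rewrite /=; ring.
    by have [k km jk] := parts_cover j; apply/existsP; exists (Ordinal km); rewrite /= jk.
  rewrite mem_multipartite_edges //.
  by case: (_ \in G); case: (same_part 0 i j) => /=; ring.
(* [J1] has rank one and trace n, and the rank-one summands of [J] have traces |V_k|, which also add
   up to n. *)
have JB : trnorm (p *: (J1 - J)) <= 2 * n%:R.
  apply: le_trans (trnormZ _ _) _; first by rewrite linearB /= sJ1 sJ.
  apply: (@le_trans _ _ (trnorm (J1 - J))).
    by case/andP: p01 => p0 p1; rewrite ler_piMl ?trnorm_ge0 // gtr0_norm // ltW.
  apply: le_trans (trnormB sJ1 sJ) _; rewrite mulr2n mulrDl mul1r; apply: lerD.
    by apply: le_trans (trnorm_rank1 _) _; rewrite sqn_ones cardsT card_ord.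
  apply: (@le_trans _ _ (\sum_(0 <= k < m) trnorm ((ones (V k))^T *m ones (V k)))).
    by apply: trnorm_sum => k _; exact: sym1.
  rewrite -card_parts; apply: ler_sum => k _.
  by apply: le_trans (trnorm_rank1 _) _; rewrite sqn_ones.
have BC : trnorm (B + C) <= \sum_(0 <= k < r) trnorm (wig p (inside (V k)) G)
      + beta * (n%:R * Num.sqrt n%:R).
  apply: le_trans (trnormD sBB sC) _; apply: lerD; last exact: trnorm_small_parts.
  exact: trnorm_sum.
have sBC : (B + C)^T = B + C by rewrite linearD /= sBB sC.
have sJJ : (p *: (J1 - J))^T = p *: (J1 - J).
  by rewrite linearZ /= linearB /= sJ1 sJ.
have sX : (p *: (J1 - J) - (B + C))^T = p *: (J1 - J) - (B + C).
  by rewrite linearB /= sJJ sBC.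
have X : trnorm (p *: (J1 - J) - (B + C)) <=
    \sum_(0 <= k < r) trnorm (wig p (inside (V k)) G)
      + beta * (n%:R * Num.sqrt n%:R) + 2 * n%:R.
  by apply: le_trans (trnormB sJJ sBC) _; rewrite addrC lerD.
have AW : A - W = p *: (J1 - J) - (B + C).
  by rewrite AE; move: (p *: _) (B + C) => Y Z; apply/matrixP => i j; rewrite !mxE; ring.
rewrite ler_norml; apply/andP; split; last first.
  by apply: le_trans X; rewrite -AW; exact: ler_trnormB.
have sAW : (A - W)^T = A - W by rewrite linearB /= sA sW.
rewrite lerNl opprB; apply: le_trans X; rewrite -AW -(trnormN sAW).
by rewrite opprB; exact: ler_trnormB.
Qed.

End Decomposition.

(** * Concentration of the trace norm, uniformly in the block *)

Section Concentration.
Variables (R : realType) (p : R).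
Hypothesis p01 : 0 < p < 1.
Let s : R := Num.sqrt (p * (1 - p)).

(** Half of [eps] covers the bias of the expectation, half the fluctuation in Chebyshev's
    inequality. With failure probability O(1 / n) for every U, a union over r + 1 blocks is
    harmless. *)
Lemma trnorm_concentration (eps : R) : 0 < eps ->
  (\forall n \near \oo, forall U : {set 'I_n},
    bprob p (fun G => ~ `|trnorm (wig p (inside U) G)
        - 8 / (3 * pi) * s * (#|U|%:R * Num.sqrt #|U|%:R)|
        <= eps * (n%:R * Num.sqrt n%:R))
    <= 16 / eps ^+ 2 / n%:R)%classic.
Proof.
move=> e0; have p01' : 0 <= p <= 1 by case/andP: p01 => *; rewrite !ltW.
have e20 : 0 < eps / 2 by rewrite divr_gt0.
near=> n.
have HU : forall U : {set 'I_n},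
    `|bexp p (fun G => trnorm (wig p (inside U) G))
      - 8 / (3 * pi) * s * (#|U|%:R * Num.sqrt #|U|%:R)|
    <= eps / 2 * (n%:R * Num.sqrt n%:R).
  by near: n; exact: expected_trnorm.
move=> U.
have n0 : (0 < n)%N by near: n; exact: nbhs_infty_gt.
have nR0 : 0 < n%:R :> R by rewrite ltr0n.
set q := Num.sqrt n%:R; have q0 : 0 < q by rewrite sqrtr_gt0.
have qE : q ^+ 2 = n%:R by rewrite sqr_sqrtr.
pose f (G : {set {set 'I_n}}) := trnorm (wig p (inside U) G).
set L := 8 / _ * _ * _.
have Ef : `|bexp p f - L| <= eps / 2 * (n%:R * q).
  exact: HU.
have a0 : 0 < eps / 2 * (n%:R * q) by rewrite !mulr_gt0.
apply: (@le_trans _ _ (bprob p (fun G => eps / 2 * (n%:R * q) <= `|f G - bexp p f|))).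
  apply: ler_bprob => // G /negP; rewrite -ltNge => H.
  have := ler_distD (bexp p f) (f G) L; rewrite -/(f G) in H; lra.
apply: le_trans (chebyshev_bexp p01' _ a0) _.
apply: (@le_trans _ _ (4 * n%:R ^+ 2 / (eps / 2 * (n%:R * q)) ^+ 2)); last first.
  rewrite le_eqVlt; apply/orP; left; apply/eqP; rewrite -qE; field.
  by rewrite !lt0r_neq0.
rewrite ler_pM2r ?invr_gt0 ?exprn_gt0 //.
apply: le_trans (bvar_trnorm_wig p01' (inside_sym U)) _.
apply: ler_piMl; first by apply: mulr_ge0 => //; exact: sqr_ge0.
by case/andP: p01 => ? ?; nra.
Unshelve. all: by end_near.
Qed.

End Concentration.

(** * The block between a set and its complement *)

Section CutBlock.
Variables (R : realType) (n : nat) (p : R) (U : {set 'I_n}).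
Hypotheses (p01 : 0 < p < 1) (U0 : (0 < #|U|)%N).
Implicit Types (G : {set {set 'I_n}}).

Definition cross : rel 'I_n := fun i j => (i \in U) != (j \in U).

Lemma cross_sym : symmetric cross.
Proof. by move=> i j; rewrite /cross eq_sym. Qed.

Let p01' : 0 <= p <= 1. Proof. by case/andP: p01 => *; rewrite !ltW. Qed.
Let s : R := Num.sqrt (p * (1 - p)).
Let pq_gt0 : 0 < p * (1 - p).
Proof. by case/andP: p01 => *; rewrite mulr_gt0 // subr_gt0. Qed.
Let s_gt0 : 0 < s. Proof. by rewrite sqrtr_gt0. Qed.
Let sE : s ^+ 2 = p * (1 - p). Proof. by rewrite sqr_sqrtr // ltW. Qed.
Let C G : 'M[R]_n := wig p cross G.
Let sC G : (C G)^T = C G := tr_wig p G cross_sym.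
Let uR0 : 0 < #|U|%:R :> R. Proof. by rewrite ltr0n. Qed.

Let CE G i j : i \in U -> j \notin U -> C G i j = ([set i; j]%SET \in G)%:R - p.
Proof.
move=> iU jU; rewrite mxE /cross iU (negPf jU) andbT.
by case: eqP => // ij; move: jU; rewrite -ij iU.
Qed.

Let C0 G i j : (i \in U) = (j \in U) -> C G i j = 0.
Proof. by move=> ij; rewrite mxE /cross ij eqxx andbF. Qed.

Let u : 'rV[R]_n := \row_i ((i \in U)%:R / Num.sqrt #|U|%:R).

Let uu : u *m u^T = 1%:M.
Proof.
apply/rowP => i; rewrite !mxE ord1 eqxx mulr1n.
under eq_bigr do rewrite !mxE mulrACA -invfM -(expr2 (Num.sqrt _)) sqr_sqrtr ?(ltW uR0) //.
rewrite -mulr_suml -[X in _ = X](divff (lt0r_neq0 uR0)); congr (_ / _).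
rewrite -sum1_card natr_sum [RHS]big_mkcond /=; apply: eq_bigr => j _.
by case: (j \in U); rewrite ?mulr1 ?mulr0.
Qed.

Let P : 'M[R]_n := 1%:M - u^T *m u.
Let PT : P^T = P. Proof. by rewrite /P linearB /= trmx1 trmx_mul trmxK. Qed.
Let uP : u *m P = 0.
Proof. by rewrite /P mulmxBr mulmx1 mulmxA uu mul1mx subrr. Qed.

Let P_le (x : 'rV[R]_n) : sqn (x *m P) <= sqn x.
Proof.
have PP : P *m P = P by rewrite {1}/P mulmxBl mul1mx -mulmxA uP mulmx0 subr0.
rewrite !sqnE trmx_mul PT mulmxA -(mulmxA x) PP /P mulmxBr mulmx1 mulmxBl.
have -> : x *m (u^T *m u) *m x^T = (x *m u^T) *m (x *m u^T)^T.
  by rewrite trmx_mul trmxK !mulmxA.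
have subE (X Y : 'M[R]_1) : (X - Y) 0 0 = X 0 0 - Y 0 0 by rewrite !mxE.
by rewrite subE gerBl -sqnE sqn_ge0.
Qed.

Let D : 'M[R]_n := diag_mx (\row_i (if i \in U then 1 else -1)).
Let DT : D^T = D. Proof. exact: tr_diag_mx. Qed.
Let D_le (x : 'rV[R]_n) : sqn (x *m D) <= sqn x.
Proof.
rewrite /sqn; apply: ler_sum => i _; rewrite mul_mx_diag !mxE.
by case: ifP => _; rewrite ?mulr1 // mulrN1 sqrrN.
Qed.

(* Conjugation by the signs D removes the two diagonal blocks; the projection P
   orthogonal to the indicator u of U removes the mean p of the remaining ones and
   leaves C up to a matrix of rank two. *)
Lemma trnorm_cut_le G (A : 'M[R]_n) (mu : R) : A^T = A -> 0 < mu ->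
    (forall i j, cross i j -> A i j = C G i j + p) ->
  trnorm (C G) - (mu ^+ 2 + sqn (u *m C G) / mu ^+ 2) <= trnorm A.
Proof.
move=> sA mu0 AC; have mun : mu != 0 by exact: lt0r_neq0.
pose A' := 2^-1 *: (A - D^T *m A *m D).
have sDAD : (D^T *m A *m D)^T = D^T *m A *m D by rewrite !trmx_mul trmxK sA mulmxA.
have A'A : trnorm A' <= trnorm A.
  apply: le_trans (trnormZ _ _) _; first by rewrite linearB /= sA sDAD.
  have := trnormB sA sDAD; have := trnorm_conj sA D_le.
  by rewrite ger0_norm ?invr_ge0 // mulrC ler_pdivrMr //; lra.
pose a : 'rV[R]_n := \row_i (i \in U)%:R; pose b : 'rV[R]_n := \row_i (i \notin U)%:R.
have A'E : A' = C G + p *: (a^T *m b + b^T *m a).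
  apply/matrixP => i j.
  have DAD : (D^T *m A *m D) i j = (if i \in U then 1 else -1) * A i j *
      (if j \in U then 1 else -1).
    by rewrite DT mul_mx_diag mxE mul_diag_mx !mxE.
  have -> : A' i j = 2^-1 * (A i j - (D^T *m A *m D) i j).
    by rewrite /A'; move: (D^T *m A *m D) => X; rewrite !mxE.
  have -> : (C G + p *: (a^T *m b + b^T *m a)) i j = C G i j +
     p * ((i \in U)%:R * (j \notin U)%:R + (i \notin U)%:R * (j \in U)%:R).
    by move: (C G) => X; rewrite !mxE !big_ord1 !mxE.
  rewrite DAD; have := AC i j; rewrite /cross.
  have := @C0 G i j; case: (i \in U); case: (j \in U) => /= H1 H2.
  - by rewrite H1 //; ring.
  - by rewrite H2 //; field.
  - by rewrite H2 //; field.
  - by rewrite H1 //; ring.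
have sA' : A'^T = A' by rewrite /A' linearZ /= linearB /= sDAD sA.
apply: le_trans A'A; apply: le_trans (trnorm_conj sA' P_le).
pose w := u *m C G.
have aP : a *m P = 0.
  have -> : a = Num.sqrt #|U|%:R *: u.
    by apply/rowP => i; rewrite !mxE mulrCA divff ?mulr1 // lt0r_neq0 // sqrtr_gt0.
  by rewrite -scalemxAl uP scaler0.
have Pa : P *m a^T = 0 by rewrite -[LHS]trmxK trmx_mul trmxK PT aP trmx0.
have CuT : C G *m u^T = w^T by rewrite /w trmx_mul sC.
have uCu : u *m C G *m u^T = 0.
  apply/rowP => i; rewrite ord1 !mxE big1 // => j _; rewrite !mxE.
  have [jU|jU] := boolP (j \in U); last by rewrite mul0r mulr0.
  rewrite big1 ?mul0r // => k _; rewrite [u 0 k]mxE.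
  by have [kU|kU] := boolP (k \in U); [rewrite C0 ?mulr0 // kU jU|rewrite !mul0r].
have PA'P : P^T *m A' *m P = C G - (u^T *m w + w^T *m u).
  have PMP : P *m (a^T *m b + b^T *m a) *m P = 0.
    have -> (Q : 'M[R]_n) : Q *m (a^T *m b + b^T *m a) *m Q =
        Q *m a^T *m (b *m Q) + Q *m b^T *m (a *m Q).
      by rewrite mulmxDr mulmxDl !mulmxA.
    by rewrite Pa aP mul0mx mulmx0 addr0.
  have -> : P^T *m A' *m P = P *m C G *m P + p *: (P *m (a^T *m b + b^T *m a) *m P).
    rewrite PT A'E; move: (C G) (a^T *m b + b^T *m a) => X Y.
    have -> // (Q : 'M[R]_n) : Q *m (X + p *: Y) *m Q = Q *m X *m Q + p *: (Q *m Y *m Q).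
    by rewrite mulmxDr mulmxDl -scalemxAr -scalemxAl.
  rewrite PMP scaler0 addr0.
  rewrite /P mulmxBl mul1mx mulmxBr mulmx1 mulmxBl !mulmxA CuT.
  rewrite -(mulmxA u^T) -/w -(mulmxA u^T w) -/w.
  have -> : w *m u^T = 0 by exact: uCu.
  by rewrite mulmx0 mul0mx subr0 opprD addrA addrAC.
have sR : (u^T *m w + w^T *m u)^T = u^T *m w + w^T *m u.
  by rewrite linearD /= !trmx_mul !trmxK addrC.
rewrite PA'P; apply: le_trans (ler_trnormB (sC G) sR); apply: lerB => //.
have -> : u^T *m w + w^T *m u = (mu *: u)^T *m (mu^-1 *: w) + (mu^-1 *: w)^T *m (mu *: u).
  rewrite !linearZ /= -!scalemxAl !scalerA.
  by rewrite divff // mulVf // !scale1r.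
apply: le_trans (trnorm_rank2 _ _) _; rewrite !sqnZ.
by rewrite [sqn u]sqnE uu mxE eqxx mulr1 exprVn mulrC.
Qed.

Let T G a b := (C G *m C G) a b.
Let k : R := #|~: U|%:R.
Let q : R := #|U|%:R * s ^+ 2.
Let q_gt0 : 0 < q. Proof. by rewrite mulr_gt0 // exprn_gt0. Qed.

Let TE G a b : a \notin U -> b \notin U ->
  T G a b = \sum_(i in U) (([set i; a]%SET \in G)%:R - p) * (([set i; b]%SET \in G)%:R - p).
Proof.
move=> aU bU; rewrite /T mxE [RHS]big_mkcond /=; apply: eq_bigr => i _.
have [iU|iU] := boolP (i \in U); last by rewrite C0 ?mul0r // (negPf iU) (negPf aU).
by rewrite -{1}sC mxE !CE.
Qed.

Let T0 G a b : a \notin U -> b \in U -> T G a b = 0.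
Proof.
move=> aU bU; rewrite /T mxE big1 // => i _.
have [iU|iU] := boolP (i \in U).
  by rewrite [X in _ * X]C0 ?mulr0 // iU bU.
by rewrite C0 ?mul0r // (negPf iU) (negPf aU).
Qed.

Let Ts G a b : T G a b = T G b a.
Proof.
have sCC : (C G *m C G)^T = C G *m C G by rewrite trmx_mul sC.
by rewrite /T -{1}sCC mxE.
Qed.

(** With zero diagonal blocks, C = Pi C + C Pi for the projection Pi to the complement of [U], and
    cyclicity gives both terms the same trace. Moments of C thus reduce to the Gram matrix on the
    complement. *)
Let cut_trace G (X : 'M[R]_n) : X *m C G = C G *m X ->
  \tr (C G *m X) = 2 * \sum_(a in ~: U) (C G *m X) a a.
Proof.
move=> XC; pose Pi : 'M[R]_n := diag_mx (\row_i (i \notin U)%:R).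
have CPi : C G = Pi *m C G + C G *m Pi.
  apply/matrixP => i j.
  have -> : (Pi *m C G + C G *m Pi) i j =
      (i \notin U)%:R * C G i j + C G i j * (j \notin U)%:R.
    by rewrite /Pi mul_diag_mx mul_mx_diag; move: (C G) => Y; rewrite !mxE.
  have := @C0 G i j; case: (i \in U); case: (j \in U) => /= H.
  - by rewrite H //; ring.
  - by ring.
  - by ring.
  - by rewrite H //; ring.
have -> : \sum_(a in ~: U) (C G *m X) a a = \tr (Pi *m (C G *m X)).
  rewrite /mxtrace [LHS]big_mkcond /=; apply: eq_bigr => a _.
  move: (C G *m X) => Y; rewrite mul_diag_mx !mxE finset.in_setC.
  by case: (a \in U); rewrite /= ?mul0r ?mul1r.
rewrite {1}CPi mulmxDl mxtraceD -!mulmxA [X in _ + X]mxtrace_mulC -mulmxA XC.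
by ring.
Qed.

(** The Gram matrix has expectation q times the identity; this squared Frobenius distance controls
    the second and fourth moments together. *)
Let gram_dev G : R := \sum_(a in ~: U) \sum_(b in ~: U) (T G a b - (a == b)%:R * q) ^+ 2.

(** The cubic bound is taken at th = sqrt q, the typical singular value. For tau the trace of the
    Gram matrix it gives (tau + k q - gram_dev / q) / th, and tau >= 3/4 k q - gram_dev / q; hence
    7/4. *)
Lemma trnorm_cut_ge G :
  (7 / 4 * k * q - 2 * (gram_dev G / q)) / (s * Num.sqrt #|U|%:R) <= trnorm (C G).
Proof.
set th := s * Num.sqrt #|U|%:R.
have th0 : 0 < th by rewrite mulr_gt0 // sqrtr_gt0.
have thE : th ^+ 2 = q by rewrite /th exprMn (sqr_sqrtr (ltW uR0)) mulrC.
have qn : q != 0 by exact: lt0r_neq0.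
pose tau := \sum_(a in ~: U) T G a a.
pose T2 := \sum_(a in ~: U) \sum_(b in ~: U) T G a b ^+ 2.
have tr2 : \tr (C G *m C G) = 2 * tau by exact: cut_trace.
have tr4 : \tr (C G *m C G *m (C G *m C G)) = 2 * T2.
  rewrite -mulmxA cut_trace ?mulmxA //; congr (_ * _); apply: eq_bigr => a.
  rewrite finset.in_setC => aU.
  rewrite -mulmxA mxE (bigID (fun b => b \in ~: U)) /= addrC big1 ?add0r.
    by apply: eq_bigr => b _; rewrite -/(T G a b) -/(T G b a) Ts -expr2.
  by move=> b; rewrite finset.in_setC negbK => bU; rewrite -/(T G a b) T0 // mul0r.
have yE : gram_dev G = T2 - 2 * q * tau + k * q ^+ 2.
  have -> : gram_dev G = \sum_(a in ~: U) (\sum_(b in ~: U) T G a b ^+ 2 +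
      (- (2 * q) * T G a a + q ^+ 2)).
    apply: eq_bigr => a aU.
    have -> : \sum_(b in ~: U) (T G a b - (a == b)%:R * q) ^+ 2 =
      \sum_(b in ~: U) (T G a b ^+ 2 +
         (a == b)%:R * (- (2 * q) * T G a b + q ^+ 2)).
      apply: eq_bigr => b _; move: (T G a b) q (a == b) => t q' [] /=; ring.
    rewrite big_split /=; congr (_ + _); rewrite (bigD1 a) //= eqxx mul1r big1 ?addr0 //.
    by move=> b /andP[_]; rewrite eq_sym => /negPf ->; rewrite mul0r.
  rewrite !big_split /= sumr_const -mulr_sumr -/tau -/T2 -[X in _ + (_ + X)]mulr_natl -/k.
  by ring.
(* Each diagonal entry t satisfies t >= 3/4 q - (t - q)^2 / q, by the square of t - q / 2. A linear
   deviation is traded for a quadratic one. *)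
have tauE : 3 / 4 * k * q - gram_dev G / q <= tau.
  have -> : 3 / 4 * k * q = \sum_(a in ~: U) (3 / 4 * q).
    by rewrite sumr_const -[RHS]mulr_natl -/k; ring.
  rewrite lerBlDl; apply: (@le_trans _ _ (\sum_(a in ~: U) ((T G a a - q) ^+ 2 / q + T G a a))).
    apply: ler_sum => a _; rewrite -(ler_pM2r q_gt0).
    move: (T G a a) (q : R) qn => t q' qn'.
    have -> : ((t - q') ^+ 2 / q' + t) * q' = (t - q') ^+ 2 + t * q' by field.
    have := sqr_ge0 (t - q' + q' / 2); lra.
  rewrite big_split /= lerD2r -mulr_suml ler_pM2r ?invr_gt0 //.
  apply: ler_sum => a aU; rewrite (bigD1 a) //= eqxx mul1r lerDl.
  by apply: sumr_ge0 => b _; exact: sqr_ge0.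
apply: le_trans (trnorm_ge_moments (sC G) th0); rewrite tr2 tr4.
have -> : 3 / (2 * th) * (2 * tau) - 2 * T2 / (2 * th ^+ 3) =
   (3 * tau - T2 / th ^+ 2) / th by field; exact: lt0r_neq0.
rewrite thE ler_pM2r ?invr_gt0 //.
have -> : T2 = gram_dev G + 2 * q * tau - k * q ^+ 2 by rewrite yE; ring.
have -> : (gram_dev G + 2 * q * tau - k * q ^+ 2) / q = gram_dev G / q + 2 * tau - k * q by field.
lra.
Qed.

Let xi (e : {set 'I_n}) G : R := (e \in G)%:R - p.

Let bdiff_xi e e' G : bdiff e (xi e') G = (e' == e)%:R.
Proof.
by rewrite /bdiff /xi !inE; case: eqP => _ /=; ring.
Qed.

Let bdiff_xi2 e e1 e2 G : `|bdiff e (fun G => xi e1 G * xi e2 G) G| <=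
  ((e1 == e) || (e2 == e))%:R.
Proof.
rewrite /bdiff /xi !inE; case/andP: p01 => ? ?; rewrite ler_norml.
by case: (e1 == e); case: (e2 == e); case: (e1 \in G); case: (e2 \in G) => /=;
  apply/andP; split; nra.
Qed.

Let sum_le1 (F : 'I_n -> R) : (forall i, `|F i| <= 1) ->
    (forall i j, i \in U -> j \in U -> F i != 0 -> F j != 0 -> i = j) ->
  `|\sum_(i in U) F i| <= 1.
Proof.
move=> F1 FU; have [/existsP[i /andP[iU Fi]]|/existsPn H] :=
  boolP [exists i, (i \in U) && (F i != 0)].
  rewrite (bigD1 i) //= big1 ?addr0 // => j /andP[jU ji].
  by apply/eqP; apply: contraR ji => Fj; apply/eqP; exact: FU.
rewrite big1 ?normr0 // => i iU; have := H i; rewrite iU /= negbK.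
by move/eqP.
Qed.

(** The edge [e] determines its end in [U], so toggling it affects at most one term of a sum over
    [U]. This keeps the variances below linear in n. *)
Let star_inj e a b i j : a \notin U -> b \notin U -> i \in U -> j \in U ->
  ([set i; a]%SET == e) || ([set i; b]%SET == e) ->
  ([set j; a]%SET == e) || ([set j; b]%SET == e) -> i = j.
Proof.
move=> aU bU iU jU Hi Hj.
have ie : i \in e by case/orP: Hi => /eqP <-; rewrite !inE eqxx.
have : (i == j) || (i == a) || (i == b).
  by case/orP: Hj ie => /eqP <-; rewrite !inE => /orP[] ->; rewrite ?orbT.
case/orP => [/orP[]|] /eqP // ii; [move: aU|move: bU]; by rewrite -ii iU.
Qed.

Let bdiff_sum e (F : 'I_n -> {set {set 'I_n}} -> R) G :
  bdiff e (fun G => \sum_(i in U) F i G) G = \sum_(i in U) bdiff e (F i) G.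
Proof. by rewrite /bdiff -sumrB. Qed.

Let bvar_T a b : a \notin U -> b \notin U ->
  bvar p (fun G => T G a b) <= p * (1 - p) * (2 * n%:R).
Proof.
move=> aU bU.
have -> : 2 * n%:R = #|{: bool * 'I_n}|%:R * 1 ^+ 2 :> R.
  by rewrite card_prod card_bool card_ord natrM expr1n mulr1.
pose h (xi : bool * 'I_n) := [set xi.2; (if xi.1 then a else b)]%SET.
pose F i G := xi [set i; a]%SET G * xi [set i; b]%SET G.
have TF : (fun G => T G a b) = (fun G => \sum_(i in U) F i G).
  by apply/funext => G; rewrite TE.
rewrite TF; apply: (@efron_stein_card _ _ _ p h) => // [e He G|[x i] G].
  rewrite bdiff_sum big1 // => i _; apply/eqP; rewrite -normr_eq0 eq_le normr_ge0 andbT.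
  apply: le_trans (bdiff_xi2 _ _ _ _) _.
  have := He (true, i); have := He (false, i); rewrite /h /= !(eq_sym e).
  by move=> /negPf -> /negPf ->.
rewrite bdiff_sum; apply: sum_le1 => [j|j l jU lU].
  by apply: le_trans (bdiff_xi2 _ _ _ _) _; rewrite lern1 leq_b1.
have nz j' : bdiff (h (x, i)) (F j') G != 0 ->
    ([set j'; a]%SET == h (x, i)) || ([set j'; b]%SET == h (x, i)).
  move=> Fn; have := bdiff_xi2 (h (x, i)) [set j'; a]%SET [set j'; b]%SET G.
  by case: (_ || _) => //; rewrite normr_le0 (negPf Fn).
by move=> /nz Hj /nz Hl; exact: star_inj Hj Hl.
Qed.

(** Stein's formula on the first factor: the derivative of the second is 1 if both are the same edge
    and 0 otherwise. *)
Let bexp_T a b : a \notin U -> b \notin U ->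
  bexp p (fun G => T G a b) = (a == b)%:R * q.
Proof.
move=> aU bU; rewrite (eq_bexp p (fun G => TE G aU bU)) bexp_sum.
have -> : (a == b)%:R * q = \sum_(i in U) p * (1 - p) * (a == b)%:R.
  by rewrite sumr_const -[RHS]mulr_natl /q sE; ring.
apply: eq_bigr => i iU; rewrite bexp_stein; congr (_ * _).
rewrite (eq_bexp p (g := fun=> (a == b)%:R)) ?bexp_cst // => G.
rewrite (bdiff_xi [set i; a]%SET [set i; b]%SET G) eq_pair_set; last first.
  by apply: contra aU => /eqP <-.
rewrite eqxx /= (eq_sym b); case: (a == b) => //=.
by case: eqP => // ia; move: aU; rewrite -ia iU.
Qed.

Lemma bexp_gram_dev_le : bexp p gram_dev <= k ^+ 2 * (p * (1 - p) * (2 * n%:R)).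
Proof.
rewrite bexp_sum.
apply: (@le_trans _ _ (\sum_(a in ~: U) \sum_(b in ~: U) (p * (1 - p) * (2 * n%:R)))).
  apply: ler_sum => a; rewrite finset.in_setC => aU; rewrite bexp_sum.
  apply: ler_sum => b; rewrite finset.in_setC => bU.
  by rewrite -bexp_T //; exact: bvar_T.
by rewrite !sumr_const -mulrnA mulnn -[leLHS]mulr_natl natrX.
Qed.

Lemma bexp_proj_le : bexp p (fun G => sqn (u *m C G)) <=
  k * (p * (1 - p) * n%:R) / #|U|%:R.
Proof.
pose S j G := \sum_(i in U) xi [set i; j]%SET G.
have -> : bexp p (fun G => sqn (u *m C G)) =
    \sum_(j in ~: U) bexp p (fun G => S j G ^+ 2) / #|U|%:R.
  have := bexp_sum p (index_enum _) (mem (~: U)) (fun j G => S j G ^+ 2 / #|U|%:R).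
  move=> E; transitivity (bexp p (fun G => \sum_(j in ~: U) S j G ^+ 2 / #|U|%:R)).
    apply: eq_bexp => G; rewrite /sqn [RHS]big_mkcond /=; apply: eq_bigr => j _.
    rewrite mxE finset.in_setC; have [jU|jU] /= := boolP (j \in U).
      rewrite big1 ?expr0n // => i _; rewrite [u _ _]mxE.
      by have [iU|iU] := boolP (i \in U); [rewrite C0 ?mulr0 // iU jU|rewrite !mul0r].
    have -> : \sum_i u 0 i * C G i j = S j G / Num.sqrt #|U|%:R.
      rewrite /S mulr_suml [RHS]big_mkcond /=; apply: eq_bigr => i _; rewrite [u _ _]mxE.
      have [iU|iU] := boolP (i \in U); last by rewrite !mul0r.
      by rewrite CE // mul1r mulrC.
    by rewrite exprMn exprVn sqr_sqrtr // ltW.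
  rewrite E; apply: eq_bigr => j _; rewrite mulrC -bexpZ.
  by apply: eq_bexp => G; rewrite mulrC.
rewrite -mulr_suml ler_pM2r ?invr_gt0 //.
rewrite /k mulr_natl -sumr_const; apply: ler_sum => j; rewrite finset.in_setC => jU.
have S0 : bexp p (S j) = 0.
  rewrite bexp_sum big1 // => i _.
  rewrite (eq_bexp p (g := fun G => xi [set i; j]%SET G * 1)).
    rewrite bexp_stein (eq_bexp p (g := fun=> 0)) ?bexp_cst ?mulr0 // => G.
    by rewrite /bdiff subrr.
  by move=> G; rewrite mulr1.
have -> : bexp p (fun G => S j G ^+ 2) = bvar p (S j).
  by rewrite bvarE S0 expr0n subr0.
have -> : n%:R = #|{: 'I_n}|%:R * 1 ^+ 2 :> R by rewrite card_ord expr1n mulr1.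
apply: (@efron_stein_card _ _ _ p (fun i => [set i; j]%SET)) => // [e He G|i G].
  rewrite bdiff_sum big1 // => i _.
  by rewrite bdiff_xi eq_sym (negPf (He i)).
rewrite bdiff_sum; apply: sum_le1 => [l|l l' lU l'U].
  by rewrite bdiff_xi ger0_norm // lern1 leq_b1.
rewrite !bdiff_xi !pnatr_eq0 !eqb0 !negbK => H H'.
by apply: (@star_inj [set i; j]%SET j j) => //; rewrite ?H ?H'.
Qed.

(** The constant is 13/8 * 9/10 - 1/10, rounded down. The threshold on [gram_dev] lowers 7/4 to
    13/8, the size of [U] gives sqrt |U| >= 9/10 sqrt n, and the two terms of the rank-two
    correction cost 1/20 each. *)
Lemma trnorm_cut_prob (A : {set {set 'I_n}} -> 'M[R]_n) :
    (forall G, (A G)^T = A G) ->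
    (forall G i j, cross i j -> A G i j = C G i j + p) ->
    81 / 100 * n%:R <= #|U|%:R :> R ->
  bprob p (fun G => ~ 27 / 20 * s * k * Num.sqrt n%:R <= trnorm (A G)) <=
    64 / s ^+ 2 * (k / n%:R) + 500 / n%:R.
Proof.
move=> sA AC Un; set r := Num.sqrt n%:R.
have n0 : 0 < n%:R :> R.
  by apply: lt_le_trans uR0 _; rewrite ler_nat -[leqRHS]card_ord max_card.
have r0 : 0 < r by rewrite sqrtr_gt0.
have rE : r ^+ 2 = n%:R by rewrite sqr_sqrtr // ltW.
have s2 : 0 < s ^+ 2 by rewrite exprn_gt0.
have k0 : 0 <= k by [].
(* The complement may be empty. Otherwise k >= 1, which absorbs the correction mu^2 = s r / 20 that
   carries no factor k. *)
have [kz|kn0] := eqVneq k 0.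
  apply: (@le_trans _ _ 0); last first.
    have H500 : 0 <= 500 / n%:R :> R by apply: divr_ge0; exact: ler0n.
    by rewrite kz mul0r mulr0 add0r.
  rewrite -(@bexp_cst R {set 'I_n} p 0); apply: ler_bexp => // G.
  rewrite asboolF // => H; apply: H; rewrite kz mulr0 mul0r; exact: trnorm_ge0.
have k1 : 1 <= k by rewrite /k ler1n lt0n; move: kn0; rewrite /k pnatr_eq0.
have kp : 0 < k by lra.
have gram_ge0 G : 0 <= gram_dev G.
  by apply: sumr_ge0 => a _; apply: sumr_ge0 => b _; exact: sqr_ge0.
have a1 : 0 < k * q ^+ 2 / 16 by rewrite divr_gt0 // mulr_gt0 // exprn_gt0.
have a2 : 0 < s ^+ 2 / 400 * k * n%:R.
  apply: mulr_gt0; last exact: n0.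
  apply: mulr_gt0; last exact: kp.
  by apply: divr_gt0; [exact: s2|rewrite ltr0n].
have M1 := markov_bexp p01' gram_ge0 a1.
have M2 := markov_bexp p01' (fun G => sqn_ge0 (u *m C G)) a2.
have H1 : bexp p gram_dev / (k * q ^+ 2 / 16) <= 64 / s ^+ 2 * (k / n%:R).
  rewrite ler_pdivrMr //; apply: le_trans bexp_gram_dev_le _; rewrite -sE.
  have -> : 64 / s ^+ 2 * (k / n%:R) * (k * q ^+ 2 / 16) =
      k ^+ 2 * s ^+ 2 * (4 * #|U|%:R ^+ 2 / n%:R).
    by rewrite /q; field; rewrite !lt0r_neq0.
  rewrite [leLHS]mulrA; apply: ler_wpM2l.
    by rewrite mulr_ge0 // sqr_ge0.
  rewrite ler_pdivlMr //.
  have : (81 / 100 * n%:R) ^+ 2 <= #|U|%:R ^+ 2 :> R.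
    by rewrite ler_sqr ?nnegrE // mulr_ge0.
  rewrite exprMn; have := sqr_ge0 (n%:R : R); rewrite expr2; lra.
have H2 : bexp p (fun G => sqn (u *m C G)) / (s ^+ 2 / 400 * k * n%:R) <= 500 / n%:R.
  rewrite ler_pdivrMr //; apply: le_trans bexp_proj_le _; rewrite -sE.
  rewrite ler_pdivrMr //.
  have -> : 500 / n%:R * (s ^+ 2 / 400 * k * n%:R) * #|U|%:R =
     k * s ^+ 2 * (5 / 4 * #|U|%:R) by field; rewrite lt0r_neq0.
  rewrite mulrA; apply: ler_wpM2l; first by rewrite mulr_ge0 // ltW.
  lra.
apply: le_trans (lerD (le_trans M1 H1) (le_trans M2 H2)).
apply: le_trans (bprobU p01' _ _); apply: ler_bprob => // G H.
apply/orP; rewrite -[_ || _]negbK negb_or -!ltNge; apply/negP => /andP[yG wG].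
apply: H; pose mu := Num.sqrt (s / 20 * r).
have mu0 : 0 < mu by rewrite sqrtr_gt0 !mulr_gt0.
have muE : mu ^+ 2 = s / 20 * r by rewrite sqr_sqrtr // ltW // !mulr_gt0.
apply: le_trans (trnorm_cut_le (sA G) mu0 (AC G)); rewrite muE.
have W1 : sqn (u *m C G) / (s / 20 * r) <= s / 20 * k * r.
  rewrite ler_pdivrMr; last by rewrite !mulr_gt0.
  by apply: le_trans (ltW wG) _; rewrite -rE; lra.
have B := trnorm_cut_ge G.
set v := Num.sqrt #|U|%:R in B; have v0 : 0 < v by rewrite sqrtr_gt0.
have vE : v ^+ 2 = #|U|%:R by rewrite sqr_sqrtr // ltW.
have B1 : 13 / 8 * k * (s * v) <= trnorm (C G).
  apply: le_trans B; rewrite ler_pdivlMr ?mulr_gt0 //.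
  have -> : 13 / 8 * k * (s * v) * (s * v) = 13 / 8 * k * q.
    by rewrite /q -vE; ring.
  have : gram_dev G / q <= k * q / 16.
    by rewrite ler_pdivrMr //; apply: le_trans (ltW yG) _; rewrite expr2; lra.
  lra.
have vr : 9 / 10 * r <= v.
  rewrite -ler_sqr ?nnegrE ?(ltW v0) ?mulr_ge0 ?(ltW r0) // vE exprMn rE; lra.
have B2 : 13 / 8 * k * (s * (9 / 10 * r)) <= 13 / 8 * k * (s * v).
  by rewrite ler_pM2l ?mulr_gt0 // ler_pM2l.
have ksr : s * r <= k * (s * r).
  by rewrite ler_peMl // ltW // mulr_gt0.
have sr0 : 0 < s * r by rewrite mulr_gt0.
lra.
Qed.

End CutBlock.

(** * Energy of the random multipartite graph *)

Section Assembly.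
Variable R : realType.

(** A lower Riemann sum with six steps for atan 1 = pi / 4. The value 80/27 is what 4 / pi <= 27/20
    amounts to. *)
Lemma pi_ge_80_27 : 80 / 27 <= pi :> R.
Proof.
have step (a b : R) : 0 <= a -> a < b ->
    (b - a) * (1 + b ^+ 2)^-1 <= atan b - atan a.
  by move=> a0 ab; have /andP[] := coulson_step ltr01 a0 ab;
    rewrite !divr1 !mul1r expr1n mul1r.
have s1 : (1 / 6 - 0) * (1 + (1 / 6) ^+ 2)^-1 <= atan (1 / 6) - atan 0 :> R.
  by apply: step; lra.
have s2 : (2 / 6 - 1 / 6) * (1 + (2 / 6) ^+ 2)^-1 <= atan (2 / 6) - atan (1 / 6) :> R.
  by apply: step; lra.
have s3 : (3 / 6 - 2 / 6) * (1 + (3 / 6) ^+ 2)^-1 <= atan (3 / 6) - atan (2 / 6) :> R.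
  by apply: step; lra.
have s4 : (4 / 6 - 3 / 6) * (1 + (4 / 6) ^+ 2)^-1 <= atan (4 / 6) - atan (3 / 6) :> R.
  by apply: step; lra.
have s5 : (5 / 6 - 4 / 6) * (1 + (5 / 6) ^+ 2)^-1 <= atan (5 / 6) - atan (4 / 6) :> R.
  by apply: step; lra.
have s6 : (1 - 5 / 6) * (1 + 1 ^+ 2)^-1 <= atan 1 - atan (5 / 6) :> R.
  by apply: step; lra.
rewrite atan0 in s1; rewrite atan1 in s6.
have e1 : (1 / 6 - 0) * (1 + (1 / 6) ^+ 2)^-1 = 6 / 37 :> R by field.
have e2 : (2 / 6 - 1 / 6) * (1 + (2 / 6) ^+ 2)^-1 = 6 / 40 :> R by field.
have e3 : (3 / 6 - 2 / 6) * (1 + (3 / 6) ^+ 2)^-1 = 6 / 45 :> R by field.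
have e4 : (4 / 6 - 3 / 6) * (1 + (4 / 6) ^+ 2)^-1 = 6 / 52 :> R by field.
have e5 : (5 / 6 - 4 / 6) * (1 + (5 / 6) ^+ 2)^-1 = 6 / 61 :> R by field.
have e6 : (1 - 5 / 6) * (1 + 1 ^+ 2)^-1 = 6 / 72 :> R by field.
rewrite e1 in s1; rewrite e2 in s2; rewrite e3 in s3.
rewrite e4 in s4; rewrite e5 in s5; rewrite e6 in s6.
lra.
Qed.

Lemma powR32 (x : R) : 0 <= x -> x `^ (3 / 2) = x * Num.sqrt x.
Proof.
move=> x0; have -> : 3 / 2 = 1 + 2^-1 :> R by field.
have [->|xn0] := eqVneq x 0; first by rewrite powR0 ?mul0r.
by rewrite powRD ?xn0 ?implybT // powRr1 // powR12_sqrt.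
Qed.

(* The same eta must serve both bounds; the least one allowed by the upper bound
   and by |eta| <= eps does. *)
Lemma eta_exists (c eps S X E : R) : 0 < eps -> eps < c -> 0 <= S -> 0 < X -> 0 <= E ->
    (1 - S) * (c - eps) * X <= E -> E <= (1 + S) * (c + eps) * X ->
  exists2 eta : R, `|eta| <= eps & (1 - S) * X <= E * (c + eta)^-1 <= (1 + S) * X.
Proof.
move=> e0 ec S0 X0 E0 lo up; have S1 : 0 < (1 + S) * X by rewrite mulr_gt0 // ltr_wpDr.
pose z := E / ((1 + S) * X) - c.
have zE : (c + z) * ((1 + S) * X) = E by rewrite /z addrC subrK divfK // lt0r_neq0.
have ze : z <= eps.
  by rewrite /z lerBlDl ler_pdivrMr //; apply: le_trans up _; rewrite -mulrA mulrCA.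
have [zl|zl] := leP z (- eps).
  have ce : 0 < c - eps by lra.
  exists (- eps); first by rewrite normrN gtr0_norm.
  rewrite ler_pdivlMr // ler_pdivrMr // -mulrA [X * _]mulrC mulrA lo /=.
  by rewrite -{1}zE mulrC ler_pM2l //; lra.
exists z; first by rewrite ler_norml ze ltW.
have cz : 0 < c + z by lra.
rewrite ler_pdivlMr // ler_pdivrMr // [(1 + S) * X * _]mulrC zE lexx andbT.
rewrite -{1}zE mulrC; apply: ler_wpM2l; first exact: ltW.
by apply: ler_wpM2r; [exact: ltW|lra].
Qed.

Lemma bprob_bigU (T : finType) (p : R) (r : nat) (Q : nat -> {set T} -> Prop) (a : R) :
    0 <= p <= 1 -> (forall k, bprob p (Q k) <= a) ->
  bprob p (fun G => exists2 k, (k < r)%N & Q k G) <= r%:R * a.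
Proof.
move=> p01 Qa; elim: r => [|r IH].
  rewrite mul0r -(@bexp_cst R T p 0); apply: ler_bexp => // G.
  by rewrite asboolF // => -[].
rewrite -natr1 mulrDl mul1r; apply: le_trans (lerD IH (Qa r)).
apply: le_trans (bprobU p01 _ _); apply: ler_bprob => // G [k].
rewrite ltnS leq_eqVlt => /orP[/eqP ->|kr] Qk; first by right.
by left; exists k.
Qed.

Variables (p : R) (m : nat -> nat) (V : forall n : nat, nat -> {set 'I_n}) (r : nat).
Hypothesis p01 : 0 < p < 1.
Hypothesis partsV : forall n : nat, (2 <= n)%N -> (2 <= m n)%N /\ is_parts (m n) (V n).
Hypothesis rm : (\forall n \near \oo, (r <= m n)%N)%classic.

Let p01' : 0 <= p <= 1. Proof. by case/andP: p01 => *; rewrite !ltW. Qed.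
Let s : R := Num.sqrt (p * (1 - p)).
Let s_gt0 : 0 < s.
Proof. by case/andP: p01 => *; rewrite sqrtr_gt0 mulr_gt0 // subr_gt0. Qed.
Let c : R := 8 / (3 * pi) * s.
Let c_gt0 : 0 < c. Proof. by rewrite mulr_gt0 // divr_gt0 // mulr_gt0 // pi_gt0. Qed.

Let nu n k : R := part_frac R (V n) k.
Let K n := multipartite_edges (m n) (V n).
Let E n (G : {set {set 'I_n}}) : R := energy R (G :&: K n)%SET.
Let X n : R := n%:R * Num.sqrt n%:R.
Let S n : R := \sum_(0 <= k < r) nu n k * Num.sqrt (nu n k).

Let nu_ge0 n k : 0 <= nu n k. Proof. by rewrite divr_ge0. Qed.

Let S_ge0 n : 0 <= S n.
Proof. by apply: sumr_ge0 => k _; rewrite mulr_ge0 // sqrtr_ge0. Qed.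

Let nuE n k : (0 < n)%N -> #|V n k|%:R = nu n k * n%:R :> R.
Proof. by move=> n0; rewrite /nu /part_frac divfK // pnatr_eq0 -lt0n. Qed.

Let nu_sum n : (2 <= n)%N -> \sum_(0 <= k < m n) nu n k = 1.
Proof.
move=> n2; have [_ P] := partsV n2; rewrite /nu /part_frac -mulr_suml.
by rewrite (card_parts R P) divff // pnatr_eq0 -lt0n; apply: leq_trans n2.
Qed.

Let X_gt0 n : (0 < n)%N -> 0 < X n.
Proof. by move=> n0; apply: mulr_gt0; rewrite ?sqrtr_gt0 ltr0n. Qed.

Let partX n k : (0 < n)%N ->
  #|V n k|%:R * Num.sqrt #|V n k|%:R = nu n k * Num.sqrt (nu n k) * X n.
Proof. by move=> n0; rewrite nuE // sqrtrM // /X mulrACA. Qed.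

(** One factor sqrt l comes out of each term, and the fractions sum to at most 1. For l < 1 this
    keeps 1 - S n away from 0. *)
Let S_le n l : (2 <= n)%N -> (r <= m n)%N ->
  (forall k, (k < m n)%N -> nu n k <= l) -> S n <= Num.sqrt l.
Proof.
move=> n2 rmn nul; rewrite -[leRHS]mul1r -(nu_sum n2) (big_cat_nat (leq0n r) rmn) /=.
rewrite mulrDl; apply: ler_wpDr; first by rewrite mulr_ge0 ?sqrtr_ge0 // sumr_ge0.
rewrite mulr_suml /S; apply: ler_sum_nat => k /andP[_ kr].
by apply: ler_wpM2l => //; rewrite ler_wsqrtr // nul // (leq_trans kr).
Qed.

Lemma energy_bounds (eps : R) : 0 < eps ->
    (\big[Num.max/0]_(r <= k < m n) nu n k @[n --> \oo] --> (0 : R))%classic ->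
  (\forall n \near \oo, bprob p (fun G =>
     ~ (c * (1 - S n) - eps) * X n <= @E n G <= (c * (1 + S n) + eps) * X n)
     <= eps)%classic.
Proof.
(* Three errors of eps / 4 in units of n^(3/2): the r + 1 concentrated blocks, the small parts, and
   the means 2 n. *)
move=> e0 tail; pose e1 := eps / (4 * r.+1%:R).
have r0 : 0 < r.+1%:R :> R by rewrite ltr0n.
have e10 : 0 < e1 by rewrite divr_gt0 // mulr_gt0.
pose beta := eps / 4; have b0 : 0 < beta by rewrite divr_gt0.
have conc := trnorm_concentration p01 e10.
near=> n.
have n2 : (2 <= n)%N by near: n; exact: nbhs_infty_ge.
have n0 : (0 < n)%N by apply: leq_trans n2.
have [_ P] := partsV n2.
have rmn : (r <= m n)%N by near: n.
have cn : forall U : {set 'I_n},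
    bprob p (fun G => ~ `|trnorm (wig p (inside U) G)
        - 8 / (3 * pi) * s * (#|U|%:R * Num.sqrt #|U|%:R)|
        <= e1 * (n%:R * Num.sqrt n%:R))
    <= 16 / e1 ^+ 2 / n%:R by near: n.
have small k : (r <= k < m n)%N -> #|V n k|%:R <= beta ^+ 2 * n%:R.
  move=> rk; rewrite nuE // ler_pM2r ?ltr0n //.
  apply: (@le_trans _ _ (\big[Num.max/0]_(r <= k < m n) nu n k)).
    by apply: le_bigmax_seq; rewrite // mem_index_iota.
  apply/ltW; near: n; apply: (cvgr_lt 0 tail); exact: exprn_gt0.
have nbig : r.+1%:R * (16 / e1 ^+ 2) / eps <= n%:R by near: n; exact: nbhs_infty_ger.
have nbig2 : (8 / eps) ^+ 2 <= n%:R by near: n; exact: nbhs_infty_ger.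
have nR0 : 0 < n%:R :> R by rewrite ltr0n.
have sqrt_big : 8 / eps <= Num.sqrt n%:R.
  have e8 : 0 <= 8 / eps by rewrite divr_ge0 // ltW.
  by rewrite -[leLHS]ger0_norm // -sqrtr_sqr ler_wsqrtr.
pose bad U (G : {set {set 'I_n}}) := ~ `|trnorm (wig p (inside U) G)
        - 8 / (3 * pi) * s * (#|U|%:R * Num.sqrt #|U|%:R)|
        <= e1 * (n%:R * Num.sqrt n%:R).
apply: (@le_trans _ _ (bprob p (fun G => bad [set: 'I_n]%SET G \/
    exists2 k, (k < r)%N & bad (V n k) G))); last first.
  apply: le_trans (bprobU p01' _ _) _.
  apply: (@le_trans _ _ (16 / e1 ^+ 2 / n%:R + r%:R * (16 / e1 ^+ 2 / n%:R))).
    by apply: lerD; [exact: cn|apply: bprob_bigU => // k; exact: cn].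
  have -> : 16 / e1 ^+ 2 / n%:R + r%:R * (16 / e1 ^+ 2 / n%:R) =
     r.+1%:R * (16 / e1 ^+ 2) / n%:R by rewrite -natr1; ring.
  by rewrite ler_pdivrMr // [eps * _]mulrC -ler_pdivrMr.
apply: ler_bprob => // G H; apply: contrapT => nB; apply: H.
have good U : (U = [set: 'I_n]%SET \/ exists2 k, (k < r)%N & U = V n k) ->
   `|trnorm (wig p (inside U) G) - c * (#|U|%:R * Num.sqrt #|U|%:R)| <= e1 * X n.
  move=> HU; apply: contrapT => bU; apply: nB.
  by case: HU bU => [->|[k kr ->]] bU; [left|right; exists k].
have := energy_approx P p01 rmn b0 small G n0.
have := good _ (or_introl erefl); rewrite cardsT card_ord -/(X n).
have Gk : `|\sum_(0 <= k < r) trnorm (wig p (inside (V n k)) G) - c * S n * X n|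
    <= r%:R * (e1 * X n).
  have -> : c * S n * X n = \sum_(0 <= k < r) c * (#|V n k|%:R * Num.sqrt #|V n k|%:R).
    rewrite -mulrA mulr_suml mulr_sumr; apply: eq_bigr => k _.
    by rewrite partX.
  rewrite -sumrB; apply: le_trans (ler_norm_sum _ _ _) _.
  apply: (@le_trans _ _ (\sum_(0 <= k < r) e1 * X n)).
    by apply: ler_sum_nat => k /andP[_ kr]; apply: good; right; exists k.
  by rewrite sumr_const_nat subn0 mulr_natl.
move: Gk; set A := \sum_(0 <= k < r) _; set W := trnorm _; rewrite -/(@E n G).
have n_small : 2 * n%:R <= eps / 4 * X n.
  have -> : 2 * n%:R = eps / 4 * (n%:R * (8 / eps)) :> R by field; exact: lt0r_neq0.
  by rewrite ler_pM2l ?divr_gt0 // /X ler_pM2l.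
have e1E : e1 * X n + r%:R * (e1 * X n) = eps / 4 * X n.
  rewrite /e1 -[r.+1%:R]natr1 /=; field.
  by rewrite natr1 pnatr_eq0.
rewrite -/(X n) /beta !ler_norml => /andP[? ?] /andP[? ?] /andP[? ?].
apply/andP; split; lra.
Unshelve. all: by end_near.
Qed.

(* When the largest part fraction tends to 1, the factor 1 - S n tends to 0, so the
   lower bound needs this version without additive error. *)
Lemma energy_degenerate_bound (eps L : R) : 0 < eps -> 1 <= L ->
    (\big[Num.max/0]_(0 <= k < m n) nu n k @[n --> \oo] --> L)%classic ->
    (\big[Num.max/0]_(r <= k < m n) nu n k @[n --> \oo] --> (0 : R))%classic ->
  (\forall n \near \oo,
     bprob p (fun G => ~ c * (1 - S n) * X n <= @E n G) <= eps)%classic.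
Proof.
move=> e0 L1 maxL tail.
have s2 : 0 < s ^+ 2 by rewrite exprn_gt0.
(* The first value ensures |U| >= 81/100 n; the second makes 64 / s^2 times the fraction outside [U]
   at most eps / 2. *)
pose eta := Num.min (19 / 100) (eps * s ^+ 2 / 128).
have eta0 : 0 < eta by rewrite lt_min divr_gt0 //= divr_gt0 // mulr_gt0.
have eta1 : eta <= 19 / 100 by rewrite ge_min lexx.
have eta2 : eta <= eps * s ^+ 2 / 128 by rewrite ge_min lexx orbT.
near=> n.
have n2 : (2 <= n)%N by near: n; exact: nbhs_infty_ge.
have n0 : (0 < n)%N by apply: leq_trans n2.
have nR0 : 0 < n%:R :> R by rewrite ltr0n.
have [_ P] := partsV n2.
have rmn : (r <= m n)%N by near: n.
have big_max : 1 - eta < \big[Num.max/0]_(0 <= k < m n) nu n k.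
  by near: n; apply: (cvgr_gt L maxL); lra.
have big_tail : \big[Num.max/0]_(r <= k < m n) nu n k < 1 - eta.
  by near: n; apply: (cvgr_lt 0 tail); lra.
have nbig : 1000 / eps <= n%:R by near: n; exact: nbhs_infty_ger.
(* The tail is too small to contain the dominating part, so its index is below r and its term occurs
   in [S n]. *)
have [k0 k0r nuk] : exists2 k, (k < r)%N & 1 - eta <= nu n k.
  apply: contrapT => H; move: big_max; rewrite ltNge => /negP; apply.
  rewrite big_seq; apply: bigmax_le; first by lra.
  move=> k; rewrite mem_index_iota => /andP[_ km]; rewrite leNgt; apply/negP => Hk.
  have [kr|rk] := ltnP k r; first by apply: H; exists k => //; exact: ltW.
  have : nu n k <= \big[Num.max/0]_(r <= k < m n) nu n k.
    by apply: le_bigmax_seq; rewrite // mem_index_iota rk.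
  lra.
have k0m : (k0 < m n)%N by apply: leq_trans rmn.
pose U := V n k0.
have UE : #|U|%:R = nu n k0 * n%:R :> R by exact: nuE.
have Un : 81 / 100 * n%:R <= #|U|%:R :> R by rewrite UE ler_pM2r //; lra.
have U0 : (0 < #|U|)%N by rewrite -(ltr0n R); apply: lt_le_trans Un; rewrite mulr_gt0.
have kE : #|~: U|%:R = (1 - nu n k0) * n%:R :> R.
  rewrite mulrBl mul1r -UE; apply/eqP; rewrite eq_sym subr_eq -natrD addnC.
  by rewrite cardsC card_ord.
pose A (G : {set {set 'I_n}}) := adjmx R (G :&: K n)%SET.
have sA G : (A G)^T = A G.
  by apply/matrixP => i j; rewrite !mxE eq_sym finset.setUC.
have AC G i j : cross U i j -> A G i j = wig p (cross U) G i j + p.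
  move=> cij; have ij : i != j by apply: contraL cij => /eqP ->; rewrite /cross eqxx.
  rewrite !mxE ij cij /= finset.in_setI /K (mem_multipartite_edges P ij).
  rewrite (_ : same_part (m n) (V n) 0 i j = false) ?andbT ?subrK //.
  apply/negbTE/existsPn => k; apply/negP => /and3P[_ ik jk]; move: cij; rewrite /cross /U.
  have [iU|iU] := boolP (i \in V n k0).
    have Ek := parts_inj P (ltn_ord k) k0m ik iU.
    by rewrite -Ek jk.
  have [jU|//] := boolP (j \in V n k0).
  have Ek := parts_inj P (ltn_ord k) k0m jk jU.
  by move: iU; rewrite -Ek ik.
have prob := trnorm_cut_prob p01 U0 sA AC Un.
have bound : 64 / s ^+ 2 * (#|~: U|%:R / n%:R) + 500 / n%:R <= eps.
  have -> : eps = eps / 2 + eps / 2 by field.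
  apply: lerD; last first.
    rewrite ler_pdivrMr // mulrC -ler_pdivrMr ?divr_gt0 //.
    by apply: le_trans nbig; rewrite le_eqVlt; apply/orP; left; apply/eqP; field; exact: lt0r_neq0.
  rewrite kE mulfK ?lt0r_neq0 //.
  have -> : eps / 2 = 64 / s ^+ 2 * (eps * s ^+ 2 / 128) by field; exact: lt0r_neq0.
  by rewrite ler_pM2l ?divr_gt0 //; lra.
apply: le_trans bound; apply: le_trans prob.
apply: ler_bprob => // G nE H; apply: nE; apply: le_trans (le_trans H _); last first.
  by rewrite /E energy_trnorm.
rewrite kE -/s; have nu1 : nu n k0 <= 1.
  rewrite -(nu_sum n2) (bigD1_seq k0) ?iota_uniq ?mem_index_iota //= lerDl.
  exact: sumr_ge0.
(* With z^2 the dominating fraction, 3/2 (1 - z^2) - (1 - z^3) = (z - 1)^2 (z + 1/2). *)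
have S1 : 1 - S n <= 3 / 2 * (1 - nu n k0).
  have Sk : nu n k0 * Num.sqrt (nu n k0) <= S n.
    rewrite /S (bigD1_seq k0) ?iota_uniq ?mem_index_iota //= lerDl.
    by apply: sumr_ge0 => k _; rewrite mulr_ge0 // sqrtr_ge0.
  apply: (@le_trans _ _ (1 - nu n k0 * Num.sqrt (nu n k0))); first by rewrite lerB.
  have := sqr_sqrtr (nu_ge0 n k0); have := sqrtr_ge0 (nu n k0).
  move: (Num.sqrt _) => z z0 <-.
  have : 0 <= (z - 1) ^+ 2 * (z + 2^-1) by rewrite mulr_ge0 ?sqr_ge0 // addr_ge0.
  have -> : (z - 1) ^+ 2 * (z + 2^-1) = z ^+ 3 - 3 / 2 * z ^+ 2 + 1 / 2 by field.
  have -> : z ^+ 2 * z = z ^+ 3 by ring.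
  lra.
have q0 : 0 < Num.sqrt n%:R :> R by rewrite sqrtr_gt0.
apply: (@le_trans _ _ (c * (3 / 2 * (1 - nu n k0)) * X n)).
  by rewrite ler_pM2r ?X_gt0 // ler_pM2l.
have -> : c * (3 / 2 * (1 - nu n k0)) * X n =
    (4 / pi) * (s * ((1 - nu n k0) * n%:R) * Num.sqrt n%:R).
  rewrite /c /X; move: (pi : R) (pi_gt0 R) => w w0.
  by field; exact: lt0r_neq0.
rewrite -2!(mulrA (27 / 20)); apply: ler_wpM2r.
  by rewrite !mulr_ge0 ?subr_ge0 // ltW.
by rewrite ler_pdivrMr ?pi_gt0 //; have := pi_ge_80_27; lra.
Unshelve. all: by end_near.
Qed.

(** An additive error must be absorbed into a relative one. If L < 1, then S n <= sqrt l < 1 and eps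
    (1 - S n) absorbs it. If L >= 1, the upper bound still absorbs it since 1 + S n >= 1, and the
    lower bound comes from [energy_degenerate_bound], where 1 - S n >= 0 allows c to be replaced by
    c - eps. *)
Lemma energy_concentration (eps L e2 : R) : 0 < eps -> 0 < e2 ->
    (\big[Num.max/0]_(0 <= k < m n) nu n k @[n --> \oo] --> L)%classic ->
    (\big[Num.max/0]_(r <= k < m n) nu n k @[n --> \oo] --> (0 : R))%classic ->
  (\forall n \near \oo, bprob p (fun G =>
     ~ (1 - S n) * (c - eps) * X n <= @E n G <= (1 + S n) * (c + eps) * X n)
     <= e2)%classic.
Proof.
move=> e0 e20 maxL tail; have [L1|L1] := ltP L 1.
  pose l := (1 + Num.max L 0) / 2.
  have ML : Num.max L 0 < 1 by rewrite gt_max L1 ltr01.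
  have M0 : 0 <= Num.max L 0 by rewrite le_max lexx orbT.
  have lL : L < l by have : L <= Num.max L 0 := ltac:(by rewrite le_max lexx); rewrite /l; lra.
  have l0 : 0 <= l by rewrite /l; lra.
  have l1 : Num.sqrt l < 1 by rewrite -[ltRHS]sqrtr1 ltr_sqrt // /l; lra.
  pose e1 := Num.min e2 (eps * (1 - Num.sqrt l)).
  have d0 : 0 < 1 - Num.sqrt l by rewrite subr_gt0.
  have e10 : 0 < e1 by rewrite lt_min e20 mulr_gt0.
  have e12 : e1 <= e2 by rewrite ge_min lexx.
  have e1d : e1 <= eps * (1 - Num.sqrt l) by rewrite ge_min lexx orbT.
  near=> n.
  have n2 : (2 <= n)%N by near: n; exact: nbhs_infty_ge.
  have X0 : 0 < X n by apply: X_gt0; apply: leq_trans n2.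
  have maxn : \big[Num.max/0]_(0 <= k < m n) nu n k < l.
    by near: n; exact: (cvgr_lt L maxL).
  have rmn : (r <= m n)%N by near: n.
  have SL : S n <= Num.sqrt l.
    apply: S_le => // k km; rewrite ltW // (le_lt_trans _ maxn) //.
    by apply: le_bigmax_seq; rewrite // mem_index_iota.
  have H : bprob p (fun G =>
     ~ (c * (1 - S n) - e1) * X n <= @E n G <= (c * (1 + S n) + e1) * X n) <= e1.
    by near: n; exact: energy_bounds.
  apply: le_trans e12; apply: le_trans H; apply: ler_bprob => // G nH H.
  apply: nH; case/andP: H => lo up; apply/andP; split.
    apply: le_trans lo; rewrite ler_pM2r //.
    have : eps * (1 - Num.sqrt l) <= eps * (1 - S n) by rewrite ler_pM2l //; lra.
    lra.
  apply: le_trans up _; rewrite ler_pM2r //.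
  have : 0 <= eps * S n by rewrite mulr_ge0 // ltW.
  have : eps * (1 - Num.sqrt l) <= eps.
    by rewrite ler_piMr ?(ltW e0) //; have := sqrtr_ge0 l; lra.
  lra.
pose e1 := Num.min (e2 / 2) eps.
have e10 : 0 < e1 by rewrite lt_min divr_gt0.
have e12 : e1 <= e2 / 2 by rewrite ge_min lexx.
have e1e : e1 <= eps by rewrite ge_min lexx orbT.
near=> n.
have n2 : (2 <= n)%N by near: n; exact: nbhs_infty_ge.
have X0 : 0 < X n by apply: X_gt0; apply: leq_trans n2.
have H1 : bprob p (fun G =>
   ~ (c * (1 - S n) - e1) * X n <= @E n G <= (c * (1 + S n) + e1) * X n) <= e1.
  by near: n; exact: energy_bounds.
have H2 : bprob p (fun G => ~ c * (1 - S n) * X n <= @E n G) <= e1.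
  by near: n; apply: (@energy_degenerate_bound e1 L).
have -> : e2 = e2 / 2 + e2 / 2 by field.
apply: le_trans (lerD (le_trans H1 e12) (le_trans H2 e12)).
apply: le_trans (bprobU p01' _ _); apply: ler_bprob => // G nH.
apply: contrapT => /not_orP[/contrapT/andP[lo1 up] /contrapT lo2]; apply: nH.
have E0 : 0 <= @E n G by rewrite /E energy_trnorm trnorm_ge0.
apply/andP; split.
  have S1 : S n <= 1.
    rewrite -[leRHS]sqrtr1; apply: S_le => // [|k km]; first by near: n.
    rewrite -(nu_sum n2) (bigD1_seq k) ?iota_uniq ?mem_index_iota //= lerDl.
    exact: sumr_ge0.
  apply: le_trans lo2; rewrite ler_pM2r // mulrC ler_wpM2r //; lra.
apply: le_trans up _; rewrite ler_pM2r //.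
have : 0 <= eps * S n by rewrite mulr_ge0 // ltW.
lra.
Unshelve. all: by end_near.
Qed.

End Assembly.

(** * The random multipartite graph *)

Local Open Scope classical_set_scope.

Theorem theorem3p3 (R : realType) (p : R) (m : nat -> nat)
    (V : forall n : nat, nat -> {set 'I_n}) (r : nat)
    (nu := fun n i : nat => part_frac R (V n) i) :
  0 < p < 1 ->
  (forall n : nat, (2 <= n)%N -> (2 <= m n)%N /\ is_parts (m n) (V n)) ->
  (exists2 L : R, 0 < L &
     \big[Num.max/0]_(0 <= i < m n) nu n i @[n --> \oo] --> L) ->
  (exists i j : nat,
     (\forall n \near \oo, (i < m n)%N /\ (j < m n)%N) /\
     (exists2 l : R, l < 1 & nu n i / nu n j @[n --> \oo] --> l)) ->
  (1 <= r)%N ->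
  (\forall n \near \oo, (r <= m n)%N) ->
  (exists2 c : R, 0 < c &
     \forall n \near \oo, forall i : nat, (i < r)%N -> c <= nu n i) ->
  \big[Num.max/0]_(r <= s < m n) nu n s @[n --> \oo] --> (0 : R) ->
  forall eps : R, 0 < eps ->
  almost_every p m V (fun n G =>
    exists2 eta : R, `|eta| <= eps &
      (1 - \sum_(0 <= i < r) nu n i `^ (3 / 2)) * n%:R `^ (3 / 2)
      <= energy R G * (8 / (3 * pi) * Num.sqrt (p * (1 - p)) + eta)^-1
      <= (1 + \sum_(0 <= i < r) nu n i `^ (3 / 2)) * n%:R `^ (3 / 2)).
Proof.
move=> p01 partsV [L _ maxL] _ _ rm _ tail eps e0.
have p01' : 0 <= p <= 1 by case/andP: p01 => *; rewrite !ltW.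
set c := 8 / (3 * pi) * Num.sqrt (p * (1 - p)).
have c0 : 0 < c.
  case/andP: p01 => p0 p1; rewrite mulr_gt0 ?divr_gt0 // ?mulr_gt0 ?pi_gt0 //.
  by rewrite sqrtr_gt0 mulr_gt0 // subr_gt0.
(* Capping the tolerance below c keeps c + eta positive, so that inverting it preserves the
   inequalities. *)
pose e1 := Num.min eps (c / 2).
have e10 : 0 < e1 by rewrite lt_min e0 divr_gt0.
have e1e : e1 <= eps by rewrite ge_min lexx.
have e1c : e1 < c.
  by apply: (@le_lt_trans _ _ (c / 2)); [rewrite ge_min lexx orbT|lra].
apply/cvgrPdist_le => e2 e20; near=> n.
have n0 : (0 < n)%N by near: n; exact: nbhs_infty_gt.
rewrite edge_probE; set Q := (X in bprob p X).
have bp : bprob p (fun G => ~ Q G) <= e2; last first.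
  rewrite bprobC in bp; rewrite ger0_norm // subr_ge0; exact: bprob_le1.
have H : bprob p (fun G : {set {set 'I_n}} =>
     ~ (1 - \sum_(0 <= k < r) nu n k * Num.sqrt (nu n k)) * (c - e1)
         * (n%:R * Num.sqrt n%:R)
       <= energy R (G :&: multipartite_edges (m n) (V n))%SET
       <= (1 + \sum_(0 <= k < r) nu n k * Num.sqrt (nu n k)) * (c + e1)
         * (n%:R * Num.sqrt n%:R)) <= e2.
  by near: n; exact: (energy_concentration p01 partsV rm e10 e20 maxL tail).
apply: le_trans H; apply: ler_bprob => // G nQ /andP[lo up]; apply: nQ.
have nu0 k : 0 <= nu n k by rewrite divr_ge0.
rewrite /Q powR32 // (eq_bigr (fun k => nu n k * Num.sqrt (nu n k))); last first.
  by move=> k _; rewrite powR32.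
have [|||eta etae HE] := eta_exists e10 e1c _ _ _ lo up.
- by apply: sumr_ge0 => k _; rewrite mulr_ge0 // sqrtr_ge0.
- by apply: mulr_gt0; rewrite ?sqrtr_gt0 ltr0n.
- by rewrite energy_trnorm trnorm_ge0.
- by exists eta => //; exact: le_trans e1e.
Unshelve. all: by end_near.
Qed.
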